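(* Assume (A1)–(A3) and (B1). Let $\mathbf{w}_M\in\mathbb{R}^d$ be random vectors with $\mathbf{w}_M\to\mathbf{w}=(w_1,\dots,w_d)$ $P_x$-almost surely for every $x\in\mathsf{X}$, where $w_i\neq0$ for all $i$. Let $\boldsymbol\delta=(\delta_1,\dots,\delta_d)$ satisfy $0<\delta_i\le\Delta(F_{g_i})$ for all $i$. Then for all $1\le i,j\le d$ and every $x\in\mathsf{X}$, $P_x$-almost surely as $M\to\infty$: (1) $\sum_{k\in\mathbb{Z}}\{\hat\gamma^{(\boldsymbol\delta)}_{M,ij}(k;\mathbf{w}_M)-\gamma_{g_i,g_j}(k)\}^2\to0$; (2) $\big|\sum_{k\in\mathbb{Z}}\hat\gamma^{(\boldsymbol\delta)}_{M,ij}(k;\mathbf{w}_M)-\sum_{k\in\mathbb{Z}}\gamma_{g_i,g_j}(k)\big|\to0$.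
   Context: Let $(\mathsf{X},\mathscr{X})$ be a complete separable metric space with Borel $\sigma$-algebra, $\pi$ a probability measure, $Q$ a Markov kernel, $X=(X_0,X_1,\dots)$ a Markov chain with kernel $Q$, and $P_x$ the law of the chain started at $X_0=x$. (A1): $X$ is $\psi$-irreducible, aperiodic and positive Harris recurrent. (A2): $Q$ is $\pi$-reversible. (A3): there exist $\rho<1$ and a nonnegative function $M(\cdot)$ with $\|Q^n(x,\cdot)-\pi\|_{TV}\le M(x)\rho^n$ for all $x,n$. $g=(g_1,\dots,g_d)$ satisfies (B1): $\int g_j^2d\pi<\infty$. For real $f_1,f_2\in L^2(\pi)$: $\gamma_{f_1f_2}(k)=\mathrm{Cov}_\pi(f_1(X_0),f_2(X_k))$ for $k\ge0$, $\mathrm{Cov}_\pi(f_1(X_{|k|}),f_2(X_0))$ for $k<0$ (stationary chain); $\gamma_f=\gamma_{ff}$, $\gamma_{g_i,g_j}=\gamma_{g_ig_j}$. $F_f$ is the unique positive measure on $[-1,1]$ with $\gamma_f(k)=\int\alpha^{|k|}F_f(d\alpha)$ (convention $0^0=1$); $\Delta(F)=1-\max\{|x|:x\in\mathrm{Supp}F\}$. $\mathscr{M}_\infty(b)$ is the set of sequences $m(k)=\int x^{|k|}\mu(dx)$, $k\in\mathbb{Z}$, with $\mu$ a positive measure on $[-b,b]$; for $r\in\ell_2(\mathbb{Z})$, $\Pi_\delta(r)=\arg\min_{m\in\mathscr{M}_\infty(1-\delta)}\sum_k(r(k)-m(k))^2$. For a real function $f$ (possibly depending on random coefficients), $r_{M,f}(k)=\frac1M\sum_{t=0}^{M-1-|k|}(f(X_t)-\bar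 f_M)(f(X_{t+|k|})-\bar f_M)$ for $|k|<M$ and $0$ otherwise, $\bar f_M=\frac1M\sum_{t=0}^{M-1}f(X_t)$. The estimator: with $\delta_{ij}=\min\{\delta_i,\delta_j\}$, $\hat\gamma^{(\boldsymbol\delta)}_{M,ii}(\cdot;\mathbf{w}_M)=\Pi_{\delta_i}(r_{M,g_i})$; for $i<j$ (and whenever $w_{Mi}w_{Mj}\ne0$) $\hat\gamma^{(\boldsymbol\delta)}_{M,ij}(\cdot;\mathbf{w}_M)=\frac{1}{4w_{Mi}w_{Mj}}\{\Pi_{\delta_{ij}}(r_{M,w_{Mi}g_i+w_{Mj}g_j})-\Pi_{\delta_{ij}}(r_{M,w_{Mi}g_i-w_{Mj}g_j})\}$; for $i>j$, $\hat\gamma^{(\boldsymbol\delta)}_{M,ij}=\hat\gamma^{(\boldsymbol\delta)}_{M,ji}$. *)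

(* Defs.v *)
From HB Require Import structures.
From mathcomp Require Import all_boot all_order all_algebra.
From mathcomp Require Import all_classical all_reals all_analysis.
Import Order.TTheory GRing.Theory Num.Theory.
Import numFieldNormedType.Exports.

Set Implicit Arguments.
Unset Strict Implicit.
Unset Printing Implicit Defensive.

Local Open Scope classical_set_scope.
Local Open Scope ring_scope.

Section Defs.
Context {R : realType}.

Definition metric_open (T : Type) (dist : T -> T -> R) : set (set T) :=
  fun U => forall x, U x -> exists2 e : R, 0 < e & forall y, dist x y < e -> U y.

Definition polish_borel d (T : measurableType d) (dist : T -> T -> R) : Prop :=
  (forall x y, 0 <= dist x y) /\
  (forall x y, dist x y = 0 <-> x = y) /\
  (forall x y, dist x y = dist y x) /\
  (forall x y z, dist x z <= dist x y + dist y z) /\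
      (forall u : nat -> T,
          (forall e, 0 < e -> exists N, forall m n, (N <= m)%N -> (N <= n)%N ->
              dist (u m) (u n) < e) ->
          exists l, forall e, 0 < e -> exists N, forall n, (N <= n)%N -> dist (u n) l < e) /\
      (exists D : set T, countable D /\
          forall x e, 0 < e -> exists2 y, D y & dist x y < e) /\
      (@measurable d T = <<s metric_open dist >>).

Fixpoint Qn d (T : measurableType d) (Q : R.-pker T ~> T) (n : nat) (x : T)
    (A : set T) : \bar R :=
  match n with
  | 0 => (\1_A x)%:E
  | n.+1 => (\int[Q x]_y Qn Q n y A)%E
  end.

(** Finite-dimensional distributions of a Markov chain with kernel Q:
    tailV Q A m n x = int Q(x,dy_m) 1_{A m}(y_m) ... Q(y_{m+n-2},dy_{m+n-1}) 1_{A (m+n-1)} *)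
Fixpoint tailV d (T : measurableType d) (Q : R.-pker T ~> T) (A : nat -> set T)
    (m n : nat) (x : T) : \bar R :=
  match n with
  | 0 => 1%E
  | n.+1 => (\int[Q x]_y ((\1_(A m) y)%:E * tailV Q A m.+1 n y))%E
  end.

Definition markov_chain d (T : measurableType d) dO (Om : measurableType dO)
    (Q : R.-pker T ~> T) (mu : {measure set T -> \bar R})
    (P : probability Om R) (X : nat -> Om -> T) : Prop :=
  (forall n, measurable_fun setT (X n)) /\
  forall (A : nat -> set T) (n : nat), (forall i, measurable (A i)) ->
    P (\bigcap_(i in [set k | (k <= n)%N]) (X i @^-1` A i)) =
    (\int[mu]_x ((\1_(A 0%N) x)%:E * tailV Q A 1 n x))%E.

Definition irred_measure d (T : measurableType d) (Q : R.-pker T ~> T)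
    (psi : {measure set T -> \bar R}) : Prop :=
  (0 < psi setT)%E /\
  forall A, measurable A -> (0 < psi A)%E ->
    forall x, exists n, (0 < n)%N /\ (0 < Qn Q n x A)%E.

Definition max_irred_measure d (T : measurableType d) (Q : R.-pker T ~> T)
    (psi : {measure set T -> \bar R}) : Prop :=
  irred_measure Q psi /\
  forall phi : {measure set T -> \bar R}, irred_measure Q phi ->
    forall A, measurable A -> psi A = 0%E -> phi A = 0%E.

Definition d_cycle d (T : measurableType d) (Q : R.-pker T ~> T)
    (psi : {measure set T -> \bar R}) (k : nat) (D : nat -> set T) : Prop :=
  [/\ (forall i, measurable (D i)),
      (forall i j, (i < k)%N -> (j < k)%N -> i != j -> D i `&` D j = set0),
      (forall i x, (i < k)%N -> D i x -> Q x (D (i.+1 %% k)%N) = 1%E) &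
      psi (~` \bigcup_(i in [set i | (i < k)%N]) D i) = 0%E].

Definition aperiodic d (T : measurableType d) (Q : R.-pker T ~> T)
    (psi : {measure set T -> \bar R}) : Prop :=
  forall k D, (2 <= k)%N -> ~ d_cycle Q psi k D.

Definition harris_recurrent d (T : measurableType d) dO (Om : measurableType dO)
    (Q : R.-pker T ~> T) (psi : {measure set T -> \bar R})
    (P : T -> probability Om R) (X : nat -> Om -> T) : Prop :=
  forall A, measurable A -> (0 < psi A)%E -> forall x,
    P x (\bigcap_n \bigcup_(m in [set m | (n <= m)%N]) (X m @^-1` A)) = 1%E.

Definition invariant d (T : measurableType d) (Q : R.-pker T ~> T)
    (mu : probability T R) : Prop :=
  forall A, measurable A -> mu A = (\int[mu]_x Q x A)%E.

Definition A1 d (T : measurableType d) dO (Om : measurableType dO)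
    (Q : R.-pker T ~> T) (P : T -> probability Om R) (X : nat -> Om -> T) : Prop :=
  exists psi : {measure set T -> \bar R},
    [/\ max_irred_measure Q psi, aperiodic Q psi, harris_recurrent Q psi P X &
        exists mu : probability T R, invariant Q mu].

Definition reversible d (T : measurableType d) (Q : R.-pker T ~> T)
    (pi : probability T R) : Prop :=
  forall A B, measurable A -> measurable B ->
    (\int[pi]_(x in A) Q x B)%E = (\int[pi]_(x in B) Q x A)%E.

Definition tv_dist d (T : measurableType d) (Q : R.-pker T ~> T)
    (pi : probability T R) (n : nat) (x : T) : \bar R :=
  ereal_sup [set `|(Qn Q n x A - pi A)%E|%E | A in @measurable d T].

Definition A3 d (T : measurableType d) (Q : R.-pker T ~> T)
    (pi : probability T R) : Prop :=
  exists (rho : R) (M : T -> R), rho < 1 /\ (forall x, 0 <= M x) /\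
    forall x n, (tv_dist Q pi n x <= (M x * rho ^+ n)%:E)%E.

Definition B1 d (T : measurableType d) (pi : probability T R) (dd : nat)
    (g : 'I_dd -> T -> R) : Prop :=
  forall j, measurable_fun setT (g j) /\ (\int[pi]_x ((g j x) ^+ 2)%:E < +oo)%E.

(** * Stationary cross-covariances gamma_{f1 f2}(k), computed on a stationary
      chain Xs under Ps (initial law pi) *)
Definition gamma dO (Om : measurableType dO) (Ps : probability Om R) d
    (T : measurableType d) (Xs : nat -> Om -> T) (f1 f2 : T -> R) (k : int) : R :=
  if (0 <= k) then fine (covariance Ps (f1 \o Xs 0%N) (f2 \o Xs `|k|%N))
  else fine (covariance Ps (f1 \o Xs `|k|%N) (f2 \o Xs 0%N)).

Definition spectral_measure_of (gam : int -> R) (F : {measure set R -> \bar R}) : Prop :=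
  [/\ F (~` `[-1, 1]) = 0%E, (F setT < +oo)%E &
      forall k : int, (gam k)%:E = (\int[F]_a (a ^+ `|k|%N)%:E)%E].

Definition oball (x e : R) : set R := `]x - e, x + e[.

Definition supp (F : {measure set R -> \bar R}) : set R :=
  [set x | forall e : R, 0 < e -> (0 < F (oball x e))%E].

(** convention: max over the empty support is 0 *)
Definition Delta (F : {measure set R -> \bar R}) : R :=
  1 - sup ([set `|x| | x in supp F] `|` [set 0]).

Definition in_Minf (b : R) (m : int -> R) : Prop :=
  exists mu : {measure set R -> \bar R},
    [/\ mu (~` `[-b, b]) = 0%E, (mu setT < +oo)%E &
        forall k : int, (m k)%:E = (\int[mu]_a (a ^+ `|k|%N)%:E)%E].

Definition ssq (r m : int -> R) : \bar R :=
  \esum_(k in [set: int]) ((r k - m k) ^+ 2)%:E.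

Definition is_proj (b : R) (r m : int -> R) : Prop :=
  in_Minf b m /\ forall m', in_Minf b m' -> (ssq r m <= ssq r m')%E.

Definition Pi (delta : R) (r : int -> R) : int -> R :=
  xget (fun _ => 0) (is_proj (1 - delta) r).

Definition autocov (M : nat) (y : nat -> R) (k : int) : R :=
  let a := `|k|%N in
  let ybar := M%:R^-1 * \sum_(t < M) y t in
  if (a < M)%N then M%:R^-1 * \sum_(t < M - a) ((y t - ybar) * (y (t + a)%N - ybar))
  else 0.

(** * The estimator gamma-hat^{(delta)}_{M,ij}(. ; w_M) along the path [path].
      (when w_{Mi} w_{Mj} = 0 the estimator is undefined; we set it to 0) *)
Definition gammahat d (T : measurableType d) (dd : nat) (g : 'I_dd -> T -> R)
    (delta : 'I_dd -> R) (M : nat) (w : 'I_dd -> R) (path : nat -> T)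
    (i j : 'I_dd) : int -> R :=
  let r f := autocov M (fun t => f (path t)) in
  if i == j then Pi (delta i) (r (g i)) else
  let a := if (i < j)%N then i else j in
  let b := if (i < j)%N then j else i in
  let dab := Num.min (delta a) (delta b) in
  if w a * w b != 0 then
    fun k => (4 * w a * w b)^-1 *
      (Pi dab (r (fun x => w a * g a x + w b * g b x)) k -
       Pi dab (r (fun x => w a * g a x - w b * g b x)) k)
  else fun _ => 0.

Definition sumZ (a : int -> R) : R :=
  a 0 + limn (fun n => \sum_(1 <= k < n) (a (Posz k) + a (- Posz k))).

End Defs.

(* Main.v *)
(**
The strong law holds from every starting point: under (A3) bounded harmonic functions are
constant, so shift-invariant events of the trajectory space have the same probability
p in {0, 1} under all P_x, and the maximal ergodic theorem for the stationary law
identifies the limits of averages of g_i(X_t) g_j(X_(t+k)).  Hence the empirical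
autocovariances converge lag by lag to those of the stationary chain.

A projection m of r onto the closed convex cone of moment sequences on [-b, b] satisfies
<m - r, (a^|k|)_k> >= 0 for |a| <= b and <m - r, m> <= 0.  If c defines a functional
L(p) = sum_k p_k c(k) that is nonnegative on polynomials nonnegative on [-b, b], then
|m - c|^2 <= <r - c, m - c>, and the total mass of m is bounded by a multiple of sup |r|;
lag-by-lag convergence r -> c therefore forces m -> c with a uniform geometric bound, and
both conclusions follow by dominated convergence.  Minimisers exist by Helly's selection
theorem applied to quantile functions.

For f = w_i g_i the functional L is integration against the spectral measure, carried by
[-b, b] because delta_i <= Delta(F_i).  For f+ = w_i g_i + w_j g_j and
f- = w_i g_i - w_j g_j no spectral measure is needed: reversibility gives
L+(q^2), L-(q^2) >= 0, and L+ + L- = 2 (w_i^2 L_i + w_j^2 L_j), so L+(e) is small when e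
is uniformly small on [-b, b]; approximating p by squares of polynomials gives L+(p) >= 0.
*)

Require Import Defs.
From HB Require Import structures.
From mathcomp Require Import all_boot all_order all_algebra.
From mathcomp Require Import all_classical all_reals all_analysis.
From mathcomp Require Import measurable_realfun.
From mathcomp Require Import ring lra.
Import Order.TTheory GRing.Theory Num.Theory.
Import numFieldNormedType.Exports.
Local Open Scope classical_set_scope.
Local Open Scope ring_scope.

Set Implicit Arguments.
Unset Strict Implicit.
Unset Printing Implicit Defensive.

(** * Trajectory space *)

Section path_space.
Context {d} {T : measurableType d}.

(** Three difficulties shape the development. The strong law is wanted under every [P x], whereas an
    ergodic theorem for the stationary law alone speaks of almost every starting point; convergence
    of [Q^n(x, .)] is therefore exploited at each [x] separately, the bound [M] of [A3] not being
    assumed integrable. The gap [delta i] is assumed for each [g i] alone, whereas the estimator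
    projects combinations of two of them; about such a combination reversibility only yields
    nonnegativity on squares, which has to be upgraded to nonnegativity on an interval strictly
    inside [-1, 1]. Finally the weights vary with M and with the trajectory, and so do the projected
    functions; empirical covariances are expanded bilinearly, so that the almost sure event concerns
    the fixed functions [g i] only and the rest is deterministic. Every sequence on the integers met
    here is even and is handled on [nat] with weights 1, 2, 2, ... *)

Definition cylinder (A : nat -> set T) (n : nat) : set (nat -> T) :=
  \bigcap_(i in [set k | (k <= n)%N]) [set w | A i (w i)].

Definition cylinders : set (set (nat -> T)) :=
  [set C | exists A n, (forall i, measurable (A i)) /\ C = cylinder A n].

Definition path : Type := g_sigma_algebraType cylinders.

HB.instance Definition _ := Measurable.on path.

Lemma cylinders_setI_closed : setI_closed cylinders.
Proof.
move=> _ _ [A [n [mA ->]]] [B [m [mB ->]]].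
(* A cylinder ignores [A i] for [i > n], so the shorter family is padded with [setT] before
   intersecting coordinatewise. *)
pose E (F : nat -> set T) k i := if (i <= k)%N then F i else setT.
exists (fun i => E A n i `&` E B m i), (maxn n m); split.
  by move=> i; apply: measurableI; rewrite /E; case: ifP.
apply/seteqP; split=> w /=.
- by move=> [wA wB] i _; rewrite /E; split; case: ifP => //; [exact: wA|exact: wB].
- by move=> h; split=> i /= im; have := h i; rewrite /= /E im leq_max im ?orbT;
    move=> /(_ isT) [].
Qed.

Lemma cylinders_setT : cylinders setT.
Proof.
exists (fun=> setT), 0%N; split => //.
by apply/seteqP; split => // w _ i.
Qed.

Lemma measurable_cylinder A n : (forall i, measurable (A i)) ->
  measurable (cylinder A n : set path).
Proof. by move=> mA; apply: sub_sigma_algebra; exists A, n. Qed.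

Definition coord (n : nat) (w : path) : T := w n.

Lemma measurable_coord n : measurable_fun setT (coord n).
Proof.
move=> _ B mB; rewrite setTI.
rewrite (_ : _ @^-1` _ = cylinder (fun i => if i == n then B else setT) n).
  by apply: measurable_cylinder => i; case: ifP.
apply/seteqP; split=> w /=.
- by move=> wB i /= _; case: eqP => // ->.
- by move=> /(_ n (leqnn n)) /=; rewrite eqxx.
Qed.

Lemma measurable_to_path d' (Y : measurableType d') (f : Y -> path) :
  (forall n, measurable_fun setT (fun y => f y n)) -> measurable_fun setT f.
Proof.
move=> mf; apply: (@measurability _ _ _ _ setT f cylinders) => //.
move=> _ [_ [A [n [mA ->]] <-]]; rewrite setTI.
rewrite (_ : _ @^-1` _ =
    \bigcap_(i in [set k | (k <= n)%N]) ((fun y => f y i) @^-1` A i)) //.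
apply: bigcap_measurableType => i _.
by rewrite -[X in measurable X]setTI; apply: mf.
Qed.

Definition shift (w : path) : path := fun n => w n.+1.

Lemma measurable_shift : measurable_fun setT shift.
Proof. by apply: measurable_to_path => n; exact: (measurable_coord n.+1). Qed.

Lemma iter_shift n w k : iter n shift w k = w (n + k)%N.
Proof.
elim: n w k => [//|n IH] w k; by rewrite iterS /shift -/shift IH addnS addSn.
Qed.

End path_space.

(** * Dynkin induction for families of laws, and induction on nonnegative functions *)

Section dynkin.
Import HBNNSimple.
Context d (T : measurableType d) {R : realType}.
Local Open Scope ereal_scope.

(** What Dynkin induction consumes, stated for bare set functions: mixtures and image laws can then
    be compared with probabilities without being packaged as measures. *)
Record prob_like (m : set T -> \bar R) : Prop := ProbLike {
  prob_likeT : m setT = 1;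
  prob_likeC : forall A, measurable A -> m (~` A) = 1 - m A;
  prob_likeU : forall F : (set T)^nat, (forall n, measurable (F n)) ->
     trivIset setT F -> m (\bigcup_k F k) = \sum_(k <oo) m (F k)}.

Lemma probability_prob_like (P : probability T R) : prob_like P.
Proof.
split; first exact: probability_setT.
- by move=> A mA; rewrite probability_setC.
- move=> F mF tF; rewrite measure_semi_bigcup//; exact: bigcup_measurable.
Qed.

Lemma prob_like_unique (G : set (set T)) (m1 m2 : set T -> \bar R) :
  @measurable _ T = <<s G >> -> setI_closed G ->
  prob_like m1 -> prob_like m2 -> (forall A, G A -> m1 A = m2 A) ->
  forall A, measurable A -> m1 A = m2 A.
Proof.
move=> GE GI p1 p2 m12 A; rewrite GE.
apply: (@dynkin_induction _ _ G (fun A => m1 A = m2 A) GE GI).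
- by rewrite (prob_likeT p1) (prob_likeT p2).
- exact: m12.
- by move=> S mS m12S; rewrite (prob_likeC p1)// (prob_likeC p2)// m12S.
- move=> F mF tF m12F; rewrite (prob_likeU p1)// (prob_likeU p2)//.
  by apply: eq_eseriesr => i _.
Qed.

Lemma measurable_prob_family d' (S : measurableType d')
    (G : set (set T)) (L : S -> probability T R) :
  @measurable _ T = <<s G >> -> setI_closed G ->
  (forall A, G A -> measurable_fun setT (L ^~ A)) ->
  forall A, measurable A -> measurable_fun setT (L ^~ A).
Proof.
move=> GE GI mG A; rewrite GE.
apply: (@dynkin_induction _ _ G
  (fun A : set T => measurable_fun [set: S] (fun s : S => L s A : \bar R)) GE GI).
- by under eq_fun do rewrite probability_setT; exact: measurable_cst.
- exact: mG.
- move=> B mB mLB; under eq_fun do rewrite probability_setC//.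
  exact: emeasurable_funB.
- move=> F mF tF mLF; under eq_fun do (rewrite measure_semi_bigcup//; last exact: bigcup_measurable).
  by apply: (@ge0_emeasurable_sum _ _ _ _ (fun k s => L s (F k)) predT).
Qed.

Lemma mixture_prob_like d' (S : measurableType d') (mu : {measure set S -> \bar R})
    (L : S -> probability T R) : mu setT = 1 ->
  (forall A, measurable A -> measurable_fun setT (L ^~ A)) ->
  prob_like (fun A => \int[mu]_s L s A).
Proof.
move=> mu1 mL; have iL A : measurable A -> mu.-integrable setT (L ^~ A).
  move=> mA; apply/integrableP; split; first exact: mL.
  apply: le_lt_trans (_ : \int[mu]_s (cst 1 s) < _).
    apply: ge0_le_integral => //; first by apply: measurableT_comp => //; exact: mL.
    by move=> x _; rewrite gee0_abs// probability_le1.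
  by rewrite integral_cst// mu1 mule1 ltry.
split.
- under eq_integral do rewrite probability_setT.
  by rewrite integral_cst// mu1 mule1.
- move=> A mA; under eq_integral do rewrite probability_setC//.
  rewrite integralB//; last exact: iL.
    by rewrite integral_cst// mu1 mule1.
  apply/integrableP; split => //.
  by under eq_integral do rewrite abse1; rewrite integral_cst// mu1 mule1 ltry.
- move=> F mF tF; under eq_integral do (rewrite measure_semi_bigcup//; last exact: bigcup_measurable).
  by rewrite integral_nneseries// => n; exact: mL.
Qed.

(** Simple functions increase to [f], and each is a finite sum of multiples of indicators of its
    level sets. *)
Lemma ge0_mfun_ind (P : (T -> \bar R) -> Prop) :
  (forall A, measurable A -> P (fun x => (\1_A x)%:E)) ->
  (forall k f, (0 <= k)%R -> measurable_fun setT f -> (forall x, 0 <= f x) ->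
     P f -> P (fun x => k%:E * f x)) ->
  (forall f g, measurable_fun setT f -> (forall x, 0 <= f x) ->
     measurable_fun setT g -> (forall x, 0 <= g x) ->
     P f -> P g -> P (fun x => f x + g x)) ->
  (forall f : nat -> T -> \bar R, (forall n, measurable_fun setT (f n)) ->
     (forall n x, 0 <= f n x) -> (forall x, nondecreasing_seq (f ^~ x)) ->
     (forall n, P (f n)) -> P (fun x => limn (f ^~ x))) ->
  forall f, measurable_fun setT f -> (forall x, 0 <= f x) -> P f.
Proof.
move=> P1 Pk PD Plim f mf f0.
pose f_ := nnsfun_approx measurableT mf.
rewrite (_ : f = (fun x => limn (fun n => (f_ n x)%:E))); last first.
  apply/funext => x; apply/esym/cvg_lim => //.
  exact: cvg_nnsfun_approx.
apply: Plim => [n|n x|x|n].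
- exact/measurable_EFinP.
- by rewrite lee_fin.
- by move=> a b ab; rewrite lee_fin; exact/lefP/nd_nnsfun_approx.
pose h := f_ n.
rewrite (_ : (fun x => (f_ n x)%:E) =
  (fun x => \sum_(y \in range h) (y * \1_(h @^-1` [set y]) x)%:E)); last first.
  by apply/funext => x; rewrite fimfunE fsumEFin//; exact: fimfunP.
have P0 : P (fun=> 0).
  by have := P1 set0 measurable0; under eq_fun do rewrite indicE in_set0.
rewrite (_ : (fun x => _) = (fun x => \sum_(y <- finmap.enum_fset (fset_set (range h)))
   (y * \1_(h @^-1` [set y]) x)%:E)); last first.
  by apply/funext => x; rewrite fsbig_finite//; exact: fimfunP.
have mh y : measurable (h @^-1` [set y]).
  by rewrite -[X in measurable X]setTI; exact: measurable_funP.
have hy y x : (0 <= y * \1_(h @^-1` [set y]) x)%R.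
  rewrite indicE; case: (asboolP ((h @^-1` [set y]) x)) => hx.
    by rewrite mem_set// mulr1 -hx.
  by rewrite memNset// mulr0.
have mi y : measurable_fun setT (fun x => (y * \1_(h @^-1` [set y]) x)%:E).
  by apply/measurable_EFinP; apply: measurable_funM => //; exact: measurable_indic.
elim: (finmap.enum_fset _) => [|y r IH].
  by under eq_fun do rewrite big_nil.
under eq_fun do rewrite big_cons.
apply: PD => //.
- by move=> x; rewrite lee_fin.
- by apply: emeasurable_sum.
- by move=> x; apply: sume_ge0 => z _; rewrite lee_fin.
(* The induction runs over an arbitrary list of reals, so a negative [y] occurs; its level set under
   the nonnegative [h] is empty. *)
have [y0|y0] := leP 0%R y.
  under eq_fun do rewrite EFinM.
  apply: (Pk y (fun x => (\1_(h @^-1` [set y]) x)%:E)) => //; last exact: P1.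
  by apply/measurable_EFinP; exact: measurable_indic.
rewrite (_ : (fun x => _) = fun=> 0) //; apply/funext => x.
rewrite indicE; case: (asboolP ((h @^-1` [set y]) x)) => hx.
  by move: y0; rewrite -hx ltNge (_ : (0 <= h x)%R).
by rewrite memNset// mulr0.
Qed.

(** Applied with [m = mu = pi] and [L = Q], this extends the invariance of [pi] from sets to
    functions, which is how the law of the stationary trajectory becomes shift-invariant. *)
Lemma ge0_integral_mixture d' (S : measurableType d') (mu : {measure set S -> \bar R})
    (L : S -> {measure set T -> \bar R}) (m : {measure set T -> \bar R}) :
  (forall A, measurable A -> measurable_fun setT (L ^~ A)) ->
  (forall A, measurable A -> m A = \int[mu]_s L s A) ->
  forall f, measurable_fun setT f -> (forall x, 0 <= f x) ->
  \int[m]_x f x = \int[mu]_s \int[L s]_x f x.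
Proof.
move=> mL mE; apply: ge0_mfun_ind.
- move=> A mA; rewrite integral_indic// setIT mE//.
  by apply: eq_integral => s _; rewrite integral_indic// setIT.
- move=> k f k0 mf f0 IH; have mLf := measurable_fun_integral_kernel mL f0 mf.
  have Lf0 s : 0 <= \int[L s]_x f x by apply: integral_ge0 => x _; exact: f0.
  transitivity (k%:E * \int[m]_x f x).
    by apply: ge0_integralZl => // x _; exact: f0.
  transitivity (\int[mu]_s (k%:E * \int[L s]_x f x)); last first.
    apply: eq_integral => s _; apply/esym/ge0_integralZl => // x _; exact: f0.
  rewrite IH; apply/esym/ge0_integralZl => // s _; exact: Lf0.
- move=> f g mf f0 mg g0 IHf IHg.
  have mLf := measurable_fun_integral_kernel mL f0 mf.
  have mLg := measurable_fun_integral_kernel mL g0 mg.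
  have Lf0 s : 0 <= \int[L s]_x f x by apply: integral_ge0 => x _; exact: f0.
  have Lg0 s : 0 <= \int[L s]_x g x by apply: integral_ge0 => x _; exact: g0.
  transitivity (\int[m]_x f x + \int[m]_x g x).
    exact: ge0_integralD.
  transitivity (\int[mu]_s (\int[L s]_x f x + \int[L s]_x g x)); last first.
    by apply: eq_integral => s _; exact/esym/ge0_integralD.
  by rewrite IHf IHg; exact/esym/ge0_integralD.
- move=> f mf f0 ndf IH.
  rewrite monotone_convergence//.
  transitivity (\int[mu]_s limn (fun n => \int[L s]_x f n x)); last first.
    by apply: eq_integral => s _; rewrite monotone_convergence.
  rewrite monotone_convergence//.
  + by apply: congr_lim; apply/funext => n; exact: IH.
  + by move=> n; exact: measurable_fun_integral_kernel.
  + by move=> n s _; exact: integral_ge0.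
  + by move=> s _ a b ab; apply: ge0_le_integral => // x _; exact: ndf.
Qed.

End dynkin.

(** * Invariant events of the chain *)

Lemma prob_like_preimage d d' (S : measurableType d) (T : measurableType d')
    (R : realType) (m : set S -> \bar R) (f : S -> T) :
  measurable_fun setT f -> prob_like m -> prob_like (fun C => m (f @^-1` C)).
Proof.
move=> mf pm; have mfC C : measurable C -> measurable (f @^-1` C).
  by move=> mC; rewrite -[X in measurable X]setTI; exact: mf.
split.
- by rewrite preimage_setT (prob_likeT pm).
- by move=> C mC; rewrite preimage_setC (prob_likeC pm)//; exact: mfC.
- move=> F mF tF; rewrite preimage_bigcup (prob_likeU pm)//.
    by move=> n; exact: mfC.
  by apply/trivIsetP => i j _ _ ij; rewrite -preimage_setI;
    move/trivIsetP: tF => ->//; rewrite preimage_set0.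
Qed.

(** The sum is the integer part of [N z] divided by [N]: that integer part counts the [j < N] with
    [(j + 1) / N <= z]. *)
Lemma staircase (R : realType) (N : nat) (z : R) : (0 < N)%N -> 0 <= z <= 1 ->
  \sum_(j < N) (N%:R^-1 : R) * ((j.+1%:R / N%:R <= z)%R)%:R <= z
    <= \sum_(j < N) (N%:R^-1 : R) * ((j.+1%:R / N%:R <= z)%R)%:R + N%:R^-1.
Proof.
move=> N0 /andP[z0 z1]; have N0' : 0 < N%:R :> R by rewrite ltr0n.
have Nz0 : 0 <= N%:R * z by rewrite mulr_ge0// ler0n.
pose k := Num.truncn (N%:R * z).
have /andP[kz zk] : k%:R <= N%:R * z < k.+1%:R := truncn_itv Nz0.
have kN : (k <= N)%N.
  by rewrite -(ler_nat R) (le_trans kz)// ler_piMr// ler0n.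
have -> : \sum_(j < N) (N%:R^-1 : R) * ((j.+1%:R / N%:R <= z)%R)%:R = N%:R^-1 * k%:R.
  rewrite -mulr_sumr; congr (_ * _).
  transitivity (\sum_(j < N) ((j < k)%N : nat)%:R : R).
    apply: eq_bigr => j _; rewrite ler_pdivrMr// mulrC; congr (_%:R).
    case: (ltnP j k) => jk.
      by rewrite (le_trans _ kz)// ler_nat.
    by rewrite leNgt (lt_le_trans zk)// ler_nat.
  rewrite -natr_sum; congr (_%:R).
  move: (k) kN; elim: (N) => [|m IH] l.
    by rewrite leqn0 => /eqP ->; rewrite big_ord0.
  rewrite big_ord_recr /= leq_eqVlt => /orP[/eqP lm|lm].
    rewrite lm ltnSn (eq_bigr (fun=> 1%N)); last by move=> j _; rewrite ltnS ltnW.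
    by rewrite sum_nat_const card_ord muln1 addn1.
  by rewrite IH// ltnNge -ltnS lm addn0.
rewrite -[X in _ <= _ + X]mulr1 -mulrDr natr1 ler_pdivrMl// kz /=.
by rewrite ler_pdivlMl// ltW.
Qed.

Section markov.
Local Open Scope ereal_scope.
Context d (T : measurableType d) {R : realType} (Q : R.-pker T ~> T).
Local Notation PT := (@path d T).

Lemma tailV_ge0 A m n x : 0 <= tailV Q A m n x.
Proof.
elim: n m x => [//|n IH] m x /=; apply: integral_ge0 => y _.
by rewrite mule_ge0// lee_fin.
Qed.

Lemma measurable_indicE (A : set T) : measurable A ->
  measurable_fun setT (fun x => (\1_A x : R)%:E).
Proof. by move=> mA; apply/measurable_EFinP; exact: measurable_indic. Qed.

Lemma measurable_tailV A m n : (forall i, measurable (A i)) ->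
  measurable_fun setT (tailV Q A m n).
Proof.
move=> mA; elim: n m => [|n IH] m /=; first exact: measurable_cst.
apply: measurable_fun_integral_kernel => [U mU|y|].
- exact: measurable_kernel.
- by rewrite mule_ge0// ?lee_fin// tailV_ge0.
- by apply: emeasurable_funM => //; exact: measurable_indicE.
Qed.

Lemma tailV_shift A m n x : tailV Q (A \o S) m n x = tailV Q A m.+1 n x.
Proof.
elim: n m x => [//|n IH] m x /=; apply: eq_integral => y _; by rewrite IH.
Qed.

Fixpoint kiter (n : nat) (f : T -> \bar R) (x : T) : \bar R :=
  if n is n.+1 then \int[Q x]_y kiter n f y else f x.

Lemma kiter_ge0 n f x : (forall y, 0 <= f y) -> 0 <= kiter n f x.
Proof.
by move=> f0; elim: n x => [|n IH] x //=; apply: integral_ge0 => y _.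
Qed.

Lemma measurable_kiter n f : (forall y, 0 <= f y) -> measurable_fun setT f ->
  measurable_fun setT (kiter n f).
Proof.
move=> f0 mf; elim: n => [//|n IH] /=.
apply: measurable_fun_integral_kernel => [U mU|y|//].
- exact: measurable_kernel.
- exact: kiter_ge0.
Qed.

Lemma kiter_le n f g x : (forall y, 0 <= f y) -> measurable_fun setT f ->
  measurable_fun setT g -> (forall y, f y <= g y) -> kiter n f x <= kiter n g x.
Proof.
move=> f0 mf mg fg; have g0 y : 0 <= g y by rewrite (le_trans (f0 y)).
elim: n x => [|n IH] x //=; apply: ge0_le_integral => //.
- by move=> y _; exact: kiter_ge0.
- exact: measurable_kiter.
- exact: measurable_kiter.
Qed.

Lemma kiterD n f g x : (forall y, 0 <= f y) -> measurable_fun setT f ->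
  (forall y, 0 <= g y) -> measurable_fun setT g ->
  kiter n (fun y => f y + g y) x = kiter n f x + kiter n g x.
Proof.
move=> f0 mf g0 mg; elim: n x => [|n IH] x //=.
under eq_integral do rewrite IH.
apply: ge0_integralD => //.
- by move=> y _; exact: kiter_ge0.
- exact: measurable_kiter.
- by move=> y _; exact: kiter_ge0.
- exact: measurable_kiter.
Qed.

Lemma kiterZ n k f x : (0 <= k)%R -> (forall y, 0 <= f y) ->
  measurable_fun setT f ->
  kiter n (fun y => k%:E * f y) x = k%:E * kiter n f x.
Proof.
move=> k0 f0 mf; elim: n x => [|n IH] x //=.
under eq_integral do rewrite IH.
apply: ge0_integralZl => //.
- exact: measurable_kiter.
- by move=> y _; exact: kiter_ge0.
Qed.

Lemma kiter_cst n c x : kiter n (fun=> c%:E) x = c%:E.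
Proof.
elim: n x => [|n IH] x //=; under eq_integral do rewrite IH.
by rewrite integral_cst// prob_kernel mule1.
Qed.

Lemma kiter_indic n A x : kiter n (fun y => (\1_A y)%:E) x = Qn Q n x A.
Proof. by elim: n x => [//|n IH] x /=; apply: eq_integral => y _; rewrite IH. Qed.

Lemma kiter_sum n (I : Type) (s : seq I) (f : I -> T -> \bar R) x :
  (forall i y, 0 <= f i y) -> (forall i, measurable_fun setT (f i)) ->
  kiter n (fun y => \sum_(i <- s) f i y) x = \sum_(i <- s) kiter n (f i) x.
Proof.
move=> f0 mf; elim: s => [|i s IH].
  by under eq_fun do rewrite big_nil; rewrite big_nil; exact: kiter_cst.
under eq_fun do rewrite big_cons; rewrite big_cons -IH kiterD//.
- by move=> y; exact: sume_ge0.
- exact: emeasurable_sum.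
Qed.

Lemma Qn_itv n x D : measurable D -> 0 <= Qn Q n x D <= 1.
Proof.
move=> mD; rewrite -kiter_indic kiter_ge0/=; last by move=> y; rewrite lee_fin.
rewrite -(kiter_cst n 1 x); apply: kiter_le => //.
- exact: measurable_indicE.
- by move=> y; rewrite lee_fin indicE lern1 leq_b1.
Qed.

Lemma Qn_fin_num n x D : measurable D -> Qn Q n x D \is a fin_num.
Proof.
move=> mD; have /andP[q0 q1] := Qn_itv n x mD.
by rewrite ge0_fin_numE// (le_lt_trans q1)// ltry.
Qed.

Lemma tv_dist_cvg (pi : probability T R) x D : A3 Q pi -> measurable D ->
  (fun n => Qn Q n x D) @ \oo --> pi D.
Proof.
move=> [rho [M [rho1 [M0 tv]]]] mD.
have bnd n : (`|fine (Qn Q n x D) - fine (pi D)| <= M x * rho ^+ n)%R.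
  rewrite -lee_fin; apply: le_trans (tv x n).
  rewrite /tv_dist; apply: ereal_sup_ubound; exists D => //.
  rewrite -[in LHS](fineK (Qn_fin_num n x mD)) -[pi D in LHS]fineK//.
  exact: fin_num_measure.
have geo0 : (fun n => M x * rho ^+ n)%R @ \oo --> 0%R.
  (* [A3] bounds [rho] only from above. If [rho <= -1], the estimate at [n = 1] bounds an absolute
     value by [M x * rho], which forces [M x = 0]. *)
  have [rhoN1|rhoN1] := leP rho (-1)%R; last first.
    apply: cvg_geometric; by rewrite ltr_norml rhoN1.
  have Mx0 : M x = 0%R.
    apply/eqP; rewrite eq_le M0 andbT leNgt; apply/negP => Mx.
    have := le_trans (normr_ge0 _) (bnd 1%N); rewrite expr1 pmulr_rge0// => rho0.
    by have := le_trans rho0 rhoN1; rewrite ler0N1.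
  by under eq_fun do rewrite Mx0 mul0r; exact: cvg_cst.
have : (fun n => fine (Qn Q n x D)) @ \oo --> fine (pi D).
  apply/cvgrPdistC_le => e e0.
  move/cvgrPdistC_le : geo0 => /(_ e e0); apply: filterS => n.
  by rewrite subr0 => /(le_trans (ler_norm _)); exact: le_trans (bnd n).
move=> cvq; rewrite -(fineK (fin_num_measure pi _ mD)).
apply: cvg_EFin cvq; apply: nearW => n; exact: Qn_fin_num.
Qed.

(* Integrating a staircase approximation of [h] against [Qn Q n x] shows that
   [h x], which does not depend on [n], is within [1/N] of the [pi]-integral of [h]. *)
Lemma harmonic_cst (pi : probability T R) (h : T -> R) : A3 Q pi ->
  measurable_fun setT h -> (forall x, 0 <= h x <= 1)%R ->
  (forall x, (h x)%:E = \int[Q x]_y (h y)%:E) ->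
  forall x y, h x = h y.
Proof.
move=> HA3 mh h01 harm.
have hn n x : kiter n (fun y => (h y)%:E) x = (h x)%:E.
  elim: n x => [//|n IH] x /=.
  by under eq_integral do rewrite IH; rewrite -harm.
have mhE : measurable_fun setT (EFin \o h) by exact/measurable_EFinP.
suff key N : (0 < N)%N -> exists a : R, forall x, (a <= h x <= a + N%:R^-1)%R.
  move=> x y; apply/eqP; rewrite eq_le; apply/andP.
  have H u v : (h u <= h v)%R.
    apply/ler_addgt0Pr => e e0.
    pose N := (Num.truncn e^-1).+1.
    have [a ha] := key N isT.
    have /andP[_ hu] := ha u; have /andP[hv _] := ha v.
    rewrite (le_trans hu)// lerD// invf_ple// ?posrE//.
    by apply/ltW; rewrite truncnS_gt.
  by split.
move=> N0.
pose D j := [set x | (j.+1%:R / N%:R <= h x)%R].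
have mD j : measurable (D j).
  rewrite (_ : D j = h @^-1` `[(j.+1%:R / N%:R)%R, +oo[); last first.
    by apply/seteqP; split => x; rewrite /D /= in_itv/= andbT.
  by rewrite -[X in measurable X]setTI; exact: mh.
pose s x : \bar R := \sum_(j <- enum 'I_N) ((N%:R^-1)%:E * (\1_(D j) x)%:E).
have sE x : s x = (\sum_(j < N) (N%:R^-1 : R) * ((j.+1%:R / N%:R <= h x)%R)%:R)%R%:E.
  rewrite /s big_enum/= sumEFin; congr (_%:E); apply: eq_bigr => j _.
  congr (_ * _)%R; rewrite indicE /D.
  by case: (boolP (_ <= h x)%R) => hx; [rewrite mem_set|rewrite memNset//; exact/negP].
have s0 x : 0 <= s x.
  by apply: sume_ge0 => j _; rewrite mule_ge0// lee_fin ?invr_ge0.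
have ms1 (j : 'I_N) : measurable_fun setT (fun x => (N%:R^-1)%:E * (\1_(D j) x)%:E : \bar R).
  by apply: emeasurable_funM => //; exact: measurable_indicE.
have ms : measurable_fun setT s by apply: emeasurable_sum.
have sh x : s x <= (h x)%:E.
  by rewrite sE lee_fin; have /andP[] := staircase N0 (h01 x).
have hs x : (h x)%:E <= s x + (N%:R^-1)%:E.
  by rewrite sE lee_fin; have /andP[] := staircase N0 (h01 x).
have ksE n x : kiter n s x = \sum_(j <- enum 'I_N) ((N%:R^-1)%:E * Qn Q n x (D j)).
  rewrite kiter_sum//.
  apply: eq_bigr => j _; rewrite kiterZ ?invr_ge0//.
    by rewrite kiter_indic.
  exact: measurable_indicE.
pose a : \bar R := \sum_(j <- enum 'I_N) ((N%:R^-1)%:E * pi (D j)).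
have afin : a \is a fin_num.
  rewrite /a sum_fin_num; apply/allP => y /mapP[j _ ->].
  by rewrite inE/= fin_numM// fin_num_measure.
have cvs x : (fun n => kiter n s x) @ \oo --> a.
  under eq_fun do rewrite ksE.
  apply: cvg_nnesum => j _.
    apply: nearW => n; rewrite mule_ge0// ?lee_fin ?invr_ge0//.
    rewrite -kiter_indic; apply: kiter_ge0 => y; by rewrite lee_fin.
  by apply: cvgeZl => //; exact: tv_dist_cvg.
exists (fine a) => x; rewrite -!lee_fin EFinD fineK//; apply/andP; split.
- rewrite -(cvg_lim _ (cvs x))//; apply: lime_le; first by apply/cvg_ex; exists a.
  by apply: nearW => n; rewrite -(hn n x); apply: kiter_le.
- rewrite -leeBlDr// -(cvg_lim _ (cvs x))//; apply: lime_ge.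
    by apply/cvg_ex; exists a.
  apply: nearW => n; rewrite leeBlDr// -(hn n x) -[X in _ + X](kiter_cst n _ x).
  rewrite -kiterD//.
  by apply: kiter_le => //; [move=> y; rewrite lee_fin; case/andP: (h01 y)|exact: emeasurable_funD].
Qed.

Variable L : T -> probability PT R.
Hypothesis L_cylinder : forall x A n, (forall i, measurable (A i)) ->
  L x (cylinder A n) = (\1_(A 0%N) x)%:E * tailV Q A 1 n x.

Lemma measurable_L C : measurable C -> measurable_fun setT (L ^~ C).
Proof.
apply: (@measurable_prob_family _ PT _ _ _ (@cylinders d T)) => //.
  exact: cylinders_setI_closed.
move=> _ [A [n [mA ->]]]; under eq_fun do rewrite L_cylinder//.
by apply: emeasurable_funM; [exact: measurable_indicE|exact: measurable_tailV].
Qed.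

Lemma shift_cylinder A n :
  shift @^-1` cylinder A n =
  cylinder (fun i => if i is j.+1 then A j else [set: T]) n.+1.
Proof.
apply/seteqP; split => w /= h.
- by move=> [|i] //= ?; exact: (h i).
- by move=> i /= ?; exact: (h i.+1).
Qed.

(** The Markov property at time 1. On cylinders it is the recursion defining [tailV], since the
    preimage of a cylinder under the shift leaves the first coordinate free. *)
Lemma L_shift x C : measurable C ->
  L x (shift @^-1` C) = \int[Q x]_y L y C.
Proof.
move=> mC; apply: (@prob_like_unique _ PT _ (@cylinders d T)
  (fun C => L x (shift @^-1` C)) (fun C => \int[Q x]_y L y C)) mC => //.
- exact: cylinders_setI_closed.
- apply: prob_like_preimage; first exact: measurable_shift.
  exact: probability_prob_like.
- apply: mixture_prob_like; first exact: prob_kernel.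
  by move=> A mA; exact: measurable_L.
- move=> _ [A [n [mA ->]]]; rewrite shift_cylinder L_cylinder; last by case.
  rewrite indicT mul1e /=; apply: eq_integral => y _.
  by rewrite L_cylinder// -!tailV_shift.
Qed.

(** Trajectories start at [x] almost surely under [L x], so an event on coordinate 0 is either
    almost sure or null. *)
Lemma L_initI x B (C : set PT) : measurable B -> measurable C ->
  L x (coord 0 @^-1` B `&` C) = (\1_B x)%:E * L x C.
Proof.
move=> mB mC.
have mE (D : set T) : measurable D -> measurable (coord 0 @^-1` D).
  by move=> mD; rewrite -[X in measurable X]setTI; exact: measurable_coord.
have L0 (D : set T) : measurable D -> L x (coord 0 @^-1` D) = (\1_D x)%:E.
  move=> mD; rewrite (_ : _ @^-1` _ = cylinder (fun=> D) 0).
    by rewrite L_cylinder//= mule1.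
  apply/seteqP; split => w /= h; last exact: (h 0%N).
  by move=> i /=; rewrite leqn0 => /eqP ->.
have [xB|xB] := pselect (B x).
  rewrite indicE mem_set// mul1e (measureDI _ mC (mE _ mB)).
  rewrite [X in X + _](_ : _ = 0) ?add0e 1?setIC//.
  apply: (@subset_measure0 _ _ _ (L x) _ (coord 0 @^-1` (~` B))).
  - by apply: measurableD => //; exact: mE.
  - by apply: mE; exact: measurableC.
  - by move=> w [].
  - by apply: etrans (L0 _ (measurableC mB)) _; rewrite indicE memNset//= => /(_ xB).
rewrite indicE memNset// mul0e.
apply: (@subset_measure0 _ _ _ (L x) _ (coord 0 @^-1` B)).
- by apply: measurableI => //; exact: mE.
- exact: mE.
- by move=> w [].
- by apply: etrans (L0 _ mB) _; rewrite indicE memNset.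
Qed.

(** By the Markov property and the invariance of [A], the function [x |-> L x A] is harmonic with
    values in [0, 1]. *)
Lemma invariant_prob_cst (pi : probability T R) (A : set PT) : A3 Q pi ->
  measurable A -> shift @^-1` A = A -> forall x y, L x A = L y A.
Proof.
move=> HA3 mA sA x y.
rewrite -[LHS]fineK ?fin_num_measure// -[RHS]fineK ?fin_num_measure//.
congr (_%:E); apply: (harmonic_cst (h := fun x => fine (L x A)) HA3).
- by apply: measurableT_comp => //; exact: measurable_L.
- move=> z; rewrite fine_ge0//= -lee_fin fineK ?fin_num_measure//.
  exact: probability_le1.
- move=> z; rewrite fineK ?fin_num_measure// -{1}sA L_shift//.
  by apply: eq_integral => u _; rewrite fineK ?fin_num_measure.
Qed.

(* The invariant event is independent of every cylinder, hence of itself. *)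
Lemma invariant_01 (pi : probability T R) (A : set PT) : A3 Q pi ->
  measurable A -> shift @^-1` A = A -> forall x, L x A = 0 \/ L x A = 1.
Proof.
move=> HA3 mA sA x; have cst := invariant_prob_cst HA3 mA sA.
(* Induction on the length: after the first coordinate there remain a shorter cylinder and, by
   invariance, the same event [A]. The probability of [A] is the same from all starting points, so
   it comes out of the integral. *)
have key n B y : (forall i, measurable (B i)) ->
    L y (cylinder B n `&` A) = L x A * L y (cylinder B n).
  elim: n B y => [|n IH] B y mB.
    have -> : cylinder B 0 = coord 0 @^-1` B 0%N.
      apply/seteqP; split => w /= h; first exact: (h 0%N).
      by move=> i /=; rewrite leqn0 => /eqP ->.
    rewrite L_initI// (cst y x) muleC; congr (_ * _).
    have := L_initI y (mB 0%N) measurableT.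
    by rewrite setIT probability_setT mule1.
  have mc m C : (forall i, measurable (C i)) -> measurable (cylinder C m : set PT).
    by move=> ?; exact: measurable_cylinder.
  have -> : cylinder B n.+1 = coord 0 @^-1` B 0%N `&` shift @^-1` cylinder (B \o S) n.
    apply/seteqP; split => w /= h.
      by split; [exact: (h 0%N)|move=> i /= ?; exact: (h i.+1)].
    by case: h => h0 h1 [|i] //= ?; exact: (h1 i).
  have mcB : measurable (cylinder (B \o S) n : set PT) by apply: mc => i; exact: mB.
  have mcBA : measurable (cylinder (B \o S) n `&` A : set PT) by exact: measurableI.
  have msh (C : set PT) : measurable C -> measurable (shift @^-1` C).
    by move=> mC; rewrite -[X in measurable X]setTI; exact: measurable_shift.
  rewrite -setIA -{1}sA -preimage_setI (L_initI _ (mB 0%N) (msh _ mcBA)).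
  rewrite (L_initI _ (mB 0%N) (msh _ mcB)) (L_shift _ mcBA) (L_shift _ mcB).
  rewrite muleCA; congr (_ * _).
  transitivity (\int[Q y]_z (L x A * L z (cylinder (B \o S) n))).
    by apply: eq_integral => z _; rewrite IH// => i; exact: mB.
  rewrite ge0_integralZl//.
  by apply: measurable_L; apply: mc => i; exact: mB.
(* The restriction of [L x] to [A] and the multiple [p] of [L x] agree on cylinders, hence
   everywhere; evaluation at [A] itself gives [p = p^2]. *)
pose p : {nonneg R} := NngNum (fine_ge0 (measure_ge0 (L x) A)).
have pE : (p%:num)%:E = L x A by rewrite fineK// fin_num_measure.
have keyB : forall B : set PT, measurable B -> L x (B `&` A) = L x A * L x B.
  move=> B mB.
  have := @measure_unique _ R PT (@cylinders d T) (fun=> setT) erefl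
    (@cylinders_setI_closed d T) (fun=> (@cylinders_setT d T)) _
    (mrestr (L x) mA) (mscale p (L x)) _ _ B mB.
  rewrite /= /mrestr /mscale/= pE; apply.
  - by rewrite bigcup_const//; exists 0%N.
  - by move=> _ [C [n [mC ->]]]; rewrite key.
  - by move=> _; rewrite setTI (le_lt_trans (probability_le1 _ mA))// ltry.
have := keyB A mA; rewrite setIid -pE -EFinM => /eqP; rewrite eqe.
rewrite -{1}[p%:num]mulr1 -subr_eq0 -mulrBr mulf_eq0 subr_eq0 => /orP[|] /eqP.
  by move=> ->; left.
by move=> <-; right.
Qed.

Variables (pi : probability T R) (nu : probability PT R).
Hypothesis nu_cylinder : forall A n, (forall i, measurable (A i)) ->
  nu (cylinder A n) = \int[pi]_x ((\1_(A 0%N) x)%:E * tailV Q A 1 n x).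
Hypothesis pi_inv : forall A, measurable A -> pi A = \int[pi]_x Q x A.

Lemma nu_mixture C : measurable C -> nu C = \int[pi]_x L x C.
Proof.
apply: (@prob_like_unique _ PT _ (@cylinders d T) nu (fun C => \int[pi]_x L x C)) => //.
- exact: cylinders_setI_closed.
- exact: probability_prob_like.
- apply: mixture_prob_like; first exact: probability_setT.
  by move=> A mA; exact: measurable_L.
- move=> _ [A [n [mA ->]]]; rewrite nu_cylinder//.
  by apply: eq_integral => y _; rewrite L_cylinder.
Qed.

Lemma nu_shift C : measurable C -> nu (shift @^-1` C) = nu C.
Proof.
move=> mC; rewrite !nu_mixture//; last first.
  by rewrite -[X in measurable X]setTI; exact: measurable_shift.
under eq_integral do rewrite L_shift//.
apply/esym/(@ge0_integral_mixture _ T _ _ T pi Q pi) => //.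
- by move=> A mA; exact: measurable_kernel.
- exact: measurable_L.
Qed.

Lemma invariant_nu (A : set PT) x : A3 Q pi -> measurable A ->
  shift @^-1` A = A -> nu A = L x A.
Proof.
move=> HA3 mA sA; rewrite nu_mixture//.
under eq_integral do rewrite (invariant_prob_cst HA3 mA sA _ x).
rewrite -[X in \int[_]_(_ in _) X]fineK ?fin_num_measure//.
by rewrite integral_cst//= probability_setT mule1 fineK// fin_num_measure.
Qed.

End markov.

(** * Law of large numbers *)

Section maximal_ergodic.
Local Open Scope ereal_scope.
Context d (S : measurableType d) {R : realType} (mu : probability S R)
  (th : S -> S).
Hypothesis mth : measurable_fun setT th.
Hypothesis mu_th : forall A, measurable A -> mu (th @^-1` A) = mu A.

Definition birkhoff_sum (G : S -> R) (n : nat) (w : S) : R :=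
  (\sum_(i < n) G (iter i th w))%R.

Lemma birkhoff_sumS G n w :
  birkhoff_sum G n.+1 w = (G w + birkhoff_sum G n (th w))%R.
Proof.
rewrite /birkhoff_sum big_ord_recl; congr (_ + _)%R.
by apply: eq_bigr => i _; rewrite /= -iterS iterSr.
Qed.

Lemma measurable_birkhoff_sum G n : measurable_fun setT G ->
  measurable_fun setT (birkhoff_sum G n).
Proof.
move=> mG; elim: n => [|n IH].
  rewrite (_ : birkhoff_sum G 0 = cst 0%R); first exact: measurable_cst.
  by apply/funext => w; rewrite /birkhoff_sum big_ord0.
rewrite (_ : birkhoff_sum G n.+1 = (G \+ (birkhoff_sum G n \o th))%R).
  by apply: measurable_funD => //; exact: measurableT_comp.
by apply/funext => w; rewrite birkhoff_sumS.
Qed.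

Lemma birkhoff_sumB G c n w :
  birkhoff_sum (fun w => G w - c)%R n w = (birkhoff_sum G n w - n%:R * c)%R.
Proof.
by rewrite /birkhoff_sum sumrB sumr_const card_ord mulr_natl.
Qed.

Lemma ge0_integral_preserving f : measurable_fun setT f -> (forall x, 0 <= f x) ->
  \int[mu]_w f (th w) = \int[mu]_w f w.
Proof.
move=> mf f0; rewrite -[LHS]/(\int[mu]_(w in th @^-1` setT) (f \o th) w).
rewrite -(ge0_integral_pushforward mth)//.
by apply: eq_measure_integral => A mA _; exact: mu_th.
Qed.

Lemma integrable_preserving f : mu.-integrable setT f ->
  mu.-integrable setT (f \o th).
Proof.
move=> /integrableP[mf foo]; apply/integrableP; split.
  exact: measurableT_comp.
rewrite (_ : \int[mu]_x _ = \int[mu]_x `|f x|)//.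
apply: (@ge0_integral_preserving (abse \o f)) => [|x]; last exact: abse_ge0.
exact: measurableT_comp.
Qed.

Lemma integral_preserving f : mu.-integrable setT f ->
  \int[mu]_w f (th w) = \int[mu]_w f w.
Proof.
move=> fi; rewrite -[LHS]/(\int[mu]_(w in th @^-1` setT) (f \o th) w).
rewrite -(integral_pushforward mth)//; last 2 first.
- exact: measurable_int fi.
- by rewrite preimage_setT; exact: integrable_preserving.
by apply: eq_measure_integral => A mA _; exact: mu_th.
Qed.

Variable G : S -> R.
Hypothesis iG : mu.-integrable setT (EFin \o G).

(* Maximum of [0] and of the first [n] Birkhoff sums, as in Garsia's proof of the
   maximal ergodic theorem. *)
Fixpoint pmax (n : nat) (w : S) : R :=
  (if n is n.+1 then Num.max 0 (G w + pmax n (th w)) else 0)%R.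

Lemma pmax_ge0 n w : (0 <= pmax n w)%R.
Proof. by case: n => [//|n] /=; rewrite le_max lexx. Qed.

Lemma pmaxS n w : (pmax n w <= pmax n.+1 w)%R.
Proof.
elim: n w => [|n IH] w; first exact: pmax_ge0.
by rewrite [leLHS]/= [leRHS]/= le_max2// lerD2l.
Qed.

Lemma birkhoff_le_pmax n w : (birkhoff_sum G n w <= pmax n w)%R.
Proof.
elim: n w => [|n IH] w; first by rewrite /birkhoff_sum big_ord0.
by rewrite birkhoff_sumS /= le_max lerD2l IH orbT.
Qed.

Let mG : measurable_fun setT G.
Proof. by apply/measurable_EFinP; exact: measurable_int iG. Qed.

Lemma integrable_pmax n : mu.-integrable setT (EFin \o pmax n).
Proof.
elim: n => [|n IH]; first exact: integrable0.
have ith := integrable_preserving IH.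
have mpt : measurable_fun setT (pmax n \o th).
  by apply/measurable_EFinP; exact: measurable_int ith.
apply: (le_integrable _ _ _ (integrableD _ (integrable_abse iG) ith)) => //.
  apply/measurable_EFinP => /=.
  by apply: measurable_maxr => //; exact: measurable_funD.
move=> w _ /=; rewrite lee_fin ger0_norm ?le_max ?lexx//.
rewrite [leRHS]ger0_norm ?addr_ge0 ?pmax_ge0// ge_max addr_ge0 ?pmax_ge0//=.
by rewrite lerD2r ler_norm.
Qed.

Let pos n := [set w | (0 < pmax n w)%R].

Let mpos n : measurable (pos n).
Proof.
rewrite (_ : pos n = pmax n @^-1` `]0%R, +oo[).
  rewrite -[X in measurable X]setTI.
  have /measurable_EFinP := measurable_int _ (integrable_pmax n).
  by apply.
by apply/seteqP; split => w; rewrite /pos /= in_itv/= andbT.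
Qed.

(** On [pos n.+1], [G] equals [pmax n.+1 - pmax n \o th], hence is at least
    [pmax n.+1 - pmax n.+1 \o th]; off it the latter is at most 0. The integral of this difference
    vanishes by invariance. *)
Let integral_pos_ge0 n : 0 <= \int[mu]_w (G w * \1_(pos n) w)%:E.
Proof.
case: n => [|n].
  rewrite integral0_eq// => w _; rewrite indicE memNset ?mulr0//.
  by rewrite /pos /= ltxx.
have iM := integrable_pmax n.+1; have iMt := integrable_preserving iM.
apply: (@le_trans _ _ (\int[mu]_w ((pmax n.+1 w)%:E - (pmax n.+1 (th w))%:E))).
  rewrite integralB_EFin// (integral_preserving iM) subee//.
  exact: integrable_fin_num.
apply: le_integral => //.
- exact: (integrableB _ iM iMt).
- apply: (le_integrable _ _ _ iG) => //.
    by apply/measurable_EFinP; apply: measurable_funM.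
  move=> w _; rewrite lee_fin normrM ler_piMr//.
  by rewrite ger0_norm// indicE lern1 leq_b1.
- move=> w _; rewrite lee_fin indicE.
  have [wp|wp] := pselect (pos n.+1 w).
    rewrite mem_set// mulr1.
    have -> : pmax n.+1 w = (G w + pmax n (th w))%R.
      have : (0 < pmax n.+1 w)%R by [].
      rewrite /= lt_max ltxx /= => h.
      by apply/max_idPr; exact: ltW.
    by rewrite lerBlDr lerD2l pmaxS.
  rewrite memNset// mulr0.
  have -> : pmax n.+1 w = 0%R.
    by apply/eqP; rewrite eq_le pmax_ge0 andbT leNgt; apply/negP.
  by rewrite sub0r oppr_le0 pmax_ge0.
Qed.

(** Under the assumption the sets [pos n] increase to a set of full measure, so [integral_pos_ge0]
    passes to the limit with dominating function [|G|]. *)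
Lemma maximal_ergodic :
  {ae mu, forall w, exists n, (0 < birkhoff_sum G n w)%R} ->
  0 <= \int[mu]_w (G w)%:E.
Proof.
move=> aeG.
have [|||||_ _ cv] := @dominated_convergence _ S R mu setT measurableT
   (fun n w => (G w * \1_(pos n) w)%:E) (EFin \o G) (abse \o (EFin \o G)).
- by move=> n; apply/measurable_EFinP; apply: measurable_funM.
- exact/measurable_EFinP.
- apply: filterS aeG => w [n wn] _.
  apply: cvg_near_cst; near=> m; rewrite indicE mem_set/= ?mulr1//.
  have nm : (n <= m)%N by near: m; exact: nbhs_infty_ge.
  apply: (lt_le_trans wn); apply: (le_trans (birkhoff_le_pmax _ _)).
  rewrite -(subnKC nm); elim: (m - n)%N => [|k IH]; first by rewrite addn0.
  by rewrite addnS (le_trans IH)// pmaxS.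
- exact: integrable_abse.
- apply: aeW => w n _; rewrite lee_fin normrM ler_piMr//.
  by rewrite ger0_norm// indicE lern1 leq_b1.
- rewrite -(cvg_lim _ cv)//; apply: lime_ge; first by apply/cvg_ex; eexists; exact: cv.
  by apply: nearW => n; exact: integral_pos_ge0.
Unshelve. all: by end_near. Qed.

End maximal_ergodic.

(** * The strong law from every starting point *)

Section slln.
Local Open Scope ereal_scope.
Context d (T : measurableType d) {R : realType} (Q : R.-pker T ~> T).
Local Notation PT := (@path d T).
Variables (L : T -> probability PT R) (pi : probability T R) (nu : probability PT R).
Hypothesis L_cylinder : forall x A n, (forall i, measurable (A i)) ->
  L x (cylinder A n) = (\1_(A 0%N) x)%:E * tailV Q A 1 n x.
Hypothesis nu_cylinder : forall A n, (forall i, measurable (A i)) ->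
  nu (cylinder A n) = \int[pi]_x ((\1_(A 0%N) x)%:E * tailV Q A 1 n x).
Hypothesis pi_inv : forall A, measurable A -> pi A = \int[pi]_x Q x A.
Hypothesis HA3 : A3 Q pi.

Local Notation bsum := (birkhoff_sum shift).

(* A shift-invariant version of [limsup (bsum F n / n) > c]. *)
Let above (F : PT -> R) (c : R) : set PT :=
  \bigcup_m \bigcap_N \bigcup_(n in [set n | (N <= n)%N])
    [set w | (n%:R * (c + m.+1%:R^-1) < bsum F n w)%R].

Let measurable_above F c : measurable_fun setT F -> measurable (above F c).
Proof.
move=> mF; apply: bigcupT_measurable => m; apply: bigcapT_measurable => N.
apply: bigcup_measurable => n _.
rewrite (_ : [set w | _] = bsum F n @^-1` `](n%:R * (c + m.+1%:R^-1))%R, +oo[).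
  rewrite -[X in measurable X]setTI.
  by apply: (measurable_birkhoff_sum measurable_shift n mF).
by apply/seteqP; split => w; rewrite /= in_itv/= andbT.
Qed.

Let aboveP F c w : above F c w <->
  exists2 e : R, (0 < e)%R & forall N, exists2 n, (N <= n)%N & (n%:R * (c + e) < bsum F n w)%R.
Proof.
split=> [[m _ h]|[e e0 h]].
  by exists m.+1%:R^-1%R => // N; have [n] := h N I; exists n.
exists (Num.truncn e^-1) => // N _; have [n Nn nw] := h N; exists n => //=.
apply: le_lt_trans nw; rewrite ler_wpM2l// lerD2l invf_ple ?posrE//.
by apply/ltW; rewrite truncnS_gt.
Qed.

(** Shifting changes the sum by the single term [F w] and its length by one; half of the margin [e]
    absorbs both once [n] is large. This is why [above] asks for a margin rather than for the bare
    inequality. *)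
Let above_shift F c : shift @^-1` above F c = above F c.
Proof.
have lin (a b : R) (e : R) : (0 < e)%R -> exists N : nat, forall n, (N <= n)%N ->
    (a <= n%:R * e + b)%R.
  move=> e0; exists (Num.truncn (`|(a - b) / e|%R)).+1 => n Nn.
  rewrite -lerBlDr -ler_pdivrMr//; apply: (le_trans (ler_norm _)).
  by apply/ltW/(lt_le_trans (truncnS_gt _)); rewrite ler_nat.
apply/seteqP; split => w /=; rewrite !aboveP => -[e e0 h].
- have [N1 HN1] := lin ((c + e) - F w)%R (- (e / 2) * 1)%R _ (divr_gt0 e0 (ltr0Sn _ 1)).
  exists (e / 2)%R; first exact: divr_gt0.
  move=> N; have [n Nn hn] := h (maxn N N1); exists n.+1.
    by rewrite (leq_trans (leq_maxl N N1))// (leq_trans Nn).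
  rewrite birkhoff_sumS.
  move: hn (HN1 n (leq_trans (leq_maxr _ _) Nn)); rewrite -(natr1 n) mulrDl !mulrDr.
  rewrite mulrA; set u := (_ * e)%R; set v := (_ * c)%R; lra.
- have [N1 HN1] := lin (F w) (c + e)%R _ (divr_gt0 e0 (ltr0Sn _ 1)).
  exists (e / 2)%R; first exact: divr_gt0.
  move=> N; have [n Nn hn] := h (maxn N N1).+1.
  case: n Nn hn => // n; rewrite ltnS => Nn; rewrite birkhoff_sumS => hn.
  exists n; first exact: (leq_trans (leq_maxl N N1)).
  move: hn (HN1 n (leq_trans (leq_maxr _ _) Nn)); rewrite -(natr1 n) mulrDl !mulrDr.
  rewrite mulrA; set u := (_ * e)%R; set v := (_ * c)%R; lra.
Qed.

(** Otherwise the event has probability 1 under [L x], hence under [nu]; then almost every Birkhoff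
    sum of [F - c] is positive at some time, and the maximal ergodic theorem makes the mean of [F]
    at least [c]. *)
Let L_above F c x : nu.-integrable setT (EFin \o F) ->
  \int[nu]_w (F w)%:E < c%:E -> L x (above F c) = 0.
Proof.
move=> iF Fc; have mF : measurable_fun setT F.
  by apply/measurable_EFinP; exact: measurable_int iF.
have mA := measurable_above c mF; have sA := above_shift F c.
have [//|L1] := invariant_01 L_cylinder HA3 mA sA x.
have nu1 : nu (above F c) = 1.
  by rewrite (invariant_nu L_cylinder nu_cylinder x HA3 mA sA).
have iFc : nu.-integrable setT (EFin \o (fun w => F w - c)%R).
  rewrite (_ : EFin \o _ = (EFin \o F) \- cst c%:E)//; apply: integrableB => //.
  exact: finite_measure_integrable_cst.
suff : 0 <= \int[nu]_w (F w - c)%:E.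
  under eq_integral do rewrite EFinB.
  rewrite integralB_EFin//; last exact: finite_measure_integrable_cst.
  rewrite integral_cst//= probability_setT mule1 sube_ge0//.
  by rewrite leNgt Fc.
apply: (maximal_ergodic measurable_shift _ iFc).
- by move=> C mC; exact: (nu_shift L_cylinder nu_cylinder pi_inv mC).
exists (~` above F c); split.
- exact: measurableC.
- by rewrite probability_setC// nu1 subee.
- move=> w /= nw aw; apply: nw; move/aboveP: aw => [e e0 /(_ 1%N)[n n1 hn]].
  exists n; rewrite birkhoff_sumB subr_gt0 (le_lt_trans _ hn)//.
  by rewrite ler_wpM2l// lerDl ltW.
Qed.

Lemma slln F x : nu.-integrable setT (EFin \o F) ->
  {ae L x, forall w, (fun n => n%:R^-1 * bsum F n w)%R @ \oo -->
     fine (\int[nu]_w (F w)%:E)}.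
Proof.
move=> iF; set e := fine _.
have eE : \int[nu]_w (F w)%:E = e%:E by rewrite fineK// integrable_fin_num.
have iFN : nu.-integrable setT (EFin \o (\- F)%R).
  by rewrite (_ : EFin \o _ = -%E \o (EFin \o F))//; exact: integrableN.
have eNE : \int[nu]_w ((\- F)%R w)%:E = (- e)%:E.
  under eq_integral do rewrite -[(\- F)%R _]mulN1r EFinM.
  by rewrite integralZl// eE -EFinM mulN1r.
have mF : measurable_fun setT F by apply/measurable_EFinP; exact: measurable_int iF.
have up G a k : nu.-integrable setT (EFin \o G) -> \int[nu]_w (G w)%:E = a%:E ->
    {ae L x, forall w, ~ above G (a + k.+1%:R^-1) w}.
  move=> iG aE; exists (above G (a + k.+1%:R^-1)); split.
  - apply: measurable_above; apply/measurable_EFinP; exact: measurable_int iG.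
  - by apply: L_above => //; rewrite aE lte_fin ltrDl.
  - by move=> w /= nw; exact: contrapT.
have aek k : {ae L x, forall w, ~ above F (e + k.+1%:R^-1) w /\
    ~ above (\- F)%R (- e + k.+1%:R^-1) w}.
  have [u1 u2] := (up F e k iF eE, up _ (- e)%R k iFN eNE).
  by near=> w; split; near: w.
move/ae_foralln : aek; apply: filterS => w hw; apply/cvgrPdist_le => eps eps0.
(* One half of [eps] pays for the level [k.+1%:R^-1] above the mean, the other half is the margin
   required by [above]. *)
pose k := Num.truncn (eps / 2)^-1.
have k2 : (k.+1%:R^-1 <= eps / 2)%R.
  by rewrite invf_ple ?posrE// ?divr_gt0//; apply/ltW; rewrite truncnS_gt.
have [h1 h2] := hw k.
have main G a : ~ above G (a + k.+1%:R^-1) w ->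
    \forall n \near \oo, (bsum G n w <= n%:R * (a + eps))%R.
  move=> nab; apply: contrapT => nn; apply: nab; apply/aboveP.
  exists (eps / 2)%R; first by rewrite divr_gt0.
  move=> N; apply: contrapT => nex; apply: nn; exists N => // n /= Nn.
  rewrite leNgt; apply/negP => lt; apply: nex; exists n => //.
  apply: le_lt_trans lt; rewrite ler_wpM2l//.
  by move: k2; set q := (k.+1%:R^-1)%R; lra.
near=> n; have n0 : (0 < n%:R :> R)%R by rewrite ltr0n; near: n; exact: nbhs_infty_gt.
have b1 : (bsum F n w <= n%:R * (e + eps))%R by near: n; exact: main h1.
have b2 : (bsum (\- F)%R n w <= n%:R * (- e + eps))%R by near: n; exact: main h2.
have b3 : bsum (\- F)%R n w = (- bsum F n w)%R by rewrite /birkhoff_sum sumrN.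
rewrite distrC ler_distl ler_pdivlMl// ler_pdivrMl//; apply/andP; split=> //.
by move: b2; rewrite b3 -lerN2 opprK -mulrN opprD opprK.
Unshelve. all: by end_near. Qed.

End slln.

(** * Covariances of the reversible chain *)

(** Continuity of multiplication does not cover [h = +oo]: there both sides are [+oo] as soon as
    some [u n] is positive, and 0 otherwise. *)
Lemma nondecreasing_limeMl (R : realType) (u : nat -> \bar R) (h : \bar R) :
  (0 <= h)%E -> (forall n, 0 <= u n)%E -> nondecreasing_seq u ->
  limn (fun n => h * u n)%E = (h * limn u)%E.
Proof.
move=> h0 u0 ndu; have cu : cvgn u by exact: ereal_nondecreasing_is_cvgn.
have [hfin|] := boolP (h \is a fin_num); first by rewrite limeMl.
rewrite ge0_fin_numE// -leNgt leye_eq => /eqP ->.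
have [[n un]|nu] := pselect (exists n, 0 < u n)%E.
  rewrite gt0_mulye; last first.
    apply: (lt_le_trans un); apply: lime_ge => //; near=> k; apply: ndu.
    by near: k; exact: nbhs_infty_ge.
  apply: cvg_lim => //; apply: cvg_near_cst; near=> k.
  rewrite gt0_mulye// (lt_le_trans un)//; apply: ndu; near: k.
  exact: nbhs_infty_ge.
have uE : u = fun=> 0%E.
  by apply/funext => n; apply/eqP; rewrite eq_le u0 andbT leNgt; apply/negP => ?; apply: nu; exists n.
by rewrite uE; under eq_fun do rewrite mule0; rewrite !lim_cst// mule0.
Unshelve. all: by end_near. Qed.

(** * Extension of identities from indicators to nonnegative functions *)

Section integral_like.
Local Open Scope ereal_scope.
Context d (T : measurableType d) {R : realType}.

(* The three properties that characterise an integral by its values on indicators. *)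
Record integral_like (I : (T -> \bar R) -> \bar R) : Prop := IntegralLike {
  integral_likeZ : forall k f, (0 <= k)%R -> measurable_fun setT f ->
    (forall x, 0 <= f x) -> I (fun x => k%:E * f x) = k%:E * I f;
  integral_likeD : forall f g, measurable_fun setT f -> (forall x, 0 <= f x) ->
    measurable_fun setT g -> (forall x, 0 <= g x) ->
    I (fun x => f x + g x) = I f + I g;
  integral_like_lim : forall f : nat -> T -> \bar R,
    (forall n, measurable_fun setT (f n)) -> (forall n x, 0 <= f n x) ->
    (forall x, nondecreasing_seq (f ^~ x)) ->
    I (fun x => limn (f ^~ x)) = limn (fun n => I (f n)) }.

Lemma integral_like_ext I J : integral_like I -> integral_like J ->
  (forall A, measurable A ->
    I (fun x => (\1_A x)%:E) = J (fun x => (\1_A x)%:E)) ->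
  forall f, measurable_fun setT f -> (forall x, 0 <= f x) -> I f = J f.
Proof.
move=> [IZ ID Il] [JZ JD Jl] IJ; apply: ge0_mfun_ind => //.
- by move=> k f k0 mf f0 e; rewrite IZ// JZ// e.
- by move=> f g mf f0 mg g0 ef eg; rewrite ID// JD// ef eg.
- move=> f mf f0 ndf e; rewrite Il// Jl//.
  by congr (limn _); apply/funext => n; exact: e.
Qed.

Lemma integral_like_weight d' (S : measurableType d')
    (m : {measure set S -> \bar R}) (a : S -> T) (h : S -> \bar R) :
  measurable_fun setT a -> measurable_fun setT h -> (forall w, 0 <= h w) ->
  integral_like (fun f => \int[m]_w (h w * f (a w))).
Proof.
move=> ma mh h0.
have mfa f : measurable_fun setT f -> measurable_fun setT (fun w => h w * f (a w)).
  by move=> mf; apply: emeasurable_funM => //; exact: measurableT_comp.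
split.
- move=> k f k0 mf f0.
  under eq_integral do rewrite muleCA.
  by apply: ge0_integralZl => //; [exact: mfa|move=> w _; exact: mule_ge0].
- move=> f g mf f0 mg g0.
  under eq_integral do rewrite ge0_muleDr//.
  by apply: ge0_integralD => //; [move=> w _; exact: mule_ge0|exact: mfa
    |move=> w _; exact: mule_ge0|exact: mfa].
- move=> f mf f0 ndf.
  transitivity (\int[m]_w limn (fun n => h w * f n (a w))).
    apply: eq_integral => w _; rewrite nondecreasing_limeMl//; exact: ndf.
  rewrite monotone_convergence//.
  + by move=> n; exact: mfa.
  + by move=> n w _; exact: mule_ge0.
  + by move=> w _ i j ij; apply: lee_wpmul2l => //; exact: ndf.
Qed.

End integral_like.

(** * Two-time correlations of the stationary reversible chain *)

Section reversible_chain.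
Local Open Scope ereal_scope.
Context d (T : measurableType d) {R : realType} (Q : R.-pker T ~> T)
  (pi : probability T R) dS (S : measurableType dS) (Ps : probability S R)
  (Xs : nat -> S -> T).
Hypothesis chain : markov_chain Q pi Ps Xs.
Hypothesis rev : reversible Q pi.

Local Notation kiter := (kiter Q).

Let mX n : measurable_fun setT (Xs n). Proof. exact: chain.1. Qed.

Lemma reversible_invariant A : measurable A -> pi A = \int[pi]_x Q x A.
Proof.
move=> mA; have := rev measurableT mA => ->.
by under eq_integral do rewrite prob_kernel; rewrite integral_cst// mul1e.
Qed.

Lemma integral_like_kiter n (h : T -> \bar R) : measurable_fun setT h ->
  (forall x, 0 <= h x) ->
  integral_like (fun f => \int[pi]_x (h x * kiter n f x)).
Proof.
move=> mh h0.
have mhf f : measurable_fun setT f -> (forall x, 0 <= f x) ->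
    measurable_fun setT (fun x => h x * kiter n f x).
  by move=> mf f0; apply: emeasurable_funM => //; exact: measurable_kiter.
have hf0 f : (forall x, 0 <= f x) -> forall x, 0 <= h x * kiter n f x.
  by move=> f0 x; rewrite mule_ge0// kiter_ge0.
split.
- move=> k f k0 mf f0.
  under eq_integral do rewrite kiterZ// muleCA.
  by apply: ge0_integralZl => //; [exact: mhf|move=> x _; exact: hf0].
- move=> f g mf f0 mg g0.
  under eq_integral do rewrite kiterD// ge0_muleDr ?kiter_ge0//.
  by apply: ge0_integralD => //; [move=> x _; exact: hf0|exact: mhf
    |move=> x _; exact: hf0|exact: mhf].
- move=> f mf f0 ndf.
  pose F m x := kiter n (f m) x.
  have F0 m x : 0 <= F m x by exact: kiter_ge0.
  have mF m : measurable_fun setT (F m) by exact: measurable_kiter.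
  have ndF x : nondecreasing_seq (F ^~ x).
    by move=> i j ij; apply: kiter_le => // y; exact: ndf.
  have kl x : kiter n (fun x => limn (f ^~ x)) x = limn (F ^~ x).
    rewrite /F; elim: n x {F F0 mF ndF mhf hf0} => [//|n IH] x /=.
    rewrite -monotone_convergence//.
    + by apply: eq_integral => y _; exact: IH.
    + by move=> m; exact: measurable_kiter.
    + by move=> m y _; exact: kiter_ge0.
    + by move=> y _ i j ij; apply: kiter_le => // z; exact: ndf.
  transitivity (\int[pi]_x limn (fun n => h x * F n x)).
    by apply: eq_integral => x _; rewrite kl nondecreasing_limeMl.
  rewrite monotone_convergence//.
  + by move=> m; apply: mhf.
  + by move=> m x _; apply: hf0.
  + by move=> x _ i j ij; apply: lee_wpmul2l => //; exact: ndF.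
Qed.

(** The definition of [kiter] peels off the outermost kernel; moving steps across an inner product
    peels off the innermost one. *)
Lemma kiterS n f x : kiter n.+1 f x = kiter n (kiter 1 f) x.
Proof.
elim: n x => [//|n IH] x; transitivity (\int[Q x]_y kiter n.+1 f y) => //.
by apply: eq_integral => y _; exact: IH.
Qed.

(** On indicators this is reversibility; both sides are integral-like in each argument, so the
    identity extends one argument at a time. *)
Lemma kiter1_selfadjoint f g :
  measurable_fun setT f -> (forall x, 0 <= f x) ->
  measurable_fun setT g -> (forall x, 0 <= g x) ->
  \int[pi]_x (f x * kiter 1 g x) = \int[pi]_x (g x * kiter 1 f x).
Proof.
move=> mf f0 mg g0; move: g mg g0; apply: integral_like_ext.
- exact: integral_like_kiter.
- under [X in integral_like X]eq_fun do under eq_integral do rewrite muleC.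
  apply: integral_like_weight => //; first exact: measurable_kiter.
  by move=> x; exact: kiter_ge0.
move=> B mB; have mBE := @measurable_indicE _ _ R _ mB.
have B0 x : 0 <= (\1_B x : R)%:E by rewrite lee_fin.
move: f mf f0; apply: integral_like_ext.
- under [X in integral_like X]eq_fun do under eq_integral do rewrite muleC.
  apply: integral_like_weight => //; first exact: measurable_kiter.
  by move=> x; exact: kiter_ge0.
- exact: integral_like_kiter.
move=> A mA /=; have := rev mA mB.
have E C D : measurable C -> measurable D ->
    \int[pi]_x ((\1_C x)%:E * \int[Q x]_y (\1_D y)%:E) = \int[pi]_(x in C) Q x D.
  move=> mC mD; rewrite [RHS]integral_mkcond; apply: eq_integral => x _.
  rewrite integral_indic// setIT patchE indicE.
  by case: ifP => _; rewrite ?mul1e ?mul0e.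
by rewrite E// E.
Qed.

Lemma kiter_selfadjoint i j f g :
  measurable_fun setT f -> (forall x, 0 <= f x) ->
  measurable_fun setT g -> (forall x, 0 <= g x) ->
  \int[pi]_x (f x * kiter (i + j) g x) = \int[pi]_x (kiter i f x * kiter j g x).
Proof.
move=> + + mg g0; elim: i f => [//|i IH] f mf f0.
transitivity (\int[pi]_x (f x * kiter 1 (kiter (i + j) g) x)) => //.
rewrite kiter1_selfadjoint//; last 2 first.
- exact: measurable_kiter.
- by move=> x; exact: kiter_ge0.
under eq_integral do rewrite muleC.
rewrite IH; last 2 first.
- exact: measurable_kiter.
- by move=> x; exact: kiter_ge0.
by apply: eq_integral => x _; rewrite [in RHS]kiterS.
Qed.

Lemma chain_kiter_indic A B n : measurable A -> measurable B ->
  \int[Ps]_w ((\1_B (Xs n w))%:E * (\1_A (Xs 0%N w))%:E) =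
  \int[pi]_x ((\1_A x)%:E * kiter n (fun y => (\1_B y)%:E) x).
Proof.
move=> mA mB.
have mXA C k : measurable C -> measurable (Xs k @^-1` C).
  by move=> mC; rewrite -[X in measurable X]setTI; exact: mX.
transitivity (Ps (Xs n @^-1` B `&` Xs 0%N @^-1` A)).
  rewrite -[in RHS](setIT (_ `&` _)) -integral_indic//; last by apply: measurableI; exact: mXA.
  by apply: eq_integral => w _; rewrite indicI.
(* Written as an intersection so that for [n = 0] both constraints fall on the same coordinate. *)
pose C k := (if (k == 0)%N then A else setT) `&` (if (k == n)%N then B else setT).
have mC k : measurable (C k) by rewrite /C; apply: measurableI; case: ifP.
have := chain.2 C n mC.
rewrite (_ : \bigcap_(_ in _) _ = Xs n @^-1` B `&` Xs 0%N @^-1` A); last first.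
  apply/seteqP; split => w /=.
    by move=> h; split; [have /= := h n (leqnn n)|have /= := h 0%N (leq0n n)];
       rewrite /C !eqxx => -[].
  by move=> [wB wA] k /= kn; rewrite /C; split; case: eqP => // ->.
move=> ->; apply: eq_integral => x _.
have tailE m k y : (0 < m)%N -> (m + k)%N = n ->
    tailV Q C m k.+1 y = kiter k.+1 (fun y => (\1_B y)%:E) y.
  elim: k m y => [|k IH] m y m0 mk.
    rewrite /=; apply: eq_integral => z _; rewrite mule1 /C (gtn_eqF m0) setTI.
    by rewrite -mk addn0 eqxx.
  transitivity (\int[Q y]_z ((\1_(C m) z)%:E * tailV Q C m.+1 k.+1 z)) => //.
  transitivity (\int[Q y]_z kiter k.+1 (fun y => (\1_B y)%:E) z) => //.
  apply: eq_integral => z _; rewrite IH//; last by rewrite -mk addSnnS.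
  rewrite /C (gtn_eqF m0) setTI ltn_eqF ?indicT ?mul1e//.
  by rewrite -mk -addSnnS leq_addr.
have [n0|n0] := posnP n.
  by rewrite {1}/C n0 eqxx/= mule1 indicI EFinM.
have := tailE 1%N n.-1 x isT; rewrite add1n prednK// => -> //.
by rewrite /C eqxx/= ltn_eqF// setIT.
Qed.

Lemma chain_kiter f g n :
  measurable_fun setT f -> (forall x, 0 <= f x) ->
  measurable_fun setT g -> (forall x, 0 <= g x) ->
  \int[Ps]_w (f (Xs 0%N w) * g (Xs n w)) = \int[pi]_x (f x * kiter n g x).
Proof.
move=> mf f0 mg g0; move: g mg g0; apply: integral_like_ext.
- exact: (integral_like_weight Ps (mX n) (measurableT_comp mf (mX 0)) (fun=> f0 _)).
- exact: integral_like_kiter.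
move=> B mB; have mBE := @measurable_indicE _ _ R _ mB.
have B0 x : 0 <= (\1_B x : R)%:E by rewrite lee_fin.
move: f mf f0; apply: integral_like_ext.
- under [X in integral_like X]eq_fun do under eq_integral do rewrite muleC.
  exact: (integral_like_weight Ps (mX 0) (measurableT_comp mBE (mX n)) (fun=> B0 _)).
- under [X in integral_like X]eq_fun do under eq_integral do rewrite muleC.
  apply: integral_like_weight => //; first exact: measurable_kiter.
  by move=> x; exact: kiter_ge0.
move=> A mA; rewrite -chain_kiter_indic//.
by apply: eq_integral => w _; rewrite muleC.
Qed.

Lemma chain_selfadjoint f g i j :
  measurable_fun setT f -> (forall x, 0 <= f x) ->
  measurable_fun setT g -> (forall x, 0 <= g x) ->
  \int[Ps]_w (f (Xs 0%N w) * g (Xs (i + j)%N w)) =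
  \int[pi]_x (kiter i f x * kiter j g x).
Proof. by move=> mf f0 mg g0; rewrite chain_kiter// kiter_selfadjoint. Qed.

(** Self-adjointness moves all [n] steps onto the constant 1, which the kernel fixes. *)
Lemma chain_marginal f n : measurable_fun setT f -> (forall x, 0 <= f x) ->
  \int[Ps]_w f (Xs n w) = \int[pi]_x f x.
Proof.
move=> mf f0; have m1 : measurable_fun setT (fun _ : T => 1 : \bar R) by [].
have := chain_selfadjoint n 0 m1 (fun=> lee01) mf f0; rewrite addn0.
under eq_integral do rewrite mul1e; move=> ->.
by apply: eq_integral => x _; rewrite (kiter_cst Q n 1) mul1e.
Qed.

Definition sqint (f : T -> R) :=
  measurable_fun setT f /\ \int[pi]_x ((f x) ^+ 2)%:E < +oo.

Definition cc (n : nat) (f g : T -> R) : R :=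
  fine (\int[Ps]_w (f (Xs 0%N w) * g (Xs n w))%:E).

Lemma sqint_integrable f n : sqint f ->
  Ps.-integrable setT (fun w => ((f (Xs n w)) ^+ 2)%:E).
Proof.
move=> [mf foo].
have mf2 : measurable_fun setT (fun x => ((f x) ^+ 2)%:E).
  by apply/measurable_EFinP; exact: measurable_funX.
apply/integrableP; split; first exact: (measurableT_comp mf2).
under eq_integral do rewrite gee0_abs ?lee_fin ?sqr_ge0//.
by rewrite (chain_marginal (f := fun x => (f x ^+ 2)%:E))// => x; rewrite lee_fin sqr_ge0.
Qed.

Lemma sqint_mul_integrable f g n m : sqint f -> sqint g ->
  Ps.-integrable setT (fun w => (f (Xs n w) * g (Xs m w))%:E).
Proof.
move=> sf sg.
have := integrableD measurableT (sqint_integrable n sf) (sqint_integrable m sg).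
apply: le_integrable => //.
  apply/measurable_EFinP; apply: measurable_funM.
  - exact: (measurableT_comp sf.1).
  - exact: (measurableT_comp sg.1).
move=> w _; rewrite -EFinD !lee_fin [leRHS]ger0_norm ?addr_ge0 ?sqr_ge0//.
set a := f _; set b := g _.
have := sqr_ge0 (`|a| - `|b|)%R; rewrite normrM sqrrB !real_normK ?num_real//.
have := sqr_ge0 a; have := sqr_ge0 b; have := normr_ge0 a; have := normr_ge0 b.
set u := (`|a| * `|b|)%R; rewrite -mulr_natr; nra.
Qed.

Lemma sqint_cst c : sqint (fun=> c).
Proof.
split; first exact: measurable_cst.
by rewrite integral_cst//= probability_setT mule1 ltry.
Qed.

Lemma sqint_lin a b f g : sqint f -> sqint g -> sqint (fun x => a * f x + b * g x)%R.
Proof.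
move=> [mf foo] [mg goo].
have mfg : measurable_fun setT (fun x => a * f x + b * g x)%R.
  by apply: measurable_funD; exact: measurable_funM.
split => //.
have mf2 (h : T -> R) : measurable_fun setT h -> measurable_fun setT (fun x => ((h x) ^+ 2)%:E).
  by move=> mh; apply/measurable_EFinP; exact: measurable_funX.
apply: (@le_lt_trans _ _ (\int[pi]_x ((2 * a ^+ 2)%:E * (f x ^+ 2)%:E +
   (2 * b ^+ 2)%:E * (g x ^+ 2)%:E))).
  apply: ge0_le_integral => //.
  - by move=> x _; rewrite lee_fin sqr_ge0.
  - exact: mf2.
  - by apply: emeasurable_funD; apply: emeasurable_funM => //; exact: mf2.
  - move=> x _; rewrite -!EFinM -EFinD lee_fin.
    rewrite -subr_ge0; set D := (X in (0 <= X)%R).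
    have -> : D = ((a * f x - b * g x) ^+ 2)%R by rewrite /D; ring.
    exact: sqr_ge0.
have c0 c : (0 <= 2 * c ^+ 2 :> R)%R by rewrite mulr_ge0 ?ler0n ?sqr_ge0.
have ge0 c (h : T -> R) : 0 <= \int[pi]_x ((2 * c ^+ 2)%:E * (h x ^+ 2)%:E).
  by apply: integral_ge0 => x _; rewrite -EFinM lee_fin mulr_ge0 ?c0 ?sqr_ge0.
have lt c (h : T -> R) : measurable_fun setT h -> \int[pi]_x ((h x) ^+ 2)%:E < +oo ->
    \int[pi]_x ((2 * c ^+ 2)%:E * (h x ^+ 2)%:E) < +oo.
  move=> mh hoo; rewrite ge0_integralZl//; last 3 first.
  - exact: mf2.
  - by move=> x _; rewrite lee_fin sqr_ge0.
  - by rewrite lee_fin c0.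
  by rewrite lte_mul_pinfty// lee_fin c0.
rewrite ge0_integralD//; first by apply: lte_add_pinfty; exact: lt.
- by move=> x _; rewrite -EFinM lee_fin mulr_ge0 ?c0 ?sqr_ge0.
- by apply: emeasurable_funM => //; exact: mf2.
- by move=> x _; rewrite -EFinM lee_fin mulr_ge0 ?c0 ?sqr_ge0.
- by apply: emeasurable_funM => //; exact: mf2.
Qed.

Lemma ccE n f g : sqint f -> sqint g ->
  (cc n f g)%:E = \int[Ps]_w (f (Xs 0%N w) * g (Xs n w))%:E.
Proof.
by move=> sf sg; rewrite fineK// integrable_fin_num//; exact: sqint_mul_integrable.
Qed.

Lemma cc_linl n a b f g h : sqint f -> sqint g -> sqint h ->
  cc n (fun x => a * f x + b * g x)%R h = (a * cc n f h + b * cc n g h)%R.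
Proof.
move=> sf sg sh; apply: EFin_inj; rewrite EFinD !EFinM !ccE//; last exact: sqint_lin.
have i1 := sqint_mul_integrable 0 n sf sh; have i2 := sqint_mul_integrable 0 n sg sh.
rewrite -!integralZl// -integralD//; try exact: integrableZl.
by apply: eq_integral => w _; rewrite -!EFinM -EFinD mulrDl !mulrA.
Qed.

Lemma cc_linr n a b f g h : sqint f -> sqint g -> sqint h ->
  cc n h (fun x => a * f x + b * g x)%R = (a * cc n h f + b * cc n h g)%R.
Proof.
move=> sf sg sh; apply: EFin_inj; rewrite EFinD !EFinM !ccE//; last exact: sqint_lin.
have i1 := sqint_mul_integrable 0 n sh sf; have i2 := sqint_mul_integrable 0 n sh sg.
rewrite -!integralZl// -integralD//; try exact: integrableZl.
by apply: eq_integral => w _; rewrite -!EFinM -EFinD mulrDr !(mulrCA _ (h _)).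
Qed.

(** Positive part for [true], negative part for [false]. The kernel identities above hold for
    nonnegative functions; bilinearity of [cc] carries them to square-integrable ones through these
    parts. *)
Definition rpart (e : bool) (f : T -> R) (x : T) : R :=
  Num.max (if e then f x else - f x)%R 0%R.

Lemma rpart_ge0 e f x : (0 <= rpart e f x)%R.
Proof. by rewrite le_max lexx orbT. Qed.

Lemma rpartE f : f = (fun x => 1 * rpart true f x + (-1) * rpart false f x)%R.
Proof.
apply/funext => x; rewrite /rpart mul1r mulN1r; have [f0|f0] := leP 0%R (f x).
  by rewrite max_r ?oppr_le0// subr0.
by rewrite max_l ?oppr_ge0 ?ltW// sub0r opprK.
Qed.

Lemma sqint_rpart e f : sqint f -> sqint (rpart e f).
Proof.
move=> [mf foo]; have mr : measurable_fun setT (rpart e f).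
  by apply: measurable_maxr => //; case: e => //; exact: measurableT_comp.
split => //; apply: le_lt_trans foo; apply: ge0_le_integral => //.
- by move=> x _; rewrite lee_fin sqr_ge0.
- by apply/measurable_EFinP; exact: measurable_funX.
- by apply/measurable_EFinP; exact: measurable_funX.
- move=> x _; rewrite lee_fin -[leRHS]real_normK ?num_real//.
  rewrite ler_sqr ?nnegrE ?rpart_ge0// /rpart ge_max normr_ge0 andbT.
  by case: (e); [exact: ler_norm|rewrite -normrN; exact: ler_norm].
Qed.

Definition sgb (e : bool) : R := if e then 1%R else (-1)%R.

Lemma cc_rpart n f g : sqint f -> sqint g ->
  cc n f g = (\sum_(e : bool) \sum_(e' : bool) sgb e * sgb e' * cc n (rpart e f) (rpart e' g))%R.
Proof.
move=> sf sg; rewrite {1}[f]rpartE cc_linl//; try exact: sqint_rpart.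
rewrite {1 2}[g]rpartE !cc_linr//; try exact: sqint_rpart.
by rewrite !big_bool /= /sgb !mulrDr !mulrA.
Qed.

Let measurable_sq f : sqint f -> measurable_fun setT (EFin \o f).
Proof. by case=> mf _; exact/measurable_EFinP. Qed.

Lemma cc_sym n f g : sqint f -> sqint g -> cc n f g = cc n g f.
Proof.
move=> sf sg; rewrite [LHS]cc_rpart// [RHS]cc_rpart// exchange_big/=.
apply: eq_bigr => e _; apply: eq_bigr => e' _; congr (_ * _)%R; first exact: mulrC.
have pos h k : sqint h -> sqint k -> (forall x, 0 <= h x)%R -> (forall x, 0 <= k x)%R ->
    cc n h k = fine (\int[pi]_x ((h x)%:E * kiter n (EFin \o k) x)).
  move=> sh sk h0 k0; congr fine.
  have := @chain_kiter (EFin \o h) (EFin \o k) n; move=> <-;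
    do ?[exact: measurable_sq|by move=> x; rewrite lee_fin].
  by [].
rewrite pos ?pos//; do ?[exact: sqint_rpart|by move=> x; exact: rpart_ge0].
congr fine; have := @kiter_selfadjoint n 0 (EFin \o rpart e' f) (EFin \o rpart e g).
rewrite addn0 => ->; do ?[exact/measurable_sq/sqint_rpart|by move=> x; rewrite lee_fin rpart_ge0].
by apply: eq_integral => x _; rewrite muleC.
Qed.

(** The quadratic form is the integral of the square of [\sum_i s i * v i x]. *)
Lemma gram_ge0 (I : finType) (v : I -> T -> R) (s : I -> R) :
  (forall i j, pi.-integrable setT (fun x => (v i x * v j x)%:E)) ->
  (0 <= \sum_i \sum_j s i * s j * fine (\int[pi]_x (v i x * v j x)%:E))%R.
Proof.
move=> iv; rewrite -lee_fin -sumEFin.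
have E i j : (s i * s j * fine (\int[pi]_x (v i x * v j x)%:E))%:E =
    \int[pi]_x ((s i * s j)%:E * (v i x * v j x)%:E).
  by rewrite EFinM fineK ?integrable_fin_num// integralZl.
rewrite (eq_bigr (fun i => \int[pi]_x \sum_j ((s i * s j)%:E * (v i x * v j x)%:E))).
  rewrite -integral_sum//; last first.
    by move=> i; apply: integrable_sum => // j _; exact: integrableZl.
  apply: integral_ge0 => x _; under eq_bigr do under eq_bigr do rewrite -EFinM.
  under eq_bigr do rewrite sumEFin.
  rewrite sumEFin lee_fin (_ : \sum_i _ = (\sum_i s i * v i x) ^+ 2)%R ?sqr_ge0//.
  rewrite expr2 mulr_suml; apply: eq_bigr => i _; rewrite mulr_sumr.
  by apply: eq_bigr => j _; rewrite mulrACA.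
move=> i _; rewrite -sumEFin integral_sum//; first by apply: eq_bigr => j _; exact: E.
by move=> j; exact: integrableZl.
Qed.

(** A real-valued version of [Q^i f]. For nonnegative square-integrable [f] the value [+oo], which
    [fine] sends to 0, occurs only on a [pi]-null set. *)
Let ur i (f : T -> R) x : R := fine (kiter i (EFin \o f) x).

Let ur_ae i f : sqint f -> (forall x, 0 <= f x)%R ->
  {ae pi, forall x, kiter i (EFin \o f) x = (ur i f x)%:E}.
Proof.
move=> sf f0; have mf := measurable_sq sf.
have f0' x : 0 <= (EFin \o f) x by rewrite lee_fin f0.
have ik : pi.-integrable setT (kiter i (EFin \o f)).
  apply/integrableP; split; first exact: measurable_kiter.
  under eq_integral do rewrite gee0_abs ?kiter_ge0//.
  have m1 : measurable_fun setT (fun _ : T => 1 : \bar R) by [].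
  have := chain_kiter i m1 (fun=> lee01) mf f0'.
  under [X in _ = X]eq_integral do rewrite mul1e; move=> <-.
  have /integrable_fin_num := sqint_mul_integrable 0 i (sqint_cst 1) sf.
  rewrite fin_numE => /(_ _)/andP[//|_].
  by under eq_integral do rewrite EFinM; rewrite ltey.
have := integrable_ae measurableT ik; apply: filterS => x /(_ I) xf.
by rewrite fineK.
Qed.

Let ur_cc i j f g : sqint f -> sqint g -> (forall x, 0 <= f x)%R -> (forall x, 0 <= g x)%R ->
  pi.-integrable setT (fun x => (ur i f x * ur j g x)%:E) /\
  fine (\int[pi]_x (ur i f x * ur j g x)%:E) = cc (i + j) f g.
Proof.
move=> sf sg f0 g0; have mf := measurable_sq sf; have mg := measurable_sq sg.
have f0' x : 0 <= (EFin \o f) x by rewrite lee_fin f0.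
have g0' x : 0 <= (EFin \o g) x by rewrite lee_fin g0.
have mur k h : sqint h -> (forall x, 0 <= h x)%R -> measurable_fun setT (ur k h).
  move=> sh h0; apply: measurableT_comp => //; apply: measurable_kiter.
    by move=> y; rewrite lee_fin.
  exact: measurable_sq.
have ur0 k h x : (forall x, 0 <= h x)%R -> (0 <= ur k h x)%R.
  by move=> h0; rewrite fine_ge0// kiter_ge0// => y; rewrite lee_fin.
have E : \int[pi]_x (ur i f x * ur j g x)%:E = (cc (i + j) f g)%:E.
  rewrite ccE//; under [RHS]eq_integral do rewrite EFinM.
  rewrite (chain_selfadjoint i j mf f0' mg g0').
  apply: ge0_ae_eq_integral => //.
  - by apply/measurable_EFinP; apply: measurable_funM; exact: mur.
  - by apply: emeasurable_funM; exact: measurable_kiter.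
  - by move=> x _; rewrite lee_fin mulr_ge0 ?ur0.
  - by move=> x _; rewrite mule_ge0 ?kiter_ge0.
  - have := ur_ae i sf f0; have := ur_ae j sg g0; apply: filterS2 => x -> -> _.
    by rewrite EFinM.
split; last by rewrite E.
apply/integrableP; split.
  by apply/measurable_EFinP; apply: measurable_funM; exact: mur.
under eq_integral do rewrite gee0_abs ?lee_fin ?mulr_ge0 ?ur0//.
by rewrite E ltry.
Qed.

(* Reversibility turns [E f(X_0) f(X_(i+j))] into the [pi]-inner product of [Q^i f]
   and [Q^j f]: the Hankel matrix is a Gram matrix. *)
Lemma cc_hankel N (s : nat -> R) f : sqint f ->
  (0 <= \sum_(i < N) \sum_(j < N) s i * s j * cc (i + j) f f)%R.
Proof.
(* The vectors are [Q^i] applied to the positive and to the negative part of [f], with coefficients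
   [s i] and [- s i]. *)
move=> sf; pose v (p : 'I_N * bool) := ur p.1 (rpart p.2 f).
have iv p q : pi.-integrable setT (fun x => (v p x * v q x)%:E).
  by have [] := @ur_cc p.1 q.1 _ _ (sqint_rpart p.2 sf) (sqint_rpart q.2 sf)
    (rpart_ge0 _ _) (rpart_ge0 _ _).
have PB (F : 'I_N -> bool -> R) : (\sum_p F p.1 p.2 = \sum_i \sum_e F i e)%R.
  by rewrite pair_bigA.
have := gram_ge0 (fun p : 'I_N * bool => s p.1 * sgb p.2)%R iv.
pose w i e j e' := (s i * sgb e * (s j * sgb e') * fine
  (\int[pi]_x (ur i (rpart e f) x * ur j (rpart e' f) x)%:E))%R.
rewrite (PB (fun i e => \sum_(q : 'I_N * bool) w i e q.1 q.2)%R).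
congr (_ <= _)%R; apply: eq_bigr => i _.
under eq_bigr => e _ do rewrite (PB (w i e)).
rewrite exchange_big; apply: eq_bigr => j _.
rewrite cc_rpart// mulr_sumr; apply: eq_bigr => e _; rewrite mulr_sumr.
apply: eq_bigr => e' _.
have [_] := @ur_cc i j _ _ (sqint_rpart e sf) (sqint_rpart e' sf)
  (rpart_ge0 _ _) (rpart_ge0 _ _).
by rewrite /w; move=> ->; ring.
Qed.

Definition mean (f : T -> R) : R := fine (\int[Ps]_w (f (Xs 0%N w))%:E).

Definition center (f : T -> R) (x : T) : R := (f x - mean f)%R.

Lemma cc_cstr n f : cc n f (fun=> 1%R) = mean f.
Proof. by congr fine; apply: eq_integral => w _; rewrite mulr1. Qed.

Lemma chain_mean n f : sqint f -> \int[Ps]_w (f (Xs n w))%:E = (mean f)%:E.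
Proof.
move=> sf; have s1 := sqint_cst 1.
rewrite -(cc_cstr n) cc_sym// ccE//.
by apply: eq_integral => w _; rewrite mul1r.
Qed.

Lemma sqint_center f : sqint f -> sqint (center f).
Proof.
move=> sf; have := sqint_lin 1 (- mean f) sf (sqint_cst 1).
by rewrite (_ : (fun x => _) = center f)//; apply/funext => x; rewrite /center mul1r mulr1.
Qed.

Lemma cc_center n f g : sqint f -> sqint g ->
  cc n (center f) (center g) = (cc n f g - mean f * mean g)%R.
Proof.
move=> sf sg; have s1 := sqint_cst 1.
have cE h : center h = (fun x => 1 * h x + (- mean h) * (fun=> 1) x)%R.
  by apply/funext => x; rewrite /center mul1r mulr1.
rewrite (cE f) cc_linl//; last exact: sqint_center.
rewrite (cE g) !cc_linr// !cc_cstr (cc_sym n s1 sg) !cc_cstr.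
rewrite /mean integral_cst//= probability_setT mule1 /=; ring.
Qed.

(** At negative lags [gamma] exchanges the two times; by reversibility this changes nothing, so
    cross-covariances are even in the lag. *)
Lemma gammaE f g k : sqint f -> sqint g ->
  gamma Ps Xs f g k = cc `|k|%N (center f) (center g).
Proof.
move=> sf sg.
have E (n m : nat) (h l : T -> R) : sqint h -> sqint l ->
    covariance Ps (h \o Xs n) (l \o Xs m) =
    \int[Ps]_w (center h (Xs n w) * center l (Xs m w))%:E.
  move=> sh sl; rewrite covariance.unlock expectation.unlock.
  by rewrite /= !chain_mean.
rewrite /gamma; case: ifP => k0; rewrite E//.
rewrite cc_sym; try exact: sqint_center.
by congr fine; apply: eq_integral => w _; rewrite mulrC.
Qed.

End reversible_chain.

(** * Compactness of moment sequences *)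

Definition mk_mfun d d' (S : measurableType d) (T : measurableType d') (f : S -> T)
  (mf : measurable_fun setT f) : {mfun S >-> T} :=
  HB.pack f (isMeasurableFun.Build _ _ S T f mf).

Lemma integral_mscale d (T : measurableType d) (R : realType)
    (m : {measure set T -> \bar R}) (k : {nonneg R}) (f : T -> \bar R) :
  m.-integrable setT f ->
  (\int[mscale k m]_x f x = k%:num%:E * \int[m]_x f x)%E.
Proof.
move=> fi; have mf := measurable_int _ fi.
rewrite [LHS]integralE (integralE m) !ge0_integral_mscale//.
- have D : (\int[m]_x f^\+ x +? - \int[m]_x f^\- x)%E.
    by apply: fin_num_adde_defl; rewrite fin_numN; exact: integrable_neg_fin_num.
  by apply/esym/muleBr.
- exact: measurable_funeneg.
- exact: measurable_funepos.
Qed.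

Section moments.
Context {R : realType}.
Implicit Types (mu : {measure set R -> \bar R}) (q : R -> R) (b c : R).

Let U : probability (measurableTypeR R) R := uniform_prob (@ltr01 R).

Lemma uniform_ray (t : R) : 0 <= t <= 1 -> U `]t, +oo[%classic = (1 - t)%:E.
Proof.
move=> /andP[t0 t1].
rewrite -[LHS]/(uniform_prob (@ltr01 R) _) /uniform_prob integral_uniform_pdf.
have -> : `]t, +oo[%classic `&` `[0, 1]%classic = `]t, 1]%classic :> set R.
  apply/seteqP; split => x; rewrite /= !in_itv/= !andbT.
    by move=> [-> /andP[_ ->]].
  by move=> /andP[tx x1]; rewrite tx x1 (le_trans t0 (ltW tx)).
rewrite (eq_integral (fun=> 1%E)); last first.
  move=> x; rewrite inE/= in_itv/= /uniform_pdf => /andP[tx ->].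
  by rewrite (le_trans t0 (ltW tx)) subr0 invr1.
rewrite integral_cst//= mul1e lebesgue_measure_itv/= lte_fin.
case: ifP => [_|/negbT]; first by rewrite -EFinB.
by rewrite -leNgt => t1'; rewrite (@le_anti _ _ t 1) ?subrr// t1.
Qed.

Lemma nondecreasing_measurable q : {homo q : x y / x <= y} -> measurable_fun setT q.
Proof.
move=> ndq; apply: (@measurability _ _ _ _ setT q _ (RGenOInfty.measurableE R)).
move=> _ [_ [x ->] <-]; rewrite setTI; apply: is_interval_measurable.
move=> s t; rewrite /= !in_itv/= !andbT => xs xt u /andP[su ut].
by rewrite in_itv/= andbT (lt_le_trans xs)// ndq.
Qed.

(* The quantile function of a measure of total mass [c] carried by [[-b, b]]. *)
Lemma quantile_repr mu b c : 0 < c -> mu (~` `[- b, b]) = 0%E -> mu setT = c%:E ->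
  exists q, [/\ {homo q : x y / x <= y}, forall u, - b <= q u <= b &
    forall n, (\int[mu]_a (a ^+ n)%:E = c%:E * \int[U]_u (q u ^+ n)%:E)%E].
Proof.
move=> c0 mub muT.
have muTy (A : set R) : measurable A -> (mu A < +oo)%E.
  by move=> mA; apply: le_lt_trans (_ : mu setT < +oo)%E;
    [apply: le_measure; rewrite ?inE|rewrite muT ltry].
have muF (A : set R) : measurable A -> mu A \is a fin_num.
  by move=> mA; rewrite ge0_fin_numE// muTy.
have b0 : - b <= b.
  rewrite leNgt; apply/negP => bb; move: mub.
  rewrite set_itv_ge ?setC0 ?muT; last by rewrite bnd_simp -ltNge.
  by move=> [] /eqP; rewrite gt_eqF.
pose F x := fine (mu `]-oo, x]%classic).
have FE x : (F x)%:E = mu `]-oo, x]%classic by rewrite fineK// muF.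
have ndF x y : x <= y -> F x <= F y.
  move=> xy; rewrite -lee_fin !FE; apply: le_measure; rewrite ?inE//.
  by move=> z; rewrite /= !in_itv/= => /le_trans; apply.
have Fb x : b <= x -> F x = c.
  move=> bx; apply: EFin_inj; rewrite FE -muT.
  apply/eqP; rewrite eq_le le_measure ?inE//=.
  rewrite -(setvU `]-oo, x]%classic) (le_trans (measureU2 _ _ _))//; first exact: measurableC.
  rewrite -[leRHS]add0e leeD// -mub; apply: le_measure; rewrite ?inE//; try exact: measurableC.
  apply: subsetC => z; rewrite /= !in_itv/= => /andP[_ zb]; exact: le_trans zb bx.
have FNb x : x < - b -> F x = 0.
  move=> xb; apply: EFin_inj; rewrite FE.
  apply: subset_measure0 mub => //; first exact: measurableC.
  move=> z; rewrite /= !in_itv/= => zx /andP[bz _].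
  by have := le_lt_trans (le_trans bz zx) xb; rewrite ltxx.
(* Right continuity of [F], from continuity from above of [mu]. *)
have Fr x y : (forall e, 0 < e -> y <= F (x + e)) -> y <= F x.
  move=> h; rewrite -lee_fin FE.
  have E : \bigcap_n `]-oo, x + n.+1%:R^-1]%classic = `]-oo, x]%classic :> set R.
    apply/seteqP; split => z /=.
      move=> hz; rewrite in_itv/=; apply/ler_addgt0Pr => e e0.
      have := hz (Num.truncn e^-1) I; rewrite /= in_itv/= => /le_trans; apply.
      rewrite lerD2l invf_ple ?posrE//.
      by apply/ltW; rewrite truncnS_gt.
    by rewrite in_itv/= => zx n _; rewrite /= in_itv/= (le_trans zx)// lerDl.
  have cv : (mu \o (fun n => `]-oo, x + n.+1%:R^-1]%classic : set R)) @ \oo --> mu `]-oo, x]%classic.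
    rewrite -E; apply: nonincreasing_cvg_mu => //.
    - exact: muTy.
    - by apply: bigcapT_measurable => n.
    - move=> n m nm; apply/subsetPset => z; rewrite /= !in_itv/= => /le_trans; apply.
      by rewrite lerD2l lef_pV2 ?posrE// ler_nat.
  rewrite -(cvg_lim _ cv)//; apply: lime_ge; first by apply/cvg_ex; eexists; exact: cv.
  by apply: nearW => n /=; rewrite -FE lee_fin h.
(* Adding the point [b] keeps the set nonempty for every real [u], and the constraint [- b <= x]
   keeps it bounded below; thus [q] is monotone with values in [-b, b] on the whole line, not only
   for [u] in ]0, 1]. *)
pose S u := [set x | (- b <= x /\ u * c <= F x) \/ x = b].
have Sb u : S u b by right.
have Slb u : lbound (S u) (- b) by move=> x [[]|->].
have Sinf u : has_inf (S u) by split; [exists b|exists (- b)].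
pose q u := inf (S u).
have qb u : - b <= q u <= b.
  apply/andP; split; first by apply: lb_le_inf => //; exists b.
  by apply: ge_inf => //; exists (- b).
have ndq : {homo q : x y / x <= y}.
  move=> u v uv; apply: lb_le_inf; first by exists b.
  move=> x [[bx vx]|->]; last by case/andP: (qb u).
  apply: ge_inf; first by exists (- b).
  by left; split => //; apply: le_trans vx; rewrite ler_pM2r.
have key u x : 0 < u <= 1 -> (x < q u) = (F x < u * c).
  move=> /andP[u0 u1]; apply/idP/idP => [xq|Fx].
    rewrite ltNge; apply/negP => ux.
    have [xb|bx] := ltP x (- b).
      by move: ux; rewrite FNb// leNgt mulr_gt0.
    move: xq; rewrite ltNge => /negP; apply; apply: ge_inf; first by exists (- b).
    by left.
  have [e e0 Fe] : exists2 e, 0 < e & F (x + e) < u * c.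
    apply: contrapT => ne; move: Fx; rewrite ltNge => /negP; apply.
    apply: Fr => e e0; rewrite leNgt; apply/negP => ?; apply: ne; by exists e.
  apply: (@lt_le_trans _ _ (x + e)); first by rewrite ltrDl.
  apply: lb_le_inf; first by exists b.
  have Sy y : S u y -> u * c <= F y.
    by move=> [[]//|->]; rewrite Fb// ger_pMl.
  move=> y /Sy uy; rewrite leNgt; apply/negP => yx.
  by have := le_lt_trans (le_trans uy (ndF _ _ (ltW yx))) Fe; rewrite ltxx.
have mq : measurable_fun [set: measurableTypeR R] q.
  exact: nondecreasing_measurable ndq.
pose k := NngNum (ltW c0).
pose X := mk_mfun mq.
(* The equivalence [key] holds for [u] in ]0, 1] only, so the uniform law must not see the
   complement. *)
have UD : U (~` `]0, 1]%classic) = 0%E.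
  pose A0 : set (measurableTypeR R) := ~` `]0, +oo[%classic.
  pose A1 : set (measurableTypeR R) := `]1, +oo[%classic.
  have U0 : U A0 = 0%E.
    apply: (etrans (probability_setC U (measurable_itv _))).
    by rewrite (uniform_ray (t := 0)) ?lexx ?ler01// subr0 subee.
  have U1 : U A1 = 0%E.
    by apply: etrans (uniform_ray (t := 1) _) _; rewrite ?subrr// ler01 lexx.
  have H : (U (A0 `|` A1) <= U A0 + U A1)%E.
    by apply: measureU2; [exact: measurableC|exact: measurable_itv].
  have -> : ~` `]0, 1]%classic = A0 `|` A1.
    apply/seteqP; split => x; rewrite /A0 /A1 /= !in_itv/= !andbT.
      by move=> /negP; rewrite negb_and -!ltNge => /orP[]; [left|right] => //; apply/negP.
    by move=> [/negP|] h; apply/negP; rewrite negb_and -!ltNge h ?orbT.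
  by apply/eqP; rewrite -measure_le0; apply: (le_trans H); rewrite U0 U1 adde0.
have UE (A B : set (measurableTypeR R)) : measurable A -> measurable B ->
    (forall u, 0 < u <= 1 -> A u <-> B u) -> U A = U B.
  move=> mA mB AB.
  have UI (C : set (measurableTypeR R)) : measurable C -> U C = U (C `&` `]0, 1]%classic).
    move=> mC; rewrite (measureDI U mC (measurable_itv `]0, 1])).
    rewrite [X in (X + _)%E](_ : _ = 0%E) ?add0e//.
    apply: subset_measure0 UD => //; first exact: measurableD.
    exact: measurableC.
  rewrite (UI A mA) (UI B mB); congr (U _).
  by apply/seteqP; split => u [Cu u01]; split => //;
    move: (u01); rewrite /= in_itv/= => /AB [h1 h2]; [exact: h1|exact: h2].
(* The rays []x, +oo[] generate the Borel sets and are closed under intersection; on such a ray both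
   measures equal [c - F x]. *)
have muE : forall A, measurable A -> mu A = mscale k (distribution U X) A.
  apply: (measure_unique (@RGenOInfty.G R) (fun n => `](- n%:R), +oo[%classic)).
  - exact: RGenOInfty.measurableE.
  - move=> _ _ [x ->] [y ->]; exists (Num.max x y); apply/seteqP.
    by split => z; rewrite /= !in_itv/= !andbT gt_max => /andP.
  - by move=> n; exists (- n%:R).
  - rewrite -subTset => x _; exists (Num.truncn `|x|).+1 => //.
    rewrite /= in_itv/= andbT ltrNl (le_lt_trans (ler_norm _))// normrN.
    by rewrite truncnS_gt.
  - move=> _ [x ->].
    have Fx0 : 0 <= F x by rewrite fine_ge0.
    have Fxc : F x <= c by rewrite -(Fb (Num.max x b)) ?le_max ?lexx ?orbT// ndF// le_max lexx.
    have UX : U (X @^-1` `]x, +oo[%classic) = (1 - F x / c)%:E.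
      have mpre : measurable (X @^-1` `]x, +oo[%classic : set (measurableTypeR R)).
        by have := mq measurableT _ (measurable_itv `]x, +oo[); rewrite setTI.
      have mray : measurable (`]F x / c, +oo[%classic : set (measurableTypeR R)).
        exact: measurable_itv.
      rewrite (UE _ _ mpre mray); last first.
        by move=> u u01; rewrite /= !in_itv/= !andbT key// ltr_pdivrMr.
      apply: (etrans (uniform_ray _)) => //.
      by rewrite ler_pdivrMr// mul1r Fxc andbT divr_ge0// ltW.
    transitivity (k%:num%:E * U (X @^-1` `]x, +oo[%classic))%E => //; rewrite UX.
    rewrite -EFinM mulrBr mulr1 mulrCA mulfV ?gt_eqF// mulr1 EFinB FE -muT.
    have := measureU mu (measurable_itv `]-oo, x]) (measurable_itv `]x, +oo[).
    rewrite (_ : _ `|` _ = setT); last first.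
      by apply/seteqP; split => z //= _; rewrite !in_itv/= andbT; case: leP; [left|right].
    move=> ->; first by rewrite addeAC subee ?muF// add0e.
    rewrite -subset0 => z; rewrite /= !in_itv/= andbT => -[zx xz].
    by have := le_lt_trans zx xz; rewrite ltxx.
  - by move=> n; rewrite muTy.
exists q; split => // n.
have iq : U.-integrable setT (fun u => (q u ^+ n)%:E).
  apply: measurable_bounded_integrable => //.
  - by rewrite ltey_eq fin_num_measure.
  - exact: measurable_funX.
  - exists (`|b| ^+ n); split; first exact: num_real.
    move=> M bM u _; apply: le_trans (ltW bM); rewrite normrX lerXn2r ?nnegrE//.
    rewrite (le_trans _ (ler_norm b))// ler_norml; exact: qb.
have mX : measurable_fun setT (fun a : R => (a ^+ n)%:E).
  by apply/measurable_EFinP; exact: measurable_funX.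
rewrite (eq_measure_integral (mscale k (distribution U X))); last by move=> A mA _; exact: muE.
rewrite integral_mscale; last by apply: integrable_pushforward.
by congr (_ * _)%E; rewrite integral_distribution.
Qed.

(** A product of segments is compact, so the sequence clusters at some [l]; [phi n] is an index at
    least [n] where the coordinates of code at most [n] are within [1 / (n + 1)] of [l]. The indices
    need not increase: [n <= phi n] is what limits require. *)
Lemma diagonal_subsequence (I : countType) (u : nat -> I -> R) (B : R) :
  (forall n i, `|u n i| <= B) -> exists phi : nat -> nat, exists l : I -> R,
    (forall n, (n <= phi n)%N) /\ forall i, (fun n => u (phi n) i) @ \oo --> l i.
Proof.
move=> uB.
pose A : forall i : I, set R := fun=> `[- B, B]%classic.
have cK := @tychonoff I (fun=> R) A (fun=> @segment_compact R (- B) B).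
pose F : set_system (prod_topology (fun _ : I => R)) := (u n @[n --> \oo])%classic.
have [l [_ cl]] : exists l, ([set f | forall i, A i (f i)] `&` cluster F) l.
  have PF : ProperFilter F by apply: fmap_proper_filter.
  apply: (cK F).
  by exists 0%N => // n _ i; rewrite /A /= in_itv/= -ler_norml.
pose V n := [set f : prod_topology (fun _ : I => R) | forall k : 'I_n.+1,
  if unpickle k is Some i then `|l i - f i| < n.+1%:R^-1 else true].
have Vl n : nbhs (l : prod_topology (fun _ : I => R)) (V n).
  have FF : Filter (nbhs (l : prod_topology (fun _ : I => R))) by exact: nbhs_filter.
  apply: (@filter_forall _ _ (fun (k : 'I_n.+1) (f : prod_topology (fun _ : I => R)) =>
    is_true (if unpickle k is Some i then `|l i - f i| < n.+1%:R^-1 else true)) _ FF) => k.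
  case: unpickle => [i|]; last exact: (@filterS _ _ FF setT _ _ filterT).
  have /cvgrPdist_lt /(_ n.+1%:R^-1) := @proj_continuous I (fun=> R) i l.
  by apply; rewrite invr_gt0.
have ex n : exists m, (n <= m)%N /\ V n (u m).
  have FA : F [set f | exists m, (n <= m)%N /\ f = u m].
    by exists n => // m /= nm; exists m.
  by have [_ [[m [nm ->]] Vm]] := cl _ _ FA (Vl n); exists m.
have [phi hphi] := choice ex; exists phi; exists l; split=> [n|i].
  by have [] := hphi n.
apply/cvgrPdist_lt => e e0; near=> n.
have [_ /(_ (inord (pickle i)))] := hphi n.
have pn : (pickle i < n.+1)%N by rewrite ltnS; near: n; exact: nbhs_infty_ge.
rewrite inordK// pickleK => /lt_le_trans; apply.
rewrite invf_ple ?posrE//.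
have : (Num.truncn e^-1 <= n)%N by near: n; exact: nbhs_infty_ge.
move=> h; apply: (le_trans (ltW (truncnS_gt _))).
by rewrite ler_nat ltnS.
Unshelve. all: by end_near. Qed.

Lemma helly (q : nat -> R -> R) (c : nat -> R) (b C : R) :
  (forall n, {homo q n : x y / x <= y}) -> (forall n u, - b <= q n u <= b) ->
  (forall n, 0 <= c n <= C) ->
  exists (phi : nat -> nat) (q_ : R -> R) (c_ : R) (E : set R),
  [/\ forall n, (n <= phi n)%N, {homo q_ : x y / x <= y} /\ (forall u, - b <= q_ u <= b),
    (fun n => c (phi n)) @ \oo --> c_, countable E &
    forall u, ~ E u -> (fun n => q (phi n) u) @ \oo --> q_ u].
Proof.
move=> ndq qb cC.
(* One family of coordinates: the values at rational points, and under [None] the total masses, so a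
   single extraction serves both. *)
pose v n (i : option rat) := if i is Some r then q n (ratr r) else c n.
have vB n i : `|v n i| <= Num.max b C.
  case: i => [r|] /=; first by rewrite le_max ler_norml qb.
  by case/andP: (cC n) => c0 cC'; rewrite ger0_norm// le_max cC' orbT.
have [phi [l [nphi cvl]]] := diagonal_subsequence vB.
pose lr (r : rat) := l (Some r).
have lrb r : - b <= lr r <= b.
  have cvr := cvl (Some r); apply/andP; split; rewrite /lr -(cvg_lim _ cvr)//.
    apply: limr_ge; first by apply/cvg_ex; eexists; exact: cvr.
    by apply: nearW => n; case/andP: (qb (phi n) (ratr r)).
  apply: limr_le; first by apply/cvg_ex; eexists; exact: cvr.
  by apply: nearW => n; case/andP: (qb (phi n) (ratr r)).
have rat_between (x y : R) : x < y -> exists r : rat, x < ratr r < y.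
  by move=> xy; have [r] := rat_in_itvoo xy; rewrite in_itv/=; exists r.
pose Sp (u : R) := [set lr r | r in [set r : rat | u < ratr r]].
pose Sm (u : R) := [set lr r | r in [set r : rat | ratr r < u]].
have Sp0 u : Sp u !=set0.
  have [r /andP[ur _]] := rat_between u (u + 1) (ltr_pwDr ltr01 (lexx u)).
  by exists (lr r), r.
have Sm0 u : Sm u !=set0.
  have [|r /andP[_ ur]] := rat_between (u - 1) u; first by rewrite ltrBlDr ltrDl.
  by exists (lr r), r.
have Splb u : has_lbound (Sp u).
  by exists (- b) => _ [r _ <-]; case/andP: (lrb r).
have Smub u : has_ubound (Sm u).
  by exists b => _ [r _ <-]; case/andP: (lrb r).
pose qp u := inf (Sp u); pose qm u := sup (Sm u).
have qpb u : - b <= qp u <= b.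
  apply/andP; split; first by apply: lb_le_inf => // _ [r _ <-]; case/andP: (lrb r).
  have [_ [r ur _]] := Sp0 u; apply: (@le_trans _ _ (lr r)); last by case/andP: (lrb r).
  by apply: ge_inf => //; exists r.
have ndqp : {homo qp : x y / x <= y}.
  move=> x y xy; apply: lb_le_inf => // _ [r yr <-]; apply: ge_inf => //.
  by exists r => //=; exact: le_lt_trans yr.
(* The jumps of the limit function. The intervals from [qm u] to [qp u] are disjoint, so a rational
   chosen in each shows countability; away from them, monotonicity squeezes [q (phi n) u] between
   rational points. *)
pose E := [set u | qm u < qp u].
exists phi, qp, (l None), E; split => //; first exact: (cvl None).
- have ex u : exists r : rat, E u -> qm u < ratr r < qp u.
    have [Eu|nE] := pselect (E u); last by exists 0.
    by have [r ?] := rat_between _ _ Eu; exists r.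
  have [f hf] := choice ex.
  apply/countable_injP; exists (fun u => pickle (f u)) => u w.
  rewrite !inE => Eu Ew /(pcan_inj pickleK) fuw.
  have H x y : E x -> E y -> f x = f y -> x < y -> False.
    move=> Ex Ey fxy xy; have [r /andP[xr ry]] := rat_between _ _ xy.
    have /andP[_ h1] := hf x Ex; have /andP[h2 _] := hf y Ey.
    have : qp x <= qm y.
      apply: (@le_trans _ _ (lr r)); first by apply: ge_inf => //; exists r.
      by apply: ub_le_sup => //; exists r.
    by move/(lt_le_trans h1)/lt_trans/(_ h2); rewrite fxy ltxx.
  have [/(H _ _ Eu Ew fuw)//|/(H _ _ Ew Eu (esym fuw))//|//] := ltgtP u w.
- move=> u /negP; rewrite -leNgt => qpm.
  apply/cvgrPdistC_lt => e e0.
  have [_ [r ur <-] hr] := inf_adherent e0 (conj (Sp0 u) (Splb u)).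
  have [_ [s su <-] hs] := sup_adherent e0 (conj (Sm0 u) (Smub u)).
  have d1 : 0 < qp u + e - lr r by rewrite subr_gt0.
  have d2 : 0 < lr s - (qm u - e) by rewrite subr_gt0.
  move/cvgrPdistC_lt : (cvl (Some r)) => /(_ _ d1) h1.
  move/cvgrPdistC_lt : (cvl (Some s)) => /(_ _ d2) h2.
  near=> n.
  have k1 : `|q (phi n) (ratr r) - lr r| < qp u + e - lr r by near: n.
  have k2 : `|q (phi n) (ratr s) - lr s| < lr s - (qm u - e) by near: n.
  have k3 : q (phi n) u <= q (phi n) (ratr r) by apply: ndq; exact: ltW.
  have k4 : q (phi n) (ratr s) <= q (phi n) u by apply: ndq; exact: ltW.
  move: k1 k2; rewrite !ltr_norml => /andP[_ k1] /andP[k2 _].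
  apply/andP; split; lra.
Unshelve. all: by end_near. Qed.

(** The limit measure is [c_] times the law of [q_] under the uniform variable. Convergence fails at
    most on a countable set, which is null, and all powers are bounded, so dominated convergence
    gives the moments. *)
Lemma moments_closed (b C : R) (c : nat -> R) (q : nat -> R -> R) :
  (forall n, {homo q n : x y / x <= y}) -> (forall n u, - b <= q n u <= b) ->
  (forall n, 0 <= c n <= C) ->
  exists (phi : nat -> nat) (mu : {measure set R -> \bar R}),
  [/\ forall n, (n <= phi n)%N, mu (~` `[- b, b]) = 0%E, (mu setT < +oo)%E &
    forall k, (fun n => (c (phi n))%:E * \int[U]_u (q (phi n) u ^+ k)%:E)%E @ \oo -->
      (\int[mu]_a (a ^+ k)%:E)%E].
Proof.
move=> ndq qb cC; have [phi [q_ [c_ [E [nphi [ndq_ qb_] cvc Ec cvq]]]]] := helly ndq qb cC.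
have c_0 : 0 <= c_.
  rewrite -(cvg_lim _ cvc)//; apply: limr_ge; first by apply/cvg_ex; eexists; exact: cvc.
  by apply: nearW => n; case/andP: (cC (phi n)).
have mq (f : R -> R) : {homo f : x y / x <= y} -> measurable_fun [set: measurableTypeR R] f.
  by move=> ndf; exact: nondecreasing_measurable ndf.
have iq (f : R -> R) n : {homo f : x y / x <= y} -> (forall u, - b <= f u <= b) ->
    U.-integrable setT (fun u => (f u ^+ n)%:E).
  move=> ndf fb; apply: measurable_bounded_integrable => //.
  - by rewrite ltey_eq fin_num_measure.
  - by apply: measurable_funX; exact: (mq _).
  - exists (`|b| ^+ n); split; first exact: num_real.
    move=> M bM u _; apply: le_trans (ltW bM); rewrite normrX lerXn2r ?nnegrE//.
    by rewrite (le_trans _ (ler_norm b))// ler_norml; exact: fb.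
pose X := mk_mfun (mq _ ndq_); pose k := NngNum c_0.
exists phi, (mscale k (distribution U X)); split => //.
- transitivity (c_%:E * U (X @^-1` (~` `[(- b)%R, b]%classic)))%E => //.
  rewrite (_ : _ @^-1` _ = set0) ?measure0 ?mule0//.
  by rewrite -subset0 => u /= /negP; rewrite in_itv/= qb_.
- apply: (@le_lt_trans _ _ (c_%:E * U (X @^-1` setT))%E) => //.
  by rewrite preimage_setT probability_setT mule1 ltry.
- move=> n; have mX : measurable_fun setT (fun a : R => (a ^+ n)%:E).
    by apply/measurable_EFinP; exact: measurable_funX.
  have iX := iq q_ n ndq_ qb_.
  rewrite integral_mscale; last by apply: integrable_pushforward.
  rewrite (integral_distribution (X := X) mX iX).
  apply: cvgeM => //.
  + rewrite mule_def_fin// integrable_fin_num//.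
  + by apply: cvg_EFin => //; exact: nearW.
  have mE : measurable (E : set (measurableTypeR R)).
    by apply: countable_measurable => //; exact: measurable_set1.
  have U0 : U E = 0%E.
    have := @dominates_uniform_prob R 0 1 ltr01.
    rewrite -/U => /null_content_dominatesP/(_ _ mE); apply.
    exact: countable_lebesgue_measure0.
  have [|||||_ _ cv] := @dominated_convergence _ (measurableTypeR R) R U setT measurableT
     (fun m u => (q (phi m) u ^+ n)%:E) (fun u => (q_ u ^+ n)%:E) (cst (`|b| ^+ n)%:E).
  + by move=> m; apply/measurable_EFinP/measurable_funX; exact: (mq _).
  + by apply/measurable_EFinP/measurable_funX; exact: (mq _).
  + exists E; split => // u /= /not_implyP[_ h]; apply: contrapT => Eu; apply: h.
    by apply: cvg_EFin; [exact: nearW|apply: (continuous_cvg _ (@exprn_continuous _ n _)); exact: cvq].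
  + by apply/integrableP; split => //; rewrite integral_cst//= probability_setT mule1 ltry.
  + apply: aeW => u m _; rewrite lee_fin normrX lerXn2r ?nnegrE//.
    by rewrite (le_trans _ (ler_norm b))// ler_norml.
  exact: cv.
Qed.

End moments.

(** * Even geometrically bounded sequences *)

Section weighted_sums.
Context {R : realType}.
Implicit Types (a c : nat -> R) (B : R).

(** The number of integers of absolute value [k]: [wsum a] is the sum over the integers of [a] at
    the absolute value. *)
Definition wt (k : nat) : R := if k == 0%N then 1 else 2.

Lemma wt_ge0 k : 0 <= wt k.
Proof. by rewrite /wt; case: ifP. Qed.

Lemma wt_le2 k : wt k <= 2.
Proof. by rewrite /wt; case: ifP => // _; rewrite ler1n. Qed.

Lemma wt_ge1 k : 1 <= wt k.
Proof. by rewrite /wt; case: ifP => // _; rewrite ler1n. Qed.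

Definition wsum a : R := limn (series (fun k => wt k * a k)).

Definition geo B a := exists C, forall k, `|a k| <= C * B ^+ k.

Lemma geo_lin B a c x y : 0 <= B -> geo B a -> geo B c -> geo B (fun k => x * a k + y * c k).
Proof.
move=> B0 [C hC] [D hD]; exists (`|x| * C + `|y| * D) => k.
rewrite (le_trans (ler_normD _ _))// !normrM mulrDl -!mulrA.
by rewrite lerD// ler_wpM2l.
Qed.

Lemma geo_ge0 B a C : (forall k, `|a k| <= C * B ^+ k) -> 0 <= C.
Proof. by move=> /(_ 0%N); rewrite expr0 mulr1; exact: le_trans. Qed.

Lemma geo_mul B a c : 0 <= B <= 1 -> geo B a -> geo B c -> geo B (fun k => a k * c k).
Proof.
move=> /andP[B0 B1] [C hC] [D hD]; exists (C * D) => k.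
have D0 := geo_ge0 hD; have C0 := geo_ge0 hC.
rewrite normrM (le_trans (ler_pM _ _ (hC k) (hD k)))// mulrACA ler_wpM2l ?mulr_ge0//.
by rewrite ler_piMr ?exprn_ge0// exprn_ile1.
Qed.

Lemma geo_norm B a : geo B a -> geo B (fun k => `|a k|).
Proof. by move=> [C hC]; exists C => k; rewrite normr_id. Qed.

Section fixed_ratio.
Variable B : R.
Hypothesis B01 : 0 <= B < 1.

Let B0 : 0 <= B. Proof. by case/andP: B01. Qed.
Let B1 : B <= 1. Proof. by case/andP: B01 => _ /ltW. Qed.

Lemma geo_wsum_cvg a : geo B a -> cvgn (series (fun k => wt k * a k)).
Proof.
move=> [C hC]; apply: normed_cvg.
apply: (series_le_cvg (v_ := geometric (2 * C) B)) => [n|n|n|] //=.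
- by rewrite mulr_ge0 ?exprn_ge0// mulr_ge0// (geo_ge0 hC).
- by rewrite normrM ger0_norm ?wt_ge0// -mulrA ler_pM ?wt_ge0 ?wt_le2.
- by apply: is_cvg_geometric_series; rewrite ger0_norm//; case/andP: B01.
Qed.

Lemma wsum_lin a c x y : geo B a -> geo B c ->
  wsum (fun k => x * a k + y * c k) = x * wsum a + y * wsum c.
Proof.
move=> /geo_wsum_cvg ca /geo_wsum_cvg cc; apply/cvg_lim => //.
have -> : series (fun k => wt k * (x * a k + y * c k)) =
   (fun n => x * series (fun k => wt k * a k) n + y * series (fun k => wt k * c k) n).
  apply/funext => n; rewrite /series/= !mulr_sumr -big_split/=.
  by apply: eq_bigr => i _; ring.
by apply: cvgD; apply: cvgMr.
Qed.

Lemma wsum_le a c : geo B a -> geo B c -> (forall k, a k <= c k) -> wsum a <= wsum c.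
Proof.
move=> /geo_wsum_cvg ca /geo_wsum_cvg cc ac; apply: lim_series_le => // n.
by rewrite ler_wpM2l ?wt_ge0.
Qed.

Lemma wsum_partial a n : geo B a -> (forall k, 0 <= a k) ->
  \sum_(k < n) wt k * a k <= wsum a.
Proof.
move=> ga a0; rewrite -(big_mkord xpredT (fun k => wt k * a k)).
apply: (@nondecreasing_cvgn_le _ (series (fun k => wt k * a k))); last exact: geo_wsum_cvg.
by apply: nondecreasing_series => k _ _; rewrite mulr_ge0 ?wt_ge0.
Qed.

Lemma wsum_ge_term a n : geo B a -> (forall k, 0 <= a k) -> a n <= wsum a.
Proof.
move=> ga a0; apply: le_trans (wsum_partial n.+1 ga a0).
rewrite big_ord_recr/= -[leLHS]add0r lerD//.
  by apply: sumr_ge0 => i _; rewrite mulr_ge0 ?wt_ge0.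
by rewrite ler_peMl ?wt_ge1.
Qed.

Lemma wsum_ge0 a : geo B a -> (forall k, 0 <= a k) -> 0 <= wsum a.
Proof. by move=> ga a0; rewrite (le_trans (a0 0%N))// wsum_ge_term. Qed.

Lemma wsum_norm a : geo B a -> `|wsum a| <= wsum (fun k => `|a k|).
Proof.
move=> ga; rewrite ler_norml; apply/andP; split; last first.
  by apply: wsum_le => //; [exact: geo_norm|move=> k; exact: ler_norm].
have := @wsum_lin a (fun k => `|a k|) 1 1 ga (geo_norm ga).
rewrite !mul1r => E; rewrite -subr_ge0 opprK -E; apply: wsum_ge0.
  by apply: geo_lin => //; exact: geo_norm.
by move=> k; rewrite !mul1r -lerBlDl sub0r -normrN; exact: ler_norm.
Qed.

Lemma wsum_geo_le a C : 0 <= C -> (forall k, `|a k| <= C * B ^+ k) ->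
  `|wsum a| <= C * wsum (fun k => B ^+ k).
Proof.
move=> C0 aC; have ga : geo B a by exists C.
have gB : geo B (fun k => B ^+ k).
  by exists 1 => k; rewrite mul1r ger0_norm// exprn_ge0.
apply: (le_trans (wsum_norm ga)).
have -> : C * wsum (fun k => B ^+ k) = wsum (fun k => C * B ^+ k + 0 * B ^+ k).
  by rewrite wsum_lin// mul0r addr0.
apply: wsum_le; [exact: geo_norm|exact: geo_lin|].
by move=> k; rewrite mul0r addr0.
Qed.

Lemma cvg_sum_ord (T : Type) (F : set_system T) {FF : Filter F} N (f : 'I_N -> T -> R) (l : 'I_N -> R) :
  (forall i, f i x @[x --> F] --> l i) -> \sum_(i < N) f i x @[x --> F] --> \sum_(i < N) l i.
Proof.
by move=> fl; apply: cvg_big => //; exact: add_continuous.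
Qed.

Lemma wsum_trunc a N :
  wsum (fun k => if (k < N)%N then a k else 0) = \sum_(k < N) wt k * a k.
Proof.
apply/cvg_lim => //; apply: cvg_near_cst; exists N => // n /= Nn.
rewrite /series/= (big_cat_nat (n := N))//= big_mkord [X in _ + X]big1_seq ?addr0; last first.
  by move=> i /andP[_]; rewrite mem_index_iota => /andP[Ni _]; rewrite ltnNge Ni mulr0.
by apply: eq_bigr => i _; rewrite ltn_ord.
Qed.

Lemma wsum_dominated (a_ : nat -> nat -> R) C :
  (forall m k, `|a_ m k| <= C * B ^+ k) -> (forall k, (fun m => a_ m k) @ \oo --> (0 : R)) ->
  (fun m => wsum (a_ m)) @ \oo --> (0 : R).
Proof.
move=> aC a0; apply/cvgrPdist_lt => e e0.
have C0 : 0 <= C by exact: (geo_ge0 (aC 0%N)).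
pose g k := C * B ^+ k.
have g0 k : 0 <= g k by rewrite mulr_ge0// exprn_ge0.
have gg : geo B g by exists C => k; rewrite ger0_norm.
have e2 : 0 < e / 2 by rewrite divr_gt0.
have /cvgrPdist_lt /(_ _ e2)[N _ /(_ N (leqnn N))] := geo_wsum_cvg gg.
rewrite /= -/(wsum g) => gN.
have cvh : (fun m => \sum_(k < N) wt k * `|a_ m k|) @ \oo --> (0 : R).
  have E0 : \sum_(k < N) wt k * `|0 : R| = 0.
    by rewrite big1// => i _; rewrite normr0 mulr0.
  rewrite -[X in _ --> X]E0; apply: cvg_sum_ord => k; apply: cvgMr; apply: cvg_norm; exact: a0.
move/cvgrPdist_lt : cvh => /(_ _ e2) h.
near=> m; have hm : `|0 - \sum_(k < N) wt k * `|a_ m k| | < e / 2 by near: m.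
rewrite sub0r normrN; rewrite sub0r normrN in hm.
have ga : geo B (a_ m) by exists C; exact: aC.
apply: (le_lt_trans (wsum_norm ga)).
(* [|a_ m|] is at most [hd + g]: the sequence itself below [N], its majorant beyond. The sum is thus
   bounded by a finite sum, small for large [m], plus the tail of [g]. *)
pose hd k := if (k < N)%N then `|a_ m k| - g k else 0.
have ghd : geo B hd.
  exists (C + C) => k; rewrite /hd; case: ifP => _; last by rewrite normr0 mulr_ge0 ?addr_ge0 ?exprn_ge0.
  by rewrite (le_trans (ler_normB _ _))// normr_id mulrDl lerD// ger0_norm.
have le1 : wsum (fun k => `|a_ m k|) <= wsum (fun k => 1 * hd k + 1 * g k).
  apply: wsum_le; [exact: geo_norm|exact: geo_lin|move=> k].
  by rewrite !mul1r /hd; case: ifP => _; rewrite ?subrK// add0r aC.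
apply: (le_lt_trans le1); rewrite wsum_lin// !mul1r wsum_trunc.
under eq_bigr do rewrite mulrBr.
rewrite sumrB -addrA [ltRHS]splitr ltrD//; first exact: le_lt_trans (ler_norm _) hm.
rewrite addrC (le_lt_trans (ler_norm _))//.
by move: gN; rewrite /series/= big_mkord.
Unshelve. all: by end_near. Qed.

Lemma series_shift_geo a : geo B a -> geo B (fun k => a k.+1).
Proof.
move=> [C hC]; exists C => k; apply: (le_trans (hC _)).
by rewrite ler_wpM2l ?(geo_ge0 hC)// exprS ler_piMl ?exprn_ge0.
Qed.

Lemma geo_cvg a : geo B a -> cvgn (series a).
Proof.
move=> [C hC]; apply: normed_cvg.
apply: (series_le_cvg (v_ := geometric C B)) => [n|n|n|] //=.
- by rewrite mulr_ge0 ?exprn_ge0// (geo_ge0 hC).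
- by apply: is_cvg_geometric_series; rewrite ger0_norm//; case/andP: B01.
Qed.

(** The first series stands for the integers [Posz k], the second for [Negz k], whose absolute value
    is [k.+1]. *)
Lemma wsum_split a : geo B a ->
  wsum a = limn (series a) + limn (series (fun k => a k.+1)).
Proof.
move=> ga; apply/cvg_lim => //.
rewrite -(cvg_shiftS (series (fun k => wt k * a k))).
have -> : (fun n => series (fun k => wt k * a k) n.+1) =
  (fun n => series a n.+1 + series (fun k => a k.+1) n).
  apply/funext => n; rewrite /series/= !big_mkord !big_ord_recl/= -addrA mul1r; congr (_ + _).
  rewrite -big_split/=; apply: eq_bigr => i _; rewrite /wt/= /bump/= add1n; ring.
apply: cvgD; first by rewrite cvg_shiftS; exact: geo_cvg.
by apply: geo_cvg; exact: series_shift_geo.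
Qed.

Lemma esum_nat_geo a : geo B a -> (forall k, 0 <= a k) ->
  \esum_(k in [set: nat]) (a k)%:E = (limn (series a))%:E.
Proof.
move=> ga a0; rewrite -nneseries_esumT => [|k]; last by rewrite lee_fin.
rewrite -EFin_lim; last exact: geo_cvg.
by congr (limn _); apply/funext => n; rewrite /series/= sumEFin.
Qed.

Lemma esum_int_even (h : int -> R) a : (forall k, h k = a `|k|%N) -> (forall k, 0 <= a k) ->
  geo B a -> \esum_(k in [set: int]) (h k)%:E = (wsum a)%:E.
Proof.
move=> ha a0 ga; rewrite (esumID [set Posz n | n in setT]); last first.
  by move=> k _; rewrite lee_fin ha.
rewrite (@reindex_esum _ _ _ setT _ Posz); last first.
  by split => [n _|n m _ _ []//|_ [_ [n _ <-]]]; [split=> //; exists n|exists n].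
rewrite (@reindex_esum _ _ _ setT (setT `&` ~` range Posz) Negz); last first.
  split => [n _|n m _ _ []//|k [_ hk]].
    by split=> // -[].
  by case: k hk => n hn; [exfalso; apply: hn; exists n|exists n].
under eq_esum do rewrite ha /=.
under [X in (_ + X)%E]eq_esum do rewrite ha /=.
by rewrite wsum_split// EFinD !esum_nat_geo//; exact: series_shift_geo.
Qed.

Lemma sumZ_even (h : int -> R) a : (forall k, h k = a `|k|%N) -> geo B a ->
  sumZ h = wsum a.
Proof.
move=> ha ga; rewrite /sumZ ha/= wsum_split//.
set u := (fun n => _).
have uE : (fun n => u n.+1) =
    (fun n => series (fun k => a k.+1) n + series (fun k => a k.+1) n).
  apply/funext => n; rewrite /u /series/= -big_split/= big_add1/=.
  by rewrite !big_mkord; apply: eq_bigr => i _; rewrite !ha/=.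
have gs := geo_cvg (series_shift_geo ga).
have cu : u @ \oo --> limn (series (fun k => a k.+1)) + limn (series (fun k => a k.+1)).
  by rewrite -cvg_shiftS uE; apply: cvgD.
rewrite (cvg_lim _ cu)// addrA; congr (_ + _); apply/esym/cvg_lim => //.
rewrite -(cvg_shiftS (series a)).
have -> : (fun n => series a n.+1) = (fun n => a 0%N + series (fun k => a k.+1) n).
  by apply/funext => n; rewrite /series/= !big_mkord big_ord_recl.
by apply: cvgD => //; exact: cvg_cst.
Qed.

End fixed_ratio.

End weighted_sums.

(** * Projection onto moment sequences *)

Section moment_functional.
Context {R : realType}.
Implicit Types (c m : nat -> R) (p q : {poly R}) (b : R).

Definition moment_form c p : R := \sum_(k < size p) p`_k * c k.

Lemma moment_form_widen c p n : (size p <= n)%N -> moment_form c p = \sum_(k < n) p`_k * c k.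
Proof.
move=> pn; rewrite /moment_form (big_ord_widen n (fun k => p`_k * c k) pn) big_mkcond/=.
by apply: eq_bigr => i _; case: ltnP => // /(nth_default 0) ->; rewrite mul0r.
Qed.

Lemma moment_form_lin c : linear (moment_form c).
Proof.
move=> a p q; pose n := maxn (size (a *: p + q)) (maxn (size p) (size q)).
rewrite !(@moment_form_widen c _ n) /n ?leq_max ?leqnn ?orbT//.
rewrite scaler_sumr -big_split/=; apply: eq_bigr => i _.
by rewrite coefD coefZ mulrDl -mulrA.
Qed.

HB.instance Definition _ c := GRing.isLinear.Build R {poly R} R *%R (moment_form c) (moment_form_lin c).

Lemma moment_formXn c n : moment_form c 'X^n = c n.
Proof.
rewrite (@moment_form_widen c _ n.+1) ?size_polyXn// big_ord_recr/= coefXn eqxx mul1r.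
by rewrite big1 ?add0r// => i _; rewrite coefXn ltn_eqF// mul0r.
Qed.

Lemma moment_form1 c : moment_form c 1 = c 0%N.
Proof. by rewrite -(expr0 'X) moment_formXn. Qed.

Lemma moment_form_cadd c1 c2 x y p :
  moment_form (fun k => x * c1 k + y * c2 k) p = x * moment_form c1 p + y * moment_form c2 p.
Proof.
rewrite /moment_form !mulr_sumr -big_split/=; apply: eq_bigr => i _; ring.
Qed.

Lemma moment_form_sqr c p :
  moment_form c (p * p) = \sum_(i < size p) \sum_(j < size p) p`_i * p`_j * c (i + j)%N.
Proof.
have pE : p = \sum_(i < size p) p`_i *: 'X^i by rewrite -poly_def coefK.
rewrite {1 2}pE mulr_suml raddf_sum/=; apply: eq_bigr => i _.
rewrite mulr_sumr raddf_sum/=; apply: eq_bigr => j _.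
by rewrite -scalerAl -scalerAr scalerA -exprD linearZ/= moment_formXn.
Qed.

Definition pos_on b c := forall p, (forall a, - b <= a <= b -> 0 <= p.[a]) -> 0 <= moment_form c p.

(** Tested on the polynomials [b^k + X^k] and [b^k - X^k], both nonnegative on [-b, b]. *)
Lemma pos_on_bound b c : 0 <= b -> pos_on b c -> forall k, `|c k| <= c 0%N * b ^+ k.
Proof.
move=> b0 pc k.
have ab a : - b <= a <= b -> `|a ^+ k| <= b ^+ k.
  by move=> ab; rewrite normrX lerXn2r ?nnegrE// ler_norml.
rewrite ler_norml; apply/andP; split.
  have := pc ((b ^+ k) *: 1 + 'X^k); rewrite linearD/= linearZ/= moment_form1 moment_formXn.
  move=> h; rewrite lerNl -subr_ge0 opprK addrC; rewrite mulrC addrC h// => a /ab.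
  rewrite ler_norml => /andP[ab1 _].
  by rewrite hornerD hornerZ hornerC mulr1 hornerXn -lerBlDl sub0r.
have := pc ((b ^+ k) *: 1 - 'X^k); rewrite linearB/= linearZ/= moment_form1 moment_formXn.
rewrite subr_ge0 mulrC => -> // a /ab; rewrite ler_norml => /andP[_ ab1].
by rewrite hornerD hornerN hornerZ hornerC mulr1 hornerXn subr_ge0.
Qed.

End moment_functional.

(** * Moment sequences of measures carried by [-b, b] *)

Section minf.
Context {R : realType}.
Implicit Types (b : R) (m r : int -> R) (mu : {measure set R -> \bar R}).

Definition carried b mu := mu (~` `[- b, b]) = 0%E /\ (mu setT < +oo)%E.

Lemma carried_bounded_integrable b mu (f : R -> R) C : 0 <= b -> carried b mu -> measurable_fun setT f ->
  (forall a, - b <= a <= b -> `|f a| <= C) -> mu.-integrable setT (EFin \o f).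
Proof.
move=> b0 [mub muT] mf fC; apply/integrableP; split; first exact/measurable_EFinP.
have bb : - b <= b by rewrite lerNl (le_trans _ b0)// oppr_le0.
have C0 : 0 <= C by apply: le_trans (fC b _); rewrite ?bb ?lexx.
apply: (@le_lt_trans _ _ (\int[mu]_a C%:E)%E).
  apply: ae_ge0_le_integral => //.
  - by apply: measurableT_comp => //; exact/measurable_EFinP.
  - exists (~` `[- b, b]%classic); split => //; first exact: measurableC.
    move=> a /= h ab; apply: h => _; rewrite lee_fin; apply: fC.
    by move: ab; rewrite in_itv.
by rewrite integral_cst//; apply: lte_mul_pinfty.
Qed.

Lemma carried_pow_integrable b mu n : 0 <= b -> carried b mu -> mu.-integrable setT (fun a => (a ^+ n)%:E).
Proof.
move=> b0 cb; apply: (carried_bounded_integrable (C := `|b| ^+ n) b0 cb).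
  exact: measurable_funX.
move=> a ab; rewrite normrX lerXn2r ?nnegrE//.
by rewrite (le_trans _ (ler_norm b))// ler_norml.
Qed.

Lemma carried_pos_on b mu c : 0 <= b -> carried b mu ->
  (forall k, (c k)%:E = (\int[mu]_a (a ^+ k)%:E)%E) -> pos_on b c.
Proof.
move=> b0 cb cE p pb; rewrite -lee_fin.
have -> : (moment_form c p)%:E = (\int[mu]_a (p.[a])%:E)%E.
  rewrite /moment_form -sumEFin.
  transitivity (\sum_(k < size p) \int[mu]_a ((p`_k)%:E * (a ^+ k)%:E))%E.
    apply: eq_bigr => i _; rewrite EFinM cE integralZl//; exact: (carried_pow_integrable _ b0).
  rewrite -integral_sum//; last by move=> i; apply: integrableZl => //; exact: (carried_pow_integrable _ b0).
  apply: eq_integral => a _; rewrite horner_coef -sumEFin; apply: eq_bigr => i _.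
  by rewrite EFinM.
have mp : measurable_fun setT (fun a : R => p.[a]).
  under eq_fun do rewrite horner_coef.
  by apply: measurable_sum => k; apply: measurable_funM => //; exact: measurable_funX.
(* The polynomial may be negative outside [-b, b]; that set is null, so its positive part has the
   same integral. *)
rewrite (@ae_eq_integral _ _ _ _ setT (fun a => (Num.max p.[a] 0)%:E))//.
- by apply: integral_ge0 => a _; rewrite lee_fin le_max lexx orbT.
- exact/measurable_EFinP.
- by apply/measurable_EFinP; exact: measurable_maxr.
- exists (~` `[- b, b]%classic); split => //; first exact: measurableC.
    by case: cb.
  move=> a /= h ab; apply: h => _; congr (_%:E); apply/esym/max_idPl; apply: pb.
  by move: ab; rewrite in_itv.
Qed.

Lemma in_Minf_pos_on b m : 0 <= b -> in_Minf b m -> pos_on b (m \o Posz).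
Proof.
move=> b0 [mu [mub muT mE]]; apply: (@carried_pos_on b mu) => // k.
exact: (mE (Posz k)).
Qed.

Lemma in_Minf_even b m : in_Minf b m -> forall k, m k = m (Posz `|k|%N).
Proof. by move=> [mu [_ _ mE]] k; apply: EFin_inj; rewrite !mE absz_nat. Qed.

Lemma in_Minf_ge0 b m : 0 <= b -> in_Minf b m -> 0 <= m 0.
Proof.
move=> b0 /(in_Minf_pos_on b0)/(_ 1); rewrite moment_form1; apply => a _.
by rewrite hornerC ler01.
Qed.

Lemma in_Minf_bound b m : 0 <= b -> in_Minf b m -> forall k : nat, `|m (Posz k)| <= m 0 * b ^+ k.
Proof. by move=> b0 /(in_Minf_pos_on b0)/(pos_on_bound b0). Qed.

Lemma in_Minf0 b : in_Minf b (fun _ => 0).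
Proof.
exists mzero; split=> //; first by rewrite /= /mzero ltry.
by move=> k; rewrite integral_measure_zero.
Qed.

Lemma in_Minf_scale b m t : 0 <= b -> 0 <= t -> in_Minf b m -> in_Minf b (fun k => t * m k).
Proof.
move=> b0 t0 [mu [mub muT mE]]; exists (mscale (NngNum t0) mu); split.
- by rewrite /= /mscale mub mule0.
- by rewrite /= /mscale lte_mul_pinfty.
- move=> k; rewrite integral_mscale ?EFinM ?mE//.
  exact: (carried_pow_integrable _ b0).
Qed.

Lemma in_Minf_add_dirac b m t a : 0 <= b -> 0 <= t -> - b <= a <= b -> in_Minf b m ->
  in_Minf b (fun k => m k + t * a ^+ `|k|%N).
Proof.
move=> b0 t0 ab [mu [mub muT mE]].
pose nu : {measure set R -> \bar R} := mscale (NngNum t0) (\d_ a : {measure set R -> \bar R}).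
have nub : nu (~` `[- b, b]) = 0%E.
  by rewrite /nu /= /mscale/= diracE memNset ?mule0//=.
have nuT : (nu setT < +oo)%E by rewrite /nu /= /mscale/= diracT mule1 ltry.
exists (measure_add mu nu); split.
- by apply: (etrans (measure_addE mu nu _)); rewrite mub nub adde0.
- by have := lte_add_pinfty muT nuT; rewrite -measure_addE.
- move=> k; rewrite integral_measure_add//; try exact: (carried_pow_integrable _ b0).
  rewrite EFinD mE; congr (_ + _)%E; rewrite integral_mscale ?integral_dirac//.
  + by rewrite diracT mul1e EFinM.
  + by apply/measurable_EFinP; exact: measurable_funX.
  + apply: (carried_pow_integrable _ b0); split; last first.
      by apply: (@le_lt_trans _ _ 1%E); rewrite ?ltry// /= diracT.
    by rewrite /= diracE memNset//= in_itv/= ab; apply.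
Qed.

End minf.

(** * Optimality conditions, existence and convergence of projections *)

Section projection.
Context {R : realType}.
Implicit Types (m r : int -> R).
(** Two ratios, because [b] may be 0: a finitely supported target is dominated by powers of a
    positive [B < 1] but not by powers of 0. *)
Variables (b B : R).
Hypothesis b0 : 0 <= b.
Hypothesis bB : b <= B.
Hypothesis B1 : B < 1.

Let B0 : 0 <= B. Proof. exact: le_trans bB. Qed.
Let B01 : 0 <= B < 1. Proof. by rewrite B0. Qed.
Let B01' : 0 <= B <= 1. Proof. by rewrite B0 ltW. Qed.

Lemma in_Minf_geo m : in_Minf b m -> geo B (m \o Posz).
Proof.
move=> mm; exists (m 0) => k; apply: (le_trans (in_Minf_bound b0 mm k)).
by rewrite ler_wpM2l ?(in_Minf_ge0 b0 mm)// lerXn2r.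
Qed.

Lemma geo_pow a : - b <= a <= b -> geo B (fun k => a ^+ k).
Proof.
move=> ab; exists 1 => k; rewrite mul1r normrX lerXn2r ?nnegrE//.
by rewrite (le_trans _ bB)// ler_norml.
Qed.

Lemma geoB (u v : nat -> R) : geo B u -> geo B v -> geo B (fun k => u k - v k).
Proof.
move=> gu gv; have := geo_lin 1 (- 1) B0 gu gv.
by congr geo; apply/funext => k; rewrite mul1r mulN1r.
Qed.

Lemma geo_sqr (u : nat -> R) : geo B u -> geo B (fun k => u k ^+ 2).
Proof. by move=> gu; exact: geo_mul. Qed.

Section fixed_target.
Variables (r : int -> R) (s : nat -> R).
Hypothesis rE : forall k, r k = s `|k|%N.
Hypothesis gs : geo B s.

Lemma ssqE m : in_Minf b m -> ssq r m = (wsum (fun k => (s k - m (Posz k)) ^+ 2))%:E.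
Proof.
move=> mm; apply: (esum_int_even B01) => [k|k|].
- by rewrite rE (in_Minf_even mm k).
- exact: sqr_ge0.
- by apply: geo_sqr; apply: geoB => //; exact: (in_Minf_geo mm).
Qed.

(** The first-order condition at [t = 0], obtained without a limit: if [x > 0], the choice
    [t = x / (x + y + 1)] gives [t y <= x], against [t y >= 2 x]. *)
Lemma slope_le0 (x y : R) : 0 <= y ->
  (forall t, 0 <= t <= 1 -> 0 <= t ^+ 2 * y - t * (2 * x)) -> x <= 0.
Proof.
move=> y0 h; rewrite leNgt; apply/negP => x0.
have d0 : 0 < x + y + 1 by rewrite ltr_wpDl// addr_ge0// ltW.
pose t := x / (x + y + 1).
have t0 : 0 < t by rewrite divr_gt0.
have tE : t * (x + y + 1) = x by rewrite /t divfK// gt_eqF.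
have t1 : t <= 1 by rewrite ler_pdivrMr// mul1r -addrA lerDl addr_ge0.
have /h : 0 <= t <= 1 by rewrite t1 ltW.
rewrite expr2 -mulrA -mulrBr pmulr_rge0// subr_ge0 => ty.
by nra.
Qed.

(** Along an admissible direction [v] the squared distance is a quadratic polynomial in [t] whose
    minimum over [0, 1] is at 0; its slope there is [-2] times the pairing. *)
Lemma proj_variation m (v : nat -> R) : is_proj b r m -> geo B v ->
  (forall t, 0 <= t <= 1 -> exists2 m', in_Minf b m' & forall k, m' (Posz k) = m (Posz k) + t * v k) ->
  wsum (fun k => (s k - m (Posz k)) * v k) <= 0.
Proof.
move=> [mm minm] gv hv.
have gd : geo B (fun k => s k - m (Posz k)) by apply: geoB => //; exact: (in_Minf_geo mm).
have gdv : geo B (fun k => (s k - m (Posz k)) * v k) by exact: geo_mul.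
apply: (@slope_le0 _ (wsum (fun k => v k ^+ 2))).
  by apply: (wsum_ge0 B01) => [|k]; [exact: geo_sqr|exact: sqr_ge0].
move=> t /hv[m' mm' m'E].
have := minm _ mm'; rewrite !ssqE// lee_fin -subr_ge0.
have -> : wsum (fun k => (s k - m' (Posz k)) ^+ 2) = 1 * wsum (fun k => (s k - m (Posz k)) ^+ 2) +
   1 * wsum (fun k => t ^+ 2 * v k ^+ 2 + (- (2 * t)) * ((s k - m (Posz k)) * v k)).
  rewrite -(wsum_lin B01); [|exact: geo_sqr|by apply: geo_lin => //; exact: geo_sqr].
  by congr wsum; apply/funext => k; rewrite m'E; ring.
rewrite !mul1r addrC addKr (wsum_lin B01)//; last exact: geo_sqr.
by congr (0 <= _); ring.
Qed.

(* Adding a point mass at [a] to the projection cannot decrease the distance. *)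
Lemma proj_dual m a : is_proj b r m -> - b <= a <= b ->
  0 <= wsum (fun k => (m (Posz k) - s k) * a ^+ k).
Proof.
move=> pm ab; have [mm _] := pm.
have := @proj_variation m (fun k => a ^+ k) pm (geo_pow ab).
have -> : wsum (fun k => (s k - m (Posz k)) * a ^+ k) =
    (- 1) * wsum (fun k => (m (Posz k) - s k) * a ^+ k) + 0 * wsum (fun k => a ^+ k).
  rewrite -(wsum_lin B01); [|apply: geo_mul => //|exact: geo_pow].
  - by congr wsum; apply/funext => k; ring.
  - by apply: geoB => //; exact: (in_Minf_geo mm).
  - exact: geo_pow.
rewrite mul0r addr0 mulN1r oppr_le0; apply => t /andP[t0 _].
exists (fun k => m k + t * a ^+ `|k|%N) => //; exact: in_Minf_add_dirac.
Qed.

(* Neither can shrinking its representing measure. *)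
Lemma proj_self m : is_proj b r m ->
  wsum (fun k => (m (Posz k) - s k) * m (Posz k)) <= 0.
Proof.
move=> pm; have [mm _] := pm; have gm := in_Minf_geo mm.
have := @proj_variation m (fun k => - m (Posz k)) pm.
have -> : (fun k => (s k - m (Posz k)) * - m (Posz k)) = (fun k => (m (Posz k) - s k) * m (Posz k)).
  by apply/funext => k; ring.
apply.
  have := geo_lin (- 1) 0 B0 gm gm.
  by congr geo; apply/funext => k /=; ring.
move=> t /andP[t0 t1]; exists (fun k => (1 - t) * m k).
  by apply: in_Minf_scale => //; rewrite subr_ge0.
by move=> k; ring.
Qed.

(** With [|m(k)| <= m(0) b^k], [proj_self] gives [m(0)^2 <= <m, m> <= <s, m> <= C m(0) \sum_k
    b^|k|]; then divide by [m(0)]. *)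
Lemma proj_mass_bound m C : is_proj b r m -> (forall k, `|s k| <= C) ->
  m 0 <= C * wsum (fun k => b ^+ k).
Proof.
move=> pm sC; have [mm _] := pm; have gm := in_Minf_geo mm.
have m0 := in_Minf_ge0 b0 mm.
have C0 : 0 <= C := le_trans (normr_ge0 _) (sC 0%N).
have gb : geo B (fun k => b ^+ k) by apply: geo_pow; rewrite lexx andbT lerNl (le_trans _ b0)// oppr_le0.
have bb01 : 0 <= b < 1 by rewrite b0 (le_lt_trans bB).
have [->|mn0] := eqVneq (m 0) 0.
  by rewrite mulr_ge0// (wsum_ge0 B01)// => k; rewrite exprn_ge0.
have mp : 0 < m 0 by rewrite lt_neqAle eq_sym mn0.
rewrite -(ler_pM2l mp).
have gmm : geo B (fun k => m (Posz k) ^+ 2) by exact: geo_sqr.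
have gsm : geo B (fun k => s k * m (Posz k)) by exact: geo_mul.
have h1 : m 0 * m 0 <= wsum (fun k => m (Posz k) ^+ 2).
  by rewrite -expr2; apply: (wsum_ge_term (a := fun k => m (Posz k) ^+ 2) B01 0) => // k; exact: sqr_ge0.
have h2 : wsum (fun k => m (Posz k) ^+ 2) <= wsum (fun k => s k * m (Posz k)).
  have := proj_self pm.
  have -> : wsum (fun k => (m (Posz k) - s k) * m (Posz k)) =
     1 * wsum (fun k => m (Posz k) ^+ 2) + (- 1) * wsum (fun k => s k * m (Posz k)).
    by rewrite -(wsum_lin B01)//; congr wsum; apply/funext => k; ring.
  by rewrite mul1r mulN1r subr_le0.
apply: (le_trans h1); apply: (le_trans h2); apply: (le_trans (ler_norm _)).
rewrite mulrA (mulrC _ C); apply: (wsum_geo_le bb01); first by rewrite mulr_ge0.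
move=> k; rewrite normrM -mulrA ler_pM//; exact: (in_Minf_bound b0 mm).
Qed.

Let U : probability (measurableTypeR R) R := uniform_prob (@ltr01 R).

Lemma in_Minf_quantile m : in_Minf b m -> exists q : R -> R,
  [/\ {homo q : x y / x <= y}, forall u, - b <= q u <= b &
   forall k, ((m (Posz k))%:E = (m 0)%:E * \int[U]_u (q u ^+ k)%:E)%E].
Proof.
move=> mm; have [m0|mn0] := eqVneq (m 0) 0.
  exists (fun=> 0); split => // [_|k]; first by rewrite oppr_le0 b0.
  rewrite m0 mul0e; congr EFin; apply/eqP; rewrite -normr_le0.
  by apply: (le_trans (in_Minf_bound b0 mm k)); rewrite m0 mul0r.
have mp : 0 < m 0 by rewrite lt_neqAle eq_sym mn0 (in_Minf_ge0 b0 mm).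
have [mu [mub muT mE]] := mm.
have muTE : mu setT = (m 0)%:E.
  by rewrite mE; under eq_integral do rewrite /= expr0; rewrite integral_cst//= mul1e.
have [q [ndq qb qE]] := quantile_repr mp mub muTE.
by exists q; split => // k; rewrite mE -qE.
Qed.

Lemma proj_exists : exists m, is_proj b r m.
Proof.
pose J m := wsum (fun k => (s k - m (Posz k)) ^+ 2).
have gJ m : in_Minf b m -> geo B (fun k => (s k - m (Posz k)) ^+ 2).
  by move=> mm; apply: geo_sqr; apply: geoB => //; exact: (in_Minf_geo mm).
pose S := [set J m | m in in_Minf b].
have Slb : lbound S 0.
  by move=> _ [m mm <-]; apply: (wsum_ge0 B01); [exact: gJ|move=> k; exact: sqr_ge0].
have Sinf : has_inf S by split; [exists (J (fun=> 0)), (fun=> 0) => //; exact: in_Minf0|exists 0].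
have near_inf n : exists m, in_Minf b m /\ J m < inf S + n.+1%:R^-1.
  by have [|_ [m mm <-] Jm] := @inf_adherent _ S n.+1%:R^-1 _ Sinf; [rewrite invr_gt0|exists m].
have [m_ hm] := choice near_inf.
have mm n := (hm n).1.
have Jm n : J (m_ n) <= inf S + 1.
  by apply: (le_trans (ltW (hm n).2)); rewrite lerD2l invf_le1// ler1n.
have [q hq] := choice (fun n => in_Minf_quantile (mm n)).
(* From [x <= x^2 + 1/4] with [x = m_ n 0 - s 0], whose square is one term of the squared distance
   and so at most [inf S + 1]. *)
have m0C n : 0 <= m_ n 0 <= `|s 0%N| + inf S + 2.
  rewrite (in_Minf_ge0 b0 (mm n))/=.
  have : (s 0%N - m_ n 0) ^+ 2 <= inf S + 1.
    apply: le_trans (Jm n).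
    by apply: (wsum_ge_term (a := fun k => (s k - m_ n (Posz k)) ^+ 2) B01 0); [exact: gJ|move=> k; exact: sqr_ge0].
  have := sqr_ge0 (m_ n 0 - s 0%N - 2^-1); have := ler_norm (s 0%N).
  by move: (inf S) (s 0%N) (m_ n 0) `|s 0%N| => I x y z; nra.
have [phi [mu [nphi mub muT cv]]] :=
  moments_closed (fun n => (let: And3 h _ _ := hq n in h)) (fun n => (let: And3 _ h _ := hq n in h)) m0C.
have cb : carried b mu by [].
pose m k := fine (\int[mu]_a (a ^+ `|k|%N)%:E)%E.
have mE k : (m k)%:E = (\int[mu]_a (a ^+ `|k|%N)%:E)%E.
  rewrite fineK//; apply: integrable_fin_num => //; exact: (carried_pow_integrable _ b0 cb).
have mmm : in_Minf b m by exists mu.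
have cvm k : (fun n => m_ (phi n) (Posz k)) @ \oo --> m (Posz k).
  have := cv k; rewrite -[X in _ --> X](mE (Posz k)).
  rewrite (_ : (fun n => _) = (fun n => (m_ (phi n) (Posz k))%:E)); last first.
    by apply/funext => n; have [_ _ ->] := hq (phi n).
  by move/fine_cvg.
exists m; split => // m' mm'; rewrite !ssqE// lee_fin.
apply: (@le_trans _ _ (inf S)); last by apply: ge_inf; [exists 0|exists m'].
(* Lower semicontinuity as in Fatou's lemma: each partial sum for the limit [m] is a limit of
   partial sums for [m_ (phi n)], which stay below [inf S + 1 / (n + 1)] since [n <= phi n]. *)
apply: limr_le; first exact: (geo_wsum_cvg B01 (gJ _ mmm)).
apply: nearW => N; rewrite /series/= big_mkord.
have cvN : (fun n => \sum_(k < N) wt k * (s k - m_ (phi n) (Posz k)) ^+ 2) @ \oo -->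
    \sum_(k < N) wt k * (s k - m (Posz k)) ^+ 2.
  apply: cvg_sum_ord => k; apply: cvgMr.
  apply: (continuous_cvg _ (@exprn_continuous _ 2 _)).
  by apply: cvgB; [exact: cvg_cst|exact: cvm].
have cvI : (fun n => inf S + n.+1%:R^-1) @ \oo --> inf S + 0.
  by apply: cvgD; [exact: cvg_cst|exact: cvg_harmonic].
rewrite addr0 in cvI.
rewrite -(cvg_lim _ cvN)// -(cvg_lim _ cvI)//; apply: ler_lim.
- by apply/cvg_ex; eexists; exact: cvN.
- by apply/cvg_ex; eexists; exact: cvI.
apply: nearW => n.
apply: (@le_trans _ _ (J (m_ (phi n)))).
  by apply: (wsum_partial B01); [exact: gJ|move=> k; exact: sqr_ge0].
apply: (le_trans (ltW (hm (phi n)).2)); rewrite lerD2l lef_pV2 ?posrE//.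
by rewrite ler_nat ltnS.
Qed.

End fixed_target.

(** Truncating [\sum_k d_k a^|k|] at [N] gives a polynomial in [a]; adding the constant [tail N],
    which bounds the discarded terms uniformly on [-b, b], makes it nonnegative there. The
    functional of [c] applies, and [tail N] tends to 0. *)
Lemma pairing_ge0 (d c : nat -> R) : geo B d -> pos_on b c ->
  (forall a, - b <= a <= b -> 0 <= wsum (fun k => d k * a ^+ k)) ->
  0 <= wsum (fun k => d k * c k).
Proof.
move=> gd pc hd.
have bb : - b <= b <= b by rewrite lexx andbT lerNl (le_trans _ b0)// oppr_le0.
have gb := geo_pow bb.
pose g k := `|d k| * b ^+ k.
have gg : geo B g by apply: geo_mul => //; exact: geo_norm.
have gc : geo B c.
  exists (c 0%N) => k; apply: (le_trans (pos_on_bound b0 pc k)).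
  by rewrite ler_wpM2l ?lerXn2r// (geo_ge0 (pos_on_bound b0 pc)).
have gdc : geo B (fun k => d k * c k) by exact: geo_mul.
pose tail N := wsum g - series (fun k => wt k * g k) N.
have cvt : tail @ \oo --> (0 : R).
  rewrite -(subrr (wsum g)); apply: cvgB; first exact: cvg_cst.
  exact: (geo_wsum_cvg B01 gg).
have cvs := geo_wsum_cvg B01 gdc.
have cvsum : (fun N => series (fun k => wt k * (d k * c k)) N + tail N * c 0%N) @ \oo -->
    wsum (fun k => d k * c k) + 0 * c 0%N.
  by apply: cvgD => //; apply: cvgMl.
rewrite mul0r addr0 in cvsum.
rewrite -(cvg_lim _ cvsum)//; apply: limr_ge; first by apply/cvg_ex; eexists; exact: cvsum.
apply: nearW => N.
pose p := \poly_(k < N) (wt k * d k).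
have := pc (p + tail N *: 1); rewrite linearD/= linearZ/= moment_form1.
rewrite (@moment_form_widen _ c p N) ?size_poly//.
have -> : series (fun k => wt k * (d k * c k)) N = \sum_(k < N) p`_k * c k.
  rewrite /series/= big_mkord; apply: eq_bigr => k _.
  by rewrite coef_poly ltn_ord mulrA.
apply => a ab; rewrite hornerD hornerZ hornerC mulr1 horner_poly.
apply: (le_trans (hd a ab)).
have ga := geo_pow ab.
have gda : geo B (fun k => d k * a ^+ k) by exact: geo_mul.
pose h k := if (k < N)%N then d k * a ^+ k - g k else 0.
have gh : geo B h.
  have [C hC] := geoB gda gg; exists C => k; rewrite /h; case: ifP => _ //.
  by rewrite normr0 mulr_ge0 ?exprn_ge0// (geo_ge0 hC).
have dag k : d k * a ^+ k <= g k.
  apply: (le_trans (ler_norm _)); rewrite normrM ler_wpM2l// normrX lerXn2r ?nnegrE//.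
  by rewrite ler_norml.
apply: (@le_trans _ _ (wsum (fun k => 1 * h k + 1 * g k))).
  apply: (wsum_le B01) => //; first exact: geo_lin.
  by move=> k; rewrite !mul1r /h; case: ifP => _; rewrite ?subrK// add0r.
rewrite (wsum_lin B01)// !mul1r wsum_trunc /tail addrCA addrC lerD2r// lerBrDr.
rewrite /series/= big_mkord -big_split/=.
by apply: ler_sum => k _; rewrite -mulrDr subrK mulrA.
Qed.

(* [|m - c|^2 = <m - s, m> - <m - s, c> + <s - c, m - c>]: the first term is
   nonpositive by [proj_self], the pairing in the second is nonnegative by [proj_dual]
   and positivity of [c], and the third vanishes by dominated convergence. *)
Lemma proj_cvg (r_ m_ : nat -> int -> R) (s_ : nat -> nat -> R) (c : nat -> R) C :
  (forall n k, r_ n k = s_ n `|k|%N) -> (forall n, geo B (s_ n)) ->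
  (forall n k, `|s_ n k| <= C) -> (forall k, s_ ^~ k @ \oo --> c k) ->
  pos_on b c -> (forall n, is_proj b (r_ n) (m_ n)) ->
  (forall k : nat, (fun n => m_ n (Posz k)) @ \oo --> c k) /\
  (forall n (k : nat), `|m_ n (Posz k)| <= C * wsum (fun k => b ^+ k) * b ^+ k).
Proof.
move=> rE gs sC sc pc pm.
have mm n : in_Minf b (m_ n) by have [] := pm n.
have gm n : geo B (fun k => m_ n (Posz k)) := in_Minf_geo (mm n).
have mC n k : `|m_ n (Posz k)| <= C * wsum (fun k => b ^+ k) * b ^+ k.
  apply: (le_trans (in_Minf_bound b0 (mm n) k)); rewrite ler_wpM2r ?exprn_ge0//.
  exact: (proj_mass_bound (rE n) (gs n) (pm n)).
split => // k; set K := C * _ in mC.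
have cC := pos_on_bound b0 pc.
have c0 : 0 <= c 0%N := geo_ge0 cC.
have gc : geo B c.
  by exists (c 0%N) => j; apply: (le_trans (cC j)); rewrite ler_wpM2l ?lerXn2r.
have C0 : 0 <= C := le_trans (normr_ge0 _) (sC 0%N 0%N).
(* The factor [m - c] supplies the geometric majorant; [s - c] is merely bounded, uniformly, and
   tends to 0 at each lag. *)
pose z n j := (s_ n j - c j) * (m_ n (Posz j) - c j).
have b01 : 0 <= b < 1 by rewrite b0 (le_lt_trans bB).
have zb n j : `|z n j| <= ((C + c 0%N) * (K + c 0%N)) * b ^+ j.
  rewrite normrM -mulrA ler_pM//.
    rewrite (le_trans (ler_normB _ _))// lerD// (le_trans (cC j))//.
    by rewrite ler_piMr// exprn_ile1// ltW// (le_lt_trans bB).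
  by rewrite (le_trans (ler_normB _ _))// mulrDl lerD.
have z0 : (fun n => wsum (z n)) @ \oo --> (0 : R).
  apply: (wsum_dominated b01 zb) => j.
  have /cvgr0Pnorm_lt h : (fun n => s_ n j - c j) @ \oo --> (0 : R).
    by rewrite -(subrr (c j)); apply: cvgB => //; exact: cvg_cst.
  apply/cvgr0Pnorm_lt => e e0.
  have Kp : 0 < K + c 0%N + 1.
    rewrite ltr_wpDl// addr_ge0// (le_trans (normr_ge0 _) (le_trans (mC 0%N 0%N) _))//.
    by rewrite expr0 mulr1.
  have d0 : 0 < e / (K + c 0%N + 1) by rewrite divr_gt0.
  near=> n; rewrite normrM.
  have hn : `|s_ n j - c j| < e / (K + c 0%N + 1) by near: n; exact: h.
  have hm : `|m_ n (Posz j) - c j| <= K + c 0%N.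
    have K0 : 0 <= K by rewrite (le_trans (normr_ge0 _) (le_trans (mC 0%N 0%N) _))// expr0 mulr1.
    rewrite (le_trans (ler_normB _ _))// lerD//.
      by rewrite (le_trans (mC n j))// ler_piMr// exprn_ile1// ltW// (le_lt_trans bB).
    by rewrite (le_trans (cC j))// ler_piMr// exprn_ile1// ltW// (le_lt_trans bB).
  move: hn; rewrite ltr_pdivlMr//.
  apply: le_lt_trans; rewrite ler_wpM2l// (le_trans hm)// lerDl//.
have key n : (m_ n (Posz k) - c k) ^+ 2 <= wsum (z n).
  have gmc := geoB (gm n) gc.
  have gms := geoB (gm n) (gs n).
  have gsc := geoB (gs n) gc.
  apply: (@le_trans _ _ (wsum (fun j => (m_ n (Posz j) - c j) ^+ 2))).
    apply: (wsum_ge_term (a := fun j => (m_ n (Posz j) - c j) ^+ 2) B01 k); first exact: geo_sqr.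
    by move=> j; exact: sqr_ge0.
  have -> : wsum (fun j => (m_ n (Posz j) - c j) ^+ 2) =
    1 * wsum (fun j => 1 * ((m_ n (Posz j) - s_ n j) * m_ n (Posz j)) +
        (- 1) * ((m_ n (Posz j) - s_ n j) * c j)) + 1 * wsum (z n).
    rewrite -(wsum_lin B01); [|apply: geo_lin => //; exact: geo_mul|exact: geo_mul].
    by congr wsum; apply/funext => j; rewrite /z; ring.
  rewrite !mul1r gerDr (wsum_lin B01); [|exact: geo_mul|exact: geo_mul].
  rewrite mul1r mulN1r subr_le0.
  apply: (le_trans (proj_self (rE n) (gs n) (pm n))) => //.
  apply: pairing_ge0 => // a ab; exact: (proj_dual (rE n) (gs n) (pm n)).
apply/subr_cvg0/cvgr0Pnorm_lt => e e0.
have e2 : 0 < e ^+ 2 by rewrite exprn_gt0.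
move/cvgr0Pnorm_lt : z0 => /(_ _ e2) h; near=> n.
have hn : `|wsum (z n)| < e ^+ 2 by near: n.
rewrite -(@ltr_pXn2r _ 2)// ?nnegrE ?(ltW e0)// -normrX ger0_norm ?sqr_ge0//.
exact: le_lt_trans (key n) (le_lt_trans (ler_norm _) hn).
Unshelve. all: by end_near. Qed.

End projection.

(* Both functionals are nonnegative on squares, so [cp] is dominated by [c] on squares;
   this makes [cp] continuous for the uniform norm on [[-b, b]], and approximating the
   square root of a nonnegative polynomial yields positivity. *)
Section dominated_positivity.
Context {R : realType}.
Variables (b : R) (cp cm c : nat -> R).
Hypothesis b01 : 0 <= b <= 1.
Hypothesis cp_sqr : forall p, 0 <= moment_form cp (p * p).
Hypothesis cm_sqr : forall p, 0 <= moment_form cm (p * p).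
Hypothesis cE : forall k, c k = cp k + cm k.
Hypothesis c_pos : pos_on b c.

(** With [u = 1 + e / eta] and [v = 1 - e / eta], [e = (eta / 4) (u^2 - v^2)]. The functional is
    nonnegative at [u^2]; at [v^2] it is dominated by that of [c], and [v^2 <= 4] on [-b, b]. *)
Lemma moment_form_small e (eta : R) : 0 < eta -> (forall a, - b <= a <= b -> `|e.[a]| <= eta) ->
  - eta * c 0%N <= moment_form cp e.
Proof.
move=> eta0 he; pose u := 1 + eta^-1 *: e; pose v := 1 - eta^-1 *: e.
have eE : e = (eta / 4) *: (u * u) - (eta / 4) *: (v * v).
  rewrite -scalerBr /u /v; set x := eta^-1 *: e.
  have -> : (1 + x) * (1 + x) - (1 - x) * (1 - x) = 4%:R *: x.
    by rewrite scaler_nat -mulr_natl; ring.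
  by rewrite /x !scalerA ?mulrA divfK// divff ?scale1r// gt_eqF.
have v4 : moment_form cp (v * v) <= 4 * c 0%N.
  have : moment_form cp (v * v) <= moment_form c (v * v).
    rewrite (_ : moment_form c (v * v) = moment_form (fun k => 1 * cp k + 1 * cm k) (v * v)); last first.
      by congr moment_form; apply/funext => k; rewrite cE !mul1r.
    by rewrite moment_form_cadd !mul1r lerDl.
  move=> /le_trans; apply.
  have := c_pos (p := 4 *: 1 - v * v); rewrite linearB/= linearZ/= moment_form1 subr_ge0; apply => a ab.
  rewrite hornerD hornerN hornerZ hornerM hornerC mulr1 /v !hornerE.
  have : `|eta^-1 * e.[a]| <= 1.
    by rewrite normrM ger0_norm ?invr_ge0 ?(ltW eta0)// ler_pdivrMl// mulr1 he.
  rewrite ler_norml => /andP[h1 h2]; nra.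
have -> : moment_form cp e = eta / 4 * moment_form cp (u * u) - eta / 4 * moment_form cp (v * v).
  by rewrite [in LHS]eE linearB/= !linearZ.
have h0 : 0 <= eta / 4 by rewrite divr_ge0 ?ltW.
have := cp_sqr u; move: h0 v4 eta0; move: (moment_form cp (u * u)) (moment_form cp (v * v)) (c 0%N) => x y z; nra.
Qed.

(* [s_0 = 0], [s_(n+1) = s_n + (x - s_n^2)/2] increases to [sqrt x] on [[0, 1]]. *)
Fixpoint sqrt_poly (p : {poly R}) n : {poly R} :=
  if n is n'.+1 then sqrt_poly p n' + 2^-1 *: (p - sqrt_poly p n' * sqrt_poly p n') else 0.

(** The error [d = y - s_n] becomes [d (1 - (y + s_n) / 2)], at most [d (1 - d / 2)]; this recursion
    preserves a bound of the form [2 / (n + 1)]. *)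
Lemma sqrt_poly_bound p (a y : R) n : 0 <= y <= 1 -> p.[a] = y ^+ 2 ->
  0 <= (sqrt_poly p n).[a] <= y /\ (y - (sqrt_poly p n).[a]) * n.+1%:R <= 2.
Proof.
move=> /andP[y0 y1] py; elim: n => [|n [/andP[s0 sy] sn]] /=.
  by rewrite horner0 lexx y0 subr0 mulr1 (le_trans y1)// ler1n.
rewrite hornerD hornerZ hornerD hornerN hornerM py.
move: (sqrt_poly p n).[a] s0 sy sn => s s0 sy.
rewrite -[n.+2%:R]natr1; have : 0 <= n.+1%:R :> R by [].
move: n.+1%:R => N N0 sN.
have h1 : 0 <= (2 - (y - s) * N) * (2 - (y - s)) by rewrite mulr_ge0 ?subr_ge0//; lra.
have h2 : 0 <= (y - s) * s by rewrite mulr_ge0 ?subr_ge0.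
have h3 : 0 <= (y - s) * (2 - (y + s)) by rewrite mulr_ge0 ?subr_ge0//; lra.
have h4 : 0 <= (y - s) * s * (N + 1) by rewrite mulr_ge0 ?addr_ge0.
split; first by nra.
by nra.
Qed.

Lemma pos_on_dominated : pos_on b cp.
Proof.
(* As [-b, b] lies in [-1, 1], the sum of the absolute coefficients bounds [p] there; adding 1 makes
   [S] positive, so that [p / S] takes values in [0, 1]. *)
move=> p pb; pose S := \sum_(k < size p) `|p`_k| + 1.
have S0 : 0 < S by rewrite ltr_wpDl// sumr_ge0.
have pS a : - b <= a <= b -> p.[a] <= S.
  move=> ab; rewrite horner_coef (@le_trans _ _ (\sum_(k < size p) `|p`_k|))// ?lerDl//.
  apply: ler_sum => k _; rewrite (le_trans (ler_norm _))// normrM ler_piMr// normrX exprn_ile1//.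
  case/andP: b01 => _ b1; rewrite ler_norml.
  by case/andP: ab => h1 h2; rewrite (le_trans _ h1) ?lerN2// (le_trans h2).
pose p' := S^-1 *: p.
have -> : p = S *: p' by rewrite scalerA divff ?scale1r// gt_eqF.
rewrite linearZ/= mulr_ge0 ?(ltW S0)//.
(* On [-b, b] the remainder [y^2 - s^2 = (y - s) (y + s)] is at most [2 (y - s)], hence at most
   [4 / (n + 1)]. *)
have key n : 0 <= moment_form cp p' + 4 * n.+1%:R^-1 * c 0%N.
  pose s := sqrt_poly p' n.
  have -> : p' = s * s + (p' - s * s) by rewrite addrCA subrr addr0.
  rewrite linearD/= -addrA addr_ge0//.
  have e0 : 0 < 4 * n.+1%:R^-1 :> R by rewrite mulr_gt0// invr_gt0.
  have := moment_form_small (e := p' - s * s) e0; rewrite -subr_ge0 mulNr opprK; apply => a ab.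
  have p0 : 0 <= p'.[a] by rewrite hornerZ mulr_ge0 ?pb// invr_ge0 ltW.
  have p1 : p'.[a] <= 1 by rewrite hornerZ ler_pdivrMl// mulr1 pS.
  have yE : p'.[a] = Num.sqrt p'.[a] ^+ 2 by rewrite sqr_sqrtr.
  have y01 : 0 <= Num.sqrt p'.[a] <= 1 by rewrite sqrtr_ge0 -sqrtr1 ler_wsqrtr.
  have [/andP[s0 sy] sn] := sqrt_poly_bound n y01 yE.
  rewrite hornerD hornerN hornerM yE -/s.
  rewrite ler_pdivlMr//.
  rewrite -/s in s0 sy sn; case/andP: y01 => y0 y1.
  move: (Num.sqrt _) s.[a] s0 sy sn y0 y1 => y t t0 ty tn y0 y1.
  rewrite ger0_norm; last by nra.
  have h1 : 0 <= (2 - (y - t) * n.+1%:R) * (y + t) by rewrite mulr_ge0 ?subr_ge0 ?addr_ge0.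
  by nra.
have cv : (fun n => moment_form cp p' + 4 * n.+1%:R^-1 * c 0%N) @ \oo --> moment_form cp p' + 4 * 0 * c 0%N.
  apply: cvgD; first exact: cvg_cst.
  by apply: cvgMl; apply: cvgMr; exact: cvg_harmonic.
rewrite mulr0 mul0r addr0 in cv.
rewrite -(cvg_lim _ cv)//; apply: limr_ge; first by apply/cvg_ex; eexists; exact: cv.
exact: nearW.
Qed.

End dominated_positivity.

(** * Support of the spectral measure *)

Section spectral_support.
Context {R : realType}.
Variables (gam : int -> R) (F : {measure set R -> \bar R}) (delta : R).
Hypothesis gamF : spectral_measure_of gam F.
Hypothesis delta0 : 0 < delta.
Hypothesis deltaF : delta <= Delta F.

Lemma supp_le1 x : supp F x -> `|x| <= 1.
Proof.
have [F1 _ _] := gamF; move=> xF; rewrite leNgt; apply/negP => x1.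
have /xF : 0 < `|x| - 1 by rewrite subr_gt0.
rewrite (_ : F _ = 0%E) ?ltxx//; apply: subset_measure0 F1 => //.
- exact: measurable_itv.
- exact: measurableC.
move=> y; rewrite /oball /= !in_itv/= => /andP[y1 y2] /andP[y3 y4].
by move: y1 y2 x1; case: (ger0P x) => _; lra.
Qed.

Let A : set R := [set `|x| | x in supp F] `|` [set 0].

Lemma supp_sup : has_sup A.
Proof.
split; first by exists 0; right.
by exists 1 => _ [[x xF <-]|->] //; exact: supp_le1.
Qed.

Lemma spectral_radius_bounds : 0 <= 1 - delta < 1.
Proof.
rewrite ltrBlDr ltrDl delta0 andbT.
have : 0 <= sup A by apply: ub_le_sup; [exact: supp_sup.2|right].
by move: deltaF; rewrite /Delta -/A; lra.
Qed.

Lemma spectral_carried : carried (1 - delta) F.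
Proof.
have [_ FT _] := gamF; split => //.
(* An enumeration of the open intervals with rational endpoints, keeping only those of mass 0. *)
pose V n : set R := if unpickle n is Some (p, q) then
  if F `]ratr p, ratr q[%classic == 0%E then `](ratr p : R), ratr q[%classic else set0 else set0.
have mV n : measurable (V n).
  by rewrite /V; case: unpickle => // -[p q]; case: ifP.
have V0 n : F.-negligible (V n).
  apply/negligibleP => //; rewrite /V; case: unpickle => [[p q]|]; last by rewrite measure0.
  by case: ifPn => [/eqP//|_]; rewrite measure0.
(* Lindelof: the complement of the support is covered by null rational intervals. *)
have sub : ~` `[- (1 - delta), 1 - delta] `<=` \bigcup_n V n.
  move=> x /= /negP; rewrite in_itv/= -ler_norml -ltNge => xd.
  have nx : ~ supp F x.
    move=> xF; have : `|x| <= sup A by apply: ub_le_sup; [exact: supp_sup.2|left; exists x].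
    by move: deltaF xd; rewrite /Delta -/A; lra.
  move/existsNP : nx => [e /not_implyP[e0 /negP]]; rewrite -leNgt measure_le0 => /eqP Fe.
  have [p] : exists p : rat, x - e < ratr p < x.
    have [|p] := @rat_in_itvoo R (x - e) x; first by rewrite ltrBlDr ltrDl.
    by rewrite in_itv/=; exists p.
  have [q] : exists q : rat, x < ratr q < x + e.
    have [|q] := @rat_in_itvoo R x (x + e); first by rewrite ltrDl.
    by rewrite in_itv/=; exists q.
  move=> /andP[xq qe] /andP[ep px]; exists (pickle (p, q)); first exact: I.
  rewrite /V pickleK ifT; first by rewrite /= in_itv/= px xq.
  apply/eqP; apply: subset_measure0 Fe => //; first exact: measurable_itv.
  move=> y; rewrite /oball /= !in_itv/= => /andP[py yq].
  by rewrite (lt_trans ep py) (lt_trans yq qe).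
apply/eqP; rewrite -measure_le0.
have /negligibleP <- : F.-negligible (\bigcup_n V n) by exact: negligible_bigcup.
  by apply: le_measure; rewrite ?inE//; [exact: measurableC|exact: bigcupT_measurable].
exact: bigcupT_measurable.
Qed.

Lemma spectral_pos_on : pos_on (1 - delta) (gam \o Posz).
Proof.
apply: (@carried_pos_on _ (1 - delta) F); first by case/andP: spectral_radius_bounds.
- exact: spectral_carried.
- by move=> k; have [_ _ /(_ (Posz k))] := gamF.
Qed.

End spectral_support.

(** * Empirical autocovariances *)

Section empirical_autocovariance.
Context {R : realType}.
Implicit Types (y z u : nat -> R).

Definition avg y M : R := M%:R^-1 * \sum_(t < M) y t.

Definition crosscov M y z k : R :=
  if (k < M)%N then M%:R^-1 * \sum_(t < M - k) ((y t - avg y M) * (z (t + k)%N - avg z M))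
  else 0.

Lemma autocov_crosscov M y k : autocov M y k = crosscov M y y `|k|%N.
Proof. by []. Qed.

Lemma crosscov_lin M y z a b k :
  crosscov M (fun t => a * y t + b * z t) (fun t => a * y t + b * z t) k =
  a ^+ 2 * crosscov M y y k + a * b * (crosscov M y z k + crosscov M z y k)
   + b ^+ 2 * crosscov M z z k.
Proof.
rewrite /crosscov; case: ifP => _; last by rewrite addr0 !mulr0 !addr0.
have -> : avg (fun t => a * y t + b * z t) M = a * avg y M + b * avg z M.
  by rewrite /avg big_split/= -!mulr_sumr; ring.
set N := M%:R^-1; set S1 := \sum_(_ < _) _; set S2 := \sum_(_ < _) _; set S3 := \sum_(_ < _) _.
set S4 := \sum_(_ < _) _; set S5 := \sum_(_ < _) _.
have -> : a ^+ 2 * (N * S2) + a * b * (N * S3 + N * S4) + b ^+ 2 * (N * S5) =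
  N * (a ^+ 2 * S2 + a * b * (S3 + S4) + b ^+ 2 * S5) by ring.
congr (_ * _); rewrite /S1 /S2 /S3 /S4 /S5 -big_split/= !mulr_sumr -!big_split/=.
by apply: eq_bigr => t _; ring.
Qed.

(** Each product is at most the half-sum of two squares, and over the sum each index occurs at most
    once as [t] and once as [t + k]. A bound at lag 0 thus serves all lags. *)
Lemma crosscov_le M y k : `|crosscov M y y k| <= crosscov M y y 0%N.
Proof.
have c0 : 0 <= crosscov M y y 0%N.
  rewrite /crosscov; case: ifP => // _; rewrite mulr_ge0 ?invr_ge0// sumr_ge0// => t _.
  by rewrite addn0 -expr2 sqr_ge0.
rewrite {1}/crosscov; case: ltnP => kM; last by rewrite normr0.
rewrite /crosscov (leq_ltn_trans _ kM)// normrM ger0_norm ?invr_ge0// ler_wpM2l ?invr_ge0// subn0.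
pose v t := y t - avg y M.
rewrite (le_trans (ler_norm_sum _ _ _))//.
apply: (@le_trans _ _ (\sum_(t < M - k) (v t ^+ 2 + v (t + k)%N ^+ 2) / 2)).
  apply: ler_sum => t _; rewrite -/(v t) -/(v (t + k)%N) normrM.
  rewrite -[v t ^+ 2]real_normK ?num_real// -[v (t + k)%N ^+ 2]real_normK ?num_real//.
  have := sqr_ge0 (`|v t| - `|v (t + k)%N|); rewrite sqrrB; lra.
have -> : \sum_(t < M) (y t - avg y M) * (y (t + 0)%N - avg y M) =
    \sum_(0 <= t < M) v t ^+ 2.
  by rewrite big_mkord; apply: eq_bigr => t _; rewrite addn0.
rewrite -mulr_suml big_split/= ler_pdivrMr// mulr_natr mulr2n lerD//.
  rewrite -(big_mkord xpredT (fun t => v t ^+ 2)) (big_cat_nat (n := M - k) (p := M))//= ?leq_subr//.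
  by rewrite lerDl; apply: sumr_ge0 => t _; exact: sqr_ge0.
rewrite -(big_mkord xpredT (fun t => v (t + k)%N ^+ 2)) [leRHS](big_cat_nat (n := k))//=; last exact: ltnW.
rewrite -[X in \sum_(X <= i < M) _](add0n k) big_addn lerDr.
by apply: sumr_ge0 => t _; exact: sqr_ge0.
Qed.

Lemma cvg_inv_shift k : (fun n => (n + k)%:R^-1 : R) @ \oo --> (0 : R).
Proof. by rewrite (cvg_shiftn k (fun n => n%:R^-1 : R)) -cvg_shiftS; exact: cvg_harmonic. Qed.

Lemma cvg_ratio_shift k : (fun n => n%:R / (n + k)%:R : R) @ \oo --> (1 : R).
Proof.
have : (fun n => 1 - k%:R * (n + k)%:R^-1 : R) @ \oo --> (1 - k%:R * 0 : R).
  by apply: cvgB; [exact: cvg_cst|apply: cvgMr; exact: cvg_inv_shift].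
rewrite mulr0 subr0; apply: cvg_trans; apply: near_eq_cvg; near=> n.
have n0 : (0 < n)%N by near: n; exact: nbhs_infty_gt.
have N0 : (n + k)%:R != 0 :> R by rewrite pnatr_eq0 -lt0n ltn_addr.
by rewrite -[X in X - _](@mulfV _ (n + k)%:R)// -mulrBl natrD addrK.
Unshelve. all: by end_near. Qed.

Lemma avg_shift u (l : R) k : avg u @ \oo --> l ->
  (fun n => (n + k)%:R^-1 * \sum_(t < n) u t) @ \oo --> l.
Proof.
move=> ul; have : (fun n => avg u n * (n%:R / (n + k)%:R)) @ \oo --> l.
  by rewrite -[X in _ --> X]mulr1; apply: cvgM => //; exact: cvg_ratio_shift.
apply: cvg_trans; apply: near_eq_cvg; near=> n; rewrite /= /avg.
have n0 : (0 < n)%N by near: n; exact: nbhs_infty_gt.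
have N0 : n%:R != 0 :> R by rewrite pnatr_eq0 -lt0n.
by field; rewrite N0 -natrD pnatr_eq0 -lt0n ltn_addr.
Unshelve. all: by end_near. Qed.

Lemma crosscov_cvg y z (my mz c : R) k : avg y @ \oo --> my -> avg z @ \oo --> mz ->
  avg (fun t => y t * z (t + k)%N) @ \oo --> c ->
  (fun M => crosscov M y z k) @ \oo --> c - my * mz.
Proof.
(* With [M = n + k] the sum has exactly [n] terms while means and normalisation use [n + k] points;
   the ratio of the two lengths tends to 1. *)
move=> cy cz cyz; rewrite -(cvg_shiftn k).
have s3 : (fun n => (n + k)%:R^-1 * \sum_(t < n) z (t + k)%N) @ \oo --> mz.
  have -> : (fun n => (n + k)%:R^-1 * \sum_(t < n) z (t + k)%N) =
      (fun n => avg z (n + k) - (n + k)%:R^-1 * \sum_(t < k) z t).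
    apply/funext => n; rewrite /avg -mulrBr; congr (_ * _).
    rewrite -(big_mkord xpredT z) (big_cat_nat (n := k))//= ?leq_addl//.
    have -> : \sum_(k <= i < n + k) z i = \sum_(t < n) z (t + k)%N.
      by rewrite -{1}(add0n k) big_addn addnK big_mkord.
    by rewrite big_mkord addrAC subrr add0r.
  rewrite -[X in _ --> X]subr0; apply: cvgB.
    by rewrite (cvg_shiftn k (avg z)).
  have : (fun n => (n + k)%:R^-1 * \sum_(t < k) z t) @ \oo --> 0 * \sum_(t < k) z t.
    by apply: cvgMl; exact: cvg_inv_shift.
  by rewrite mul0r.
have cy' : (fun n => avg y (n + k)) @ \oo --> my by rewrite (cvg_shiftn k (avg y)).
have cz' : (fun n => avg z (n + k)) @ \oo --> mz by rewrite (cvg_shiftn k (avg z)).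
have : (fun n => (n + k)%:R^-1 * \sum_(t < n) (y t * z (t + k)%N)
    - avg z (n + k) * ((n + k)%:R^-1 * \sum_(t < n) y t)
    - avg y (n + k) * ((n + k)%:R^-1 * \sum_(t < n) z (t + k)%N)
    + n%:R / (n + k)%:R * (avg y (n + k) * avg z (n + k))) @ \oo --> c - my * mz.
  have -> : c - my * mz = c - mz * my - my * mz + 1 * (my * mz) by ring.
  apply: cvgD; last by apply: cvgM; [exact: cvg_ratio_shift|exact: cvgM].
  apply: cvgB; last exact: cvgM.
  by apply: cvgB; [exact: (avg_shift k cyz)|apply: cvgM => //; exact: (avg_shift k cy)].
apply: cvg_trans; apply: near_eq_cvg; near=> n.
have n0 : (0 < n)%N by near: n; exact: nbhs_infty_gt.
rewrite /= /crosscov ifT ?addnK; last by rewrite -{1}(add0n k) ltn_add2r.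
set Y := avg y _; set Z := avg z _; set N := (n + k)%:R^-1.
have -> : \sum_(t < n) (y t - Y) * (z (t + k)%N - Z) =
  \sum_(t < n) y t * z (t + k)%N - Z * (\sum_(t < n) y t) - Y * (\sum_(t < n) z (t + k)%N)
   + n%:R * (Y * Z).
  rewrite !mulr_sumr -!sumrB mulr_natl -[n in _ *+ n]card_ord -sumr_const -big_split/=.
  by apply: eq_bigr => t _; ring.
by ring.
Unshelve. all: by end_near. Qed.

End empirical_autocovariance.

(** * Projected autocovariances along a fixed trajectory *)

Section deterministic_limits.
Context {R : realType}.

Lemma finite_support_geo (B C : R) (s : nat -> R) N : 0 < B < 1 -> 0 <= C ->
  (forall k, `|s k| <= C) -> (forall k, (N <= k)%N -> s k = 0) -> geo B s.
Proof.
move=> /andP[B0 B1] C0 sC sN; exists (C / B ^+ N) => k; have [Nk|kN] := leqP N k.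
  by rewrite sN// normr0 mulr_ge0 ?exprn_ge0 ?divr_ge0 ?exprn_ge0// ltW.
apply: (le_trans (sC k)); rewrite -mulrA ler_peMr// mulrC ler_pdivlMr ?exprn_gt0// mul1r.
by apply: ler_wiXn2l; [exact: ltW|exact: ltW|exact: ltnW].
Qed.

(** [Pi] picks a minimiser with [xget], falling back on the zero sequence; existence of a minimiser
    excludes the fallback. *)
Lemma Pi_is_proj (delta B : R) r s : 0 <= 1 - delta -> 1 - delta <= B -> B < 1 ->
  (forall k, r k = s `|k|%N) -> geo B s -> is_proj (1 - delta) r (Pi delta r).
Proof.
move=> d0 dB B1 rE gs; have [m pm] := proj_exists d0 dB B1 rE gs.
by rewrite /Pi; case: xgetP => [//|/(_ m)].
Qed.

(** The observed sequence [u M] may depend on [M], as it does when the weights are re-estimated with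
    each sample size. *)
Lemma Pi_autocov_cvg (delta : R) (u : nat -> nat -> R) (c : nat -> R) : 0 <= 1 - delta < 1 ->
  (forall k, (fun M => crosscov M (u M) (u M) k) @ \oo --> c k) -> pos_on (1 - delta) c ->
  (forall M k, Pi delta (autocov M (u M)) k = Pi delta (autocov M (u M)) (Posz `|k|%N)) /\
  (forall k : nat, (fun M => Pi delta (autocov M (u M)) (Posz k)) @ \oo --> c k) /\
  exists C, forall M (k : nat), `|Pi delta (autocov M (u M)) (Posz k)| <= C * (1 - delta) ^+ k.
Proof.
move=> /andP[d0 d1] cv pc; set b := 1 - delta in d0 d1 pc *.
(* A ratio in ]0, 1[ that is at least [b]; the value 1/2 only guards against [b = 0]. *)
pose B := Num.max b 2^-1.
have bB : b <= B by rewrite le_max lexx.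
have B0 : 0 < B by rewrite lt_max orbC invr_gt0 ltr0n.
have B1 : B < 1 by rewrite gt_max d1 invf_lt1 ?ltr1n.
have [C hC] : exists C, forall M k, `|crosscov M (u M) (u M) k| <= C.
  have : bounded_fun (fun M => crosscov M (u M) (u M) 0%N).
    by apply: cvg_seq_bounded; apply/cvg_ex; exists (c 0%N); exact: cv.
  move=> [C [_ hC]]; exists (C + 1) => M k; apply: (le_trans (crosscov_le _ _ _)).
  by apply: (le_trans (ler_norm _)); apply: (hC (C + 1)) => //; rewrite ltrDl.
have C0 : 0 <= C := le_trans (normr_ge0 _) (hC 0%N 0%N).
have gs M : geo B (crosscov M (u M) (u M)).
  apply: (@finite_support_geo _ C _ M) => //; first by rewrite B0.
  by move=> k Mk; rewrite /crosscov ltnNge Mk.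
have pj M : is_proj b (autocov M (u M)) (Pi delta (autocov M (u M))).
  exact: (Pi_is_proj d0 bB B1 (autocov_crosscov M (u M)) (gs M)).
have [h1 h2] := proj_cvg d0 bB B1 (fun M => autocov_crosscov M (u M)) gs hC cv pc pj.
split=> [M k|]; first by have [mm _] := pj M; exact: (in_Minf_even mm).
by split => //; exists (C * wsum (fun k => b ^+ k)).
Qed.

Lemma dominated_conclusion (b C : R) (h : nat -> int -> R) (c : int -> R) : 0 <= b < 1 ->
  (forall M k, h M k = h M (Posz `|k|%N)) -> (forall k, c k = c (Posz `|k|%N)) ->
  (forall M (k : nat), `|h M (Posz k)| <= C * b ^+ k) ->
  (forall k : nat, (fun M => h M (Posz k)) @ \oo --> c (Posz k)) ->
  (fun M => \esum_(k in [set: int]) ((h M k - c k) ^+ 2)%:E) @ \oo --> 0%E /\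
  (fun M => `|sumZ (h M) - sumZ c|) @ \oo --> 0.
Proof.
move=> b01 hE cE hC hc; have [b0 b1] := andP b01.
have C0 : 0 <= C := geo_ge0 (hC 0%N).
have cC k : `|c (Posz k)| <= C * b ^+ k.
  have cvn : (fun M => `|h M (Posz k)|) @ \oo --> `|c (Posz k)| by apply: cvg_norm; exact: hc.
  rewrite -(cvg_lim _ cvn)//; apply: limr_le; first by apply/cvg_ex; eexists; exact: cvn.
  by apply: nearW => M; exact: hC.
have gh M : geo b (h M \o Posz) by exists C; exact: hC.
have gc : geo b (c \o Posz) by exists C; exact: cC.
pose e M (k : nat) := h M (Posz k) - c (Posz k).
have eC M k : `|e M k| <= (C + C) * b ^+ k.
  by rewrite (le_trans (ler_normB _ _))// mulrDl lerD.
have ge M : geo b (e M) by exists (C + C); exact: eC.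
have e0 k : (fun M => e M k) @ \oo --> (0 : R).
  by rewrite -(subrr (c (Posz k))); apply: cvgB; [exact: hc|exact: cvg_cst].
split.
  have -> : (fun M => \esum_(k in [set: int]) ((h M k - c k) ^+ 2)%:E) =
      (fun M => (wsum (fun k => e M k ^+ 2))%:E).
    apply/funext => M; apply: (esum_int_even b01).
    - by move=> k; rewrite hE cE.
    - by move=> k; exact: sqr_ge0.
    - by apply: geo_mul; rewrite ?b0 ?ltW.
  apply: cvg_EFin; first exact: nearW.
  apply: (wsum_dominated (C := (C + C) * (C + C)) b01) => [M k|k].
    rewrite expr2 normrM (@le_trans _ _ ((C + C) * b ^+ k * ((C + C) * b ^+ k)))//.
      by rewrite ler_pM.
    rewrite mulrACA ler_wpM2l ?mulr_ge0 ?addr_ge0// ler_piMr ?exprn_ge0// exprn_ile1//.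
    exact: ltW.
  by rewrite -(mulr0 0); apply: cvgM; exact: e0.
have -> : (fun M => `|sumZ (h M) - sumZ c|) = (fun M => `|wsum (e M)|).
  apply/funext => M; rewrite (sumZ_even b01 (hE M) (gh M)) (sumZ_even b01 cE gc); congr `|_|.
  have := wsum_lin b01 1 (- 1) (gh M) gc; rewrite mul1r mulN1r => <-.
  by congr wsum; apply/funext => k; rewrite /e /= mul1r mulN1r.
rewrite -[X in _ --> X](normr0 R); apply: cvg_norm; exact: (wsum_dominated b01 eC).
Qed.

End deterministic_limits.

(** * Convergence of the estimator *)

Lemma ae_distribution d d' (S : measurableType d) (T : measurableType d') (R : realType)
    (P : probability S R) (f : {mfun S >-> T}) (Z : T -> Prop) :
  {ae distribution P f, forall y, Z y} -> {ae P, forall x, Z (f x)}.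
Proof.
move=> [N [mN N0 NZ]]; exists (f @^-1` N); split => //.
- rewrite -[X in measurable X]setTI; exact: measurable_funP.
- by move=> x /= nZ; exact: NZ.
Qed.

Section chain_averages.
Context {R : realType} dX (X : measurableType dX) (pi : probability X R) (Q : R.-pker X ~> X)
  dO (Om : measurableType dO) (P : X -> probability Om R) (Xc : nat -> Om -> X)
  dS (OmS : measurableType dS) (Ps : probability OmS R) (Xs : nat -> OmS -> X).
Hypothesis chainP : forall x, markov_chain Q (\d_x) (P x) Xc.
Hypothesis chainS : markov_chain Q pi Ps Xs.
Hypothesis rev : reversible Q pi.
Hypothesis HA3 : A3 Q pi.
Local Notation PT := (@path dX X).

Lemma measurable_trajectory d (S : measurableType d) (Y : nat -> S -> X) :
  (forall n, measurable_fun setT (Y n)) ->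
  measurable_fun setT (fun s => (fun n => Y n s) : PT).
Proof. by move=> mY; apply: measurable_to_path => n; exact: mY. Qed.

(** Stated for functionals of the whole trajectory: [g_i(X_t) g_j(X_(t+k))] is then the [t]-th shift
    of a single functional, and no chain of tuples has to be introduced. *)
Lemma chain_slln (F : PT -> R) x : measurable_fun setT F ->
  Ps.-integrable setT (fun om => (F (fun n => Xs n om))%:E) ->
  {ae P x, forall om, avg (fun t => F (fun n => Xc (t + n)%N om)) @ \oo -->
    fine (\int[Ps]_om (F (fun n => Xs n om))%:E)%E}.
Proof.
move=> mF iF.
pose tc := mk_mfun (measurable_trajectory (chainP x).1).
have mts := measurable_trajectory chainS.1; pose ts := mk_mfun mts.
pose L y : probability PT R := distribution (P y) tc.
pose nu : probability PT R := distribution Ps ts.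
have LE y A n : (forall i, measurable (A i)) ->
    L y (cylinder A n) = ((\1_(A 0%N) y)%:E * tailV Q A 1 n y)%E.
  move=> mA; apply: (etrans ((chainP y).2 A n mA)).
  rewrite integral_dirac ?diracT ?mul1e//.
  by apply: emeasurable_funM; [exact: measurable_indicE|exact: measurable_tailV].
have nuE A n : (forall i, measurable (A i)) ->
    nu (cylinder A n) = (\int[pi]_y ((\1_(A 0%N) y)%:E * tailV Q A 1 n y))%E.
  by move=> mA; exact: (chainS.2 A n mA).
have inu : nu.-integrable setT (EFin \o F).
  by apply: integrable_pushforward => //; exact/measurable_EFinP.
have := slln LE nuE (reversible_invariant rev) HA3 x inu.
move=> /ae_distribution; apply: filterS => om.
rewrite (integral_distribution (X := ts))//; last exact/measurable_EFinP.
apply: cvg_trans; apply: near_eq_cvg; apply: nearW => n.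
rewrite /avg /birkhoff_sum; congr (_ * _); apply: eq_bigr => i _.
congr F; apply/funext => k; rewrite iter_shift.
by [].
Qed.

End chain_averages.

(** * Polarization and the limit of the estimator along a fixed trajectory *)

Section estimator_limit.
Context {R : realType}.

Lemma pos_on_widen (b1 b2 : R) c : b1 <= b2 -> pos_on b1 c -> pos_on b2 c.
Proof.
move=> b12 pc p pb; apply: pc => a /andP[a1 a2]; apply: pb.
by rewrite (le_trans _ a1) ?lerN2// (le_trans a2).
Qed.

Lemma pos_on_cadd (b : R) c1 c2 x y : 0 <= x -> 0 <= y -> pos_on b c1 -> pos_on b c2 ->
  pos_on b (fun k => x * c1 k + y * c2 k).
Proof.
by move=> x0 y0 p1 p2 p pb; rewrite moment_form_cadd addr_ge0 ?mulr_ge0 ?p1 ?p2.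
Qed.

Variables (dT : measure_display) (T : measurableType dT) (d : nat) (g : 'I_d -> T -> R) (delta : 'I_d -> R)
  (G : 'I_d -> 'I_d -> nat -> R) (w : nat -> 'I_d -> R) (wl : 'I_d -> R) (x : nat -> T).
Hypothesis G_sym : forall i j k, G i j k = G j i k.

(** The autocovariance of [a g_i + b g_j] when [G] holds the cross-covariances. *)
Definition comb (a b : R) (i j : 'I_d) (k : nat) : R :=
  a ^+ 2 * G i i k + a * b * (G i j k + G j i k) + b ^+ 2 * G j j k.

Hypothesis G_hankel : forall a b i j N (s : nat -> R),
  0 <= \sum_(p < N) \sum_(q < N) s p * s q * comb a b i j (p + q).
Hypothesis delta_bounds : forall i, 0 <= 1 - delta i < 1.
Hypothesis G_pos : forall i, pos_on (1 - delta i) (G i i).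
Hypothesis emp_cvg : forall i j k,
  (fun M => crosscov M (g i \o x) (g j \o x) k) @ \oo --> G i j k.
Hypothesis w_cvg : forall i, w ^~ i @ \oo --> wl i.
Hypothesis wl0 : forall i, wl i != 0.

Definition geo_limit (h : nat -> int -> R) (c : nat -> R) := exists b C : R,
  [/\ 0 <= b < 1, forall M k, h M k = h M (Posz `|k|%N),
    forall M (k : nat), `|h M (Posz k)| <= C * b ^+ k &
    forall k : nat, (fun M => h M (Posz k)) @ \oo --> c k].

Lemma delta_min_bounds i j : 0 <= 1 - Num.min (delta i) (delta j) < 1.
Proof. by rewrite /Order.min; case: ifP => _. Qed.

(** The dominated pair is [comb a b] and [comb a (- b)], whose cross terms cancel in the sum. Taking
    the smaller gap enlarges the interval, so positivity of both [G i i] and [G j j] carries over to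
    it. *)
Lemma comb_pos a b i j : pos_on (1 - Num.min (delta i) (delta j)) (comb a b i j).
Proof.
set dl := Num.min _ _.
have dli : 1 - delta i <= 1 - dl by rewrite lerD2l lerN2 ge_min lexx.
have dlj : 1 - delta j <= 1 - dl by rewrite lerD2l lerN2 ge_min lexx orbT.
apply: (@pos_on_dominated _ _ _ (comb a (- b) i j)
   (fun k => (2 * a ^+ 2) * G i i k + (2 * b ^+ 2) * G j j k)).
- by have /andP[-> /ltW ->] := delta_min_bounds i j.
- by move=> p; rewrite moment_form_sqr; exact: (G_hankel a b i j (size p) (fun k => p`_k)).
- by move=> p; rewrite moment_form_sqr; exact: (G_hankel a (- b) i j (size p) (fun k => p`_k)).
- by move=> k; rewrite /comb; ring.
- have sq2 (y : R) : 0 <= 2 * y ^+ 2 by rewrite mulr_ge0 ?sqr_ge0.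
  by apply: pos_on_cadd => //; [apply: (pos_on_widen dli)|apply: (pos_on_widen dlj)]; exact: G_pos.
Qed.

(** The sign [e] is 1 or -1 in use, so one statement covers both projections of the polarization
    formula. *)
Lemma Pi_comb_limit (e : R) i j : let dl := Num.min (delta i) (delta j) in
  geo_limit (fun M => Pi dl (autocov M (fun t => w M i * g i (x t) + e * w M j * g j (x t))))
    (comb (wl i) (e * wl j) i j).
Proof.
move=> dl; have dlb : 0 <= 1 - dl < 1 := delta_min_bounds i j.
have cv k : (fun M => crosscov M (fun t => w M i * g i (x t) + e * w M j * g j (x t))
    (fun t => w M i * g i (x t) + e * w M j * g j (x t)) k) @ \oo --> comb (wl i) (e * wl j) i j k.
  have -> : (fun M => crosscov M (fun t => w M i * g i (x t) + e * w M j * g j (x t))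
      (fun t => w M i * g i (x t) + e * w M j * g j (x t)) k) =
    (fun M => w M i * w M i * crosscov M (g i \o x) (g i \o x) k +
      w M i * (e * w M j) * (crosscov M (g i \o x) (g j \o x) k + crosscov M (g j \o x) (g i \o x) k)
      + (e * w M j) * (e * w M j) * crosscov M (g j \o x) (g j \o x) k).
    apply/funext => M.
    by rewrite (crosscov_lin M (g i \o x) (g j \o x) (w M i) (e * w M j) k) !expr2.
  rewrite /comb !expr2.
  have cj : (fun M => e * w M j) @ \oo --> e * wl j by apply: cvgMr; exact: w_cvg.
  have ci : w ^~ i @ \oo --> wl i by exact: w_cvg.
  apply: cvgD; [apply: cvgD|]; apply: cvgM; try exact: emp_cvg.
  - exact: (cvgM ci ci).
  - exact: (cvgM ci cj).
  - by apply: cvgD; exact: emp_cvg.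
  - exact: (cvgM cj cj).
have [h1 [h2 [C h3]]] := Pi_autocov_cvg dlb cv (@comb_pos (wl i) (e * wl j) i j).
by exists (1 - dl), C; split.
Qed.

Lemma polarization_limit i j : let dl := Num.min (delta i) (delta j) in
  geo_limit (fun M => if w M i * w M j != 0 then
    fun k => (4 * w M i * w M j)^-1 *
      (Pi dl (autocov M (fun t => w M i * g i (x t) + w M j * g j (x t))) k -
       Pi dl (autocov M (fun t => w M i * g i (x t) - w M j * g j (x t))) k)
    else fun _ => 0) (G i j).
Proof.
move=> dl; have [b [C [b01 hE hC hc]]] := Pi_comb_limit 1 i j.
have [b' [C' [b01' hE' hC' hc']]] := Pi_comb_limit (- 1) i j.
rewrite -/dl in hE hC hc hE' hC' hc'.
pose u M t := w M i * g i (x t) + w M j * g j (x t).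
pose v M t := w M i * g i (x t) - w M j * g j (x t).
have uE M : (fun t => w M i * g i (x t) + 1 * w M j * g j (x t)) = u M.
  by apply/funext => t; rewrite mul1r.
have vE M : (fun t => w M i * g i (x t) + (- 1) * w M j * g j (x t)) = v M.
  by apply/funext => t; rewrite mulN1r mulNr.
have {}hE M k : Pi dl (autocov M (u M)) k = Pi dl (autocov M (u M)) (Posz `|k|%N).
  by rewrite -uE; exact: hE.
have {}hE' M k : Pi dl (autocov M (v M)) k = Pi dl (autocov M (v M)) (Posz `|k|%N).
  by rewrite -vE; exact: hE'.
have {}hC M (k : nat) : `|Pi dl (autocov M (u M)) (Posz k)| <= C * b ^+ k.
  by rewrite -uE; exact: hC.
have {}hC' M (k : nat) : `|Pi dl (autocov M (v M)) (Posz k)| <= C' * b' ^+ k.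
  by rewrite -vE; exact: hC'.
have {}hc k : (fun M => Pi dl (autocov M (u M)) (Posz k)) @ \oo --> comb (wl i) (1 * wl j) i j k.
  by rewrite -(funext uE); exact: hc.
have {}hc' k : (fun M => Pi dl (autocov M (v M)) (Posz k)) @ \oo --> comb (wl i) (- 1 * wl j) i j k.
  by rewrite -(funext vE); exact: hc'.
(* The inverse of 0 being 0, [e] is defined for every [M]; being convergent, it is bounded over all
   [M], including those where the estimator takes its default value. *)
pose e M := (4 * w M i * w M j)^-1.
have ce : e @ \oo --> (4 * wl i * wl j)^-1.
  apply: cvgV; first by rewrite !mulf_neq0.
  by apply: cvgM; [apply: cvgMr|]; exact: w_cvg.
have [E hEb] : exists E, forall M, `|e M| <= E.
  have : bounded_fun e by apply: cvg_seq_bounded; apply/cvg_ex; eexists; exact: ce.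
  by move=> [E [_ hE1]]; exists (E + 1) => M; apply: (hE1 (E + 1)) => //; rewrite ltrDl.
have E0 : 0 <= E := le_trans (normr_ge0 _) (hEb 0%N).
have [b0 b1] := andP b01; have [b0' b1'] := andP b01'.
have C0 : 0 <= C := geo_ge0 (hC 0%N); have C0' : 0 <= C' := geo_ge0 (hC' 0%N).
(* [geo_limit] hides the ratios of the two projections, so their maximum is taken. *)
exists (Num.max b b'), (E * (C + C')); split.
- by rewrite le_max b0/= gt_max b1.
- move=> M k; case: ifP => // _; congr (_ * (_ - _)).
    exact: (hE M k).
  exact: (hE' M k).
- move=> M k; case: ifP => _; last by rewrite normr0 !mulr_ge0 ?addr_ge0 ?exprn_ge0// le_max b0.
  rewrite normrM -[leRHS]mulrA; apply: ler_pM => //; first exact: hEb.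
  rewrite (le_trans (ler_normB _ _))// mulrDl; apply: lerD.
    apply: (le_trans (hC M k)); rewrite ler_wpM2l// lerXn2r ?nnegrE ?le_max ?lexx ?b0//.
  apply: (le_trans (hC' M k)); rewrite ler_wpM2l// lerXn2r ?nnegrE ?le_max ?lexx ?b0 ?orbT//.
- move=> k.
  (* Polarization yields the symmetrised [G i j + G j i]; symmetry of [G] turns it into
     [2 G i j]. *)
  have -> : G i j k = (4 * wl i * wl j)^-1 *
      (comb (wl i) (1 * wl j) i j k - comb (wl i) (- 1 * wl j) i j k).
    rewrite /comb (G_sym j i k); field; by rewrite !wl0.
  have : (fun M => e M * (Pi dl (autocov M (u M)) (Posz k) - Pi dl (autocov M (v M)) (Posz k)))
      @ \oo --> (4 * wl i * wl j)^-1 *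
      (comb (wl i) (1 * wl j) i j k - comb (wl i) (- 1 * wl j) i j k).
    by apply: cvgM => //; apply: cvgB.
  apply: cvg_trans; apply: near_eq_cvg.
  (* The limiting weights are nonzero, so the default branch is taken for finitely many [M] only. *)
  have : \forall M \near \oo, w M i * w M j != 0.
    have cw : (fun M => w M i * w M j) @ \oo --> wl i * wl j by apply: cvgM; exact: w_cvg.
    have wlp : wl i * wl j != 0 by rewrite mulf_neq0.
    move/cvgrPdist_lt : cw => /(_ `|wl i * wl j|); rewrite normr_gt0 => /(_ wlp).
    apply: filterS => M; apply: contraTneq => ->; rewrite subr0 ltxx//.
  by apply: filterS => M -> /=.
Qed.

Lemma gammahat_limit i j : geo_limit (fun M => gammahat g delta M (w M) x i j) (G i j).
Proof.
rewrite /gammahat; case: eqVneq => [->|ij].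
  have [h1 [h2 [C h3]]] := Pi_autocov_cvg (delta_bounds j) (@emp_cvg j j) (@G_pos j).
  by exists (1 - delta j), C; split.
case: ltnP => _; first exact: polarization_limit.
rewrite (_ : G i j = G j i); last by apply/funext => k; exact: G_sym.
exact: polarization_limit.
Qed.

End estimator_limit.

Lemma cc_comb d (X : measurableType d) (R : realType) (pi : probability X R) (Q : R.-pker X ~> X)
    dS (S : measurableType dS) (Ps : probability S R) (Xs : nat -> S -> X) (f g : X -> R) a b k :
  markov_chain Q pi Ps Xs -> reversible Q pi -> sqint pi f -> sqint pi g ->
  cc Ps Xs k (fun x => a * f x + b * g x) (fun x => a * f x + b * g x) =
  a ^+ 2 * cc Ps Xs k f f + a * b * (cc Ps Xs k f g + cc Ps Xs k g f) + b ^+ 2 * cc Ps Xs k g g.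
Proof.
move=> ch rev sf sg; have sfg := sqint_lin a b sf sg.
rewrite (cc_linl ch)// !(cc_linr ch)//; ring.
Qed.

Theorem theorem2
  (R : realType)
  (dX : measure_display) (X : measurableType dX) (dist : X -> X -> R)
  (pi : probability X R) (Q : R.-pker X ~> X)
  (dO : measure_display) (Om : measurableType dO)
  (P : X -> probability Om R) (Xc : nat -> Om -> X)
  (dS : measure_display) (OmS : measurableType dS)
  (Ps : probability OmS R) (Xs : nat -> OmS -> X)
  (d : nat) (g : 'I_d -> X -> R)
  (w : nat -> Om -> 'I_d -> R) (wlim : 'I_d -> R) (delta : 'I_d -> R) :
  polish_borel dist ->
  (* P x is the law of the chain with kernel Q started at x *)
  (forall x, markov_chain Q (\d_x) (P x) Xc) ->
  (* a stationary version of the chain, used to define gamma *)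
  markov_chain Q pi Ps Xs ->
  A1 Q P Xc -> reversible Q pi -> A3 Q pi -> B1 pi g ->
  (forall M i, measurable_fun setT (fun om => w M om i)) ->
  (forall x, {ae P x, forall om, forall i, (fun M => w M om i) @ \oo --> wlim i}) ->
  (forall i, wlim i != 0) ->
  (forall i, 0 < delta i /\
     exists F, spectral_measure_of (gamma Ps Xs (g i) (g i)) F /\ delta i <= Delta F) ->
  forall (i j : 'I_d) (x : X),
  {ae P x, forall om,
    (fun M => \esum_(k in [set: int])
        ((gammahat g delta M (w M om) (fun t => Xc t om) i j k
          - gamma Ps Xs (g i) (g j) k) ^+ 2)%:E) @ \oo --> 0%E
    /\
    (fun M => `| sumZ (gammahat g delta M (w M om) (fun t => Xc t om) i j)
               - sumZ (gamma Ps Xs (g i) (g j)) |) @ \oo --> 0}.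
Proof.
move=> _ chP chS _ rev HA3 HB1 _ hw wl0 hd i j x.
have sg i0 : sqint pi (g i0) by exact: HB1.
(* Centering the functions beforehand makes covariances plain inner products, to which [cc_hankel]
   applies. *)
pose G i0 j0 k := cc Ps Xs k (center Ps Xs (g i0)) (center Ps Xs (g j0)).
have sc i0 : sqint pi (center Ps Xs (g i0)) by exact: (sqint_center Ps Xs (sg i0)).
have G_sym i0 j0 k : G i0 j0 k = G j0 i0 k by exact: (cc_sym chS rev).
have G_hankel a b i0 j0 N (s : nat -> R) :
    0 <= \sum_(p < N) \sum_(q < N) s p * s q * comb G a b i0 j0 (p + q).
  have := cc_hankel chS rev N s (sqint_lin a b (sc i0) (sc j0)).
  congr (0 <= _); apply: eq_bigr => p _; apply: eq_bigr => q _; congr (_ * _).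
  exact: (cc_comb a b (p + q) chS rev (sc i0) (sc j0)).
have gE i0 j0 k : gamma Ps Xs (g i0) (g j0) k = G i0 j0 `|k|%N.
  exact: (gammaE chS rev k (sg i0) (sg j0)).
have delta_bounds i0 : 0 <= 1 - delta i0 < 1.
  have [d0 [F [hF dF]]] := hd i0; exact: (spectral_radius_bounds hF d0 dF).
have G_pos i0 : pos_on (1 - delta i0) (G i0 i0).
  have [d0 [F [hF dF]]] := hd i0; have := spectral_pos_on hF d0 dF.
  by congr pos_on; apply/funext => k; rewrite /= gE.
have mean_cvg i0 : {ae P x, forall om, avg (fun t => g i0 (Xc t om)) @ \oo --> mean Ps Xs (g i0)}.
  have mg : measurable_fun setT (fun w : @path dX X => g i0 (coord 0 w)).
    by apply: (measurableT_comp (sg i0).1); exact: measurable_coord.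
  have ig : Ps.-integrable setT (fun om => (g i0 (Xs 0%N om))%:E).
    have := sqint_mul_integrable chS rev 0 0 (sg i0) (sqint_cst pi 1).
    by under eq_fun do rewrite mulr1.
  have := chain_slln chP chS rev HA3 x mg ig; apply: filterS => om.
  by suff -> : (fun t => g i0 (coord 0 (fun n => Xc (t + n)%N om))) = (fun t => g i0 (Xc t om));
    [|apply/funext => t; rewrite /coord addn0].
have prod_cvg i0 j0 k : {ae P x, forall om,
    avg (fun t => g i0 (Xc t om) * g j0 (Xc (t + k)%N om)) @ \oo --> cc Ps Xs k (g i0) (g j0)}.
  have mg : measurable_fun setT (fun w : @path dX X => g i0 (coord 0 w) * g j0 (coord k w)).
    apply: measurable_funM; [apply: (measurableT_comp (sg i0).1)|apply: (measurableT_comp (sg j0).1)];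
      exact: measurable_coord.
  have ig := sqint_mul_integrable chS rev 0 k (sg i0) (sg j0).
  have := chain_slln chP chS rev HA3 x mg ig; apply: filterS => om.
  by suff -> : (fun t => g i0 (coord 0 (fun n => Xc (t + n)%N om)) *
      g j0 (coord k (fun n => Xc (t + n)%N om))) = (fun t => g i0 (Xc t om) * g j0 (Xc (t + k)%N om));
    [|apply/funext => t; rewrite /coord addn0].
(* Finitely many functions and countably many lags share one null set; the weights [w M om] enter
   only once [om] is fixed. *)
have all_mean : {ae P x, forall om, forall i0, avg (fun t => g i0 (Xc t om)) @ \oo --> mean Ps Xs (g i0)}.
  exact: filter_forall mean_cvg.
have all_prod : {ae P x, forall om, forall i0 j0 k,
    avg (fun t => g i0 (Xc t om) * g j0 (Xc (t + k)%N om)) @ \oo --> cc Ps Xs k (g i0) (g j0)}.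
  apply: filter_forall => i0; apply: filter_forall => j0; apply/ae_foralln; exact: prod_cvg.
move: (hw x) all_mean all_prod; apply: filterS3 => om wom hm hp.
have emp i0 j0 k : (fun M => crosscov M (fun t => g i0 (Xc t om)) (fun t => g j0 (Xc t om)) k) @ \oo
    --> G i0 j0 k.
  rewrite /G (cc_center chS rev)//; exact: crosscov_cvg.
have [b [C [b01 hE hC hc]]] := gammahat_limit (w := fun M => w M om) G_sym G_hankel delta_bounds
  G_pos emp wom wl0 i j.
apply: (dominated_conclusion (b := b) (C := C)) => //.
- by move=> k; rewrite !gE.
- by move=> k; rewrite gE.
Qed.
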